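(* Let $r,a$ be positive integers with $\gcd(r,a)=1$ and $a<r-a$, and let $G\subset \mathrm{GL}(3,\mathbb{C})$ be the cyclic group of type $\frac{1}{r}(1,a,r-a)$. For every compact divisor $D$ of $G\text{-}\mathrm{Hilb}(\mathbb{C}^3)$ (i.e. every torus-invariant prime divisor $D=D_v$ corresponding to a ray $v$ of $\mathrm{Fan}(G)$ other than those generated by $e_1,e_2,e_3$), one has $$\mathrm{SC}(D)=\mathrm{EC}(D)\otimes\chi_1,\qquad\text{where } \mathrm{EC}(D)\otimes\chi_1:=\{\chi\otimes\chi_1\mid \chi\in \mathrm{EC}(D)\}.$$
   Context: Group and weights. $G$ is cyclic of order $r$, generated by $g=\mathrm{diag}(\varepsilon,\varepsilon^{a},\varepsilon^{r-a})$, $\varepsilon$ a primitive $r$-th root of unity; $G^\vee$ is its character group and $\chi_i\in G^\vee$ is defined by $\chi_i(g)=\varepsilon^i$; $\otimes$ is multiplication of characters. Let $\mathcal M$ be the set of monomials in $\mathbb{C}[x,y,z]$. For $X\in\mathcal M$, $\mathrm{wt}(X)\in G^\vee$ is the character with $X(h\cdot p)=\mathrm{wt}(X)(h)X(p)$ for all $h\in G,p\in\mathbb{C}^3$; so $\mathrm{wt}(x)=\chi_1$, $\mathrm{wt}(y)=\chi_a$, $\mathrm{wt}(z)=\chi_{r-a}$. $G$-graphs and the fan. A $G$-graph is a set $\Gamma=\{X\in\mathcal M: X\notin I\}$, $I$ a monomial ideal, such that $\mathrm{wt}:\Gamma\to G^\vee$ is bijective. For a monomial $X$, $\mathrm{wt}_\Gamma(X)$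 is the unique element of $\Gamma$ with the same weight as $X$. $\mathrm{Span}(u_1,\dots,u_n)$ is the set of all monomials dividing some $u_i$. Let $N=\mathbb{Z}^3+\mathbb{Z}\cdot\frac1r(1,a,r-a)\subset\mathbb{Q}^3$, $N_{\mathbb R}=N\otimes\mathbb R$, $M$ the dual lattice (invariant Laurent monomials). With $A_\Gamma$ the minimal generators of the ideal of monomials not in $\Gamma$, put $\sigma(\Gamma)=\{w\in N_{\mathbb R}: w\cdot X\ge w\cdot \mathrm{wt}_\Gamma(X)\ \forall X\in A_\Gamma\}$, where $w\cdot X$ is the inner product of $w$ with the exponent vector. For this $G$ every $\sigma(\Gamma)$ is three-dimensional, and these cones with their faces form a fan $\mathrm{Fan}(G)$ supported on the positive octant; write $\Gamma_\sigma$ for the $G$-graph of a three-dimensional cone $\sigma$. $G\text{-}\mathrm{Hilb}(\mathbb{C}^3)$ denotes the toric variety of $\mathrm{Fan}(G)$ (the normalization of the component of the $G$-Hilbert scheme dominating $\mathbb{C}^3/G$). Let $e_1,e_2,e_3$ be the standard basis of $\mathbb{R}^3$. A vertex $v$ means a ray of $\mathrm{Fan}(G)$ other than those of $e_1,e_2,e_3$; $D_v$ is its (compact exceptional) divisor. Essential characters. A socle of a $G$-graph $\Gamma$ is a monomial in $\Gamma$ not dividing any other element of $\Gamma$. $\mathrm{EC}(D_v)$ is the intersection, over all three-dimensional cones $\sigma$ of $\mathrm{Fan}(G)$ containing $v$, of the sets $\{\mathrm{wt}(X): X \text{ a socle of } \Gamma_\sigma\}$. Edges and markings. The edges at $v$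 are the two-dimensional cones of $\mathrm{Fan}(G)$ containing $v$; the valency of $v$ is their number, which is 3, 4 or 5. For a two-dimensional cone meeting the interior of the octant, the primitive vector of $M$ orthogonal to it (unique up to sign) is a quotient $m_1/m_2$ of coprime monomials; its monomial ratio is $m_1:m_2$ and it is marked by the character $\mathrm{wt}(m_1)=\mathrm{wt}(m_2)$. Write $e_iv$ for the edge spanned by $e_i$ and $v$. Valleys. A $y$-valley (resp. $z$-valley) of $\Gamma$ is a monomial $x^my^n$ (resp. $x^mz^n$) in $\Gamma$ with $x^{m+1}y^n,x^my^{n+1}\in\Gamma$, $x^{m+1}y^{n+1}\notin\Gamma$ (resp. with $z$ in place of $y$). If $\Gamma$ has two valleys, they are of the form $x^{k_x}y^{k_y}$ and $x^{j_x}z^{j_z}$; letting $i_x,j_y,k_z$ be the least exponents with $x^{i_x},y^{j_y},z^{k_z}\notin\Gamma$, one has $\Gamma=\mathrm{Span}(x^{i_x-1}y^{k_y},x^{k_x}y^{j_y-1},x^{i_x-1}z^{j_z},x^{j_x}z^{k_z-1})$, $i_x=k_x+j_x+2$, $\mathrm{wt}(z^{k_z-1})=\mathrm{wt}(x^{k_x+1}y^{k_y+1})$, $\mathrm{wt}(y^{j_y-1})=\mathrm{wt}(x^{j_x+1}z^{j_z+1})$, and $\sigma(\Gamma)$ has four facets. Special characters. The set $\mathrm{SC}(D_v)$ is defined by cases. Case 1: $v$ has valency 3 (the unique vertex where lines from $e_1,e_2,e_3$ meet): $\mathrm{SC}(D_v)=\{\mathrm{wt}(x)\otimes\mathrm{wt}(x)\}=\{\chi_2\}$.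 Case 2: $v$ has valency 4 and its edges do not form two straight lines. Then $v$ is joined to $e_1$ and to $e_2$ or $e_3$; if $e_1v$ has ratio $y^j:z^i$, then $\mathrm{SC}(D_v)=\{\mathrm{wt}(x)\otimes\mathrm{wt}(y^j)\}$. Case 3: $v$ has valency 4 and its four edges lie two by two in two planes (two straight lines in a planar slice). Then there is a three-dimensional cone $\sigma(\Gamma)$ containing $v$, with $\Gamma$ having two valleys, such that (in the notation above) the two facets of $\sigma(\Gamma)$ containing $v$ have monomial ratios $y^{j_y-1}:x^{j_x+1}z^{j_z+1}$ and $z^{k_z-1}:x^{k_x+1}y^{k_y+1}$; and $\mathrm{SC}(D_v)=\{\mathrm{wt}(x^{i_x}y^{k_y+1}),\ \mathrm{wt}(x^{i_x}z^{j_z+1})\}$. Case 4: $v$ has valency 5. Then there are uniquely determined characters $\chi_l,\chi_m$ each marking a pair of edges at $v$, the fifth edge being marked by a distinct character; $\mathrm{SC}(D_v)=\{\chi_l\otimes\chi_m\}$. *)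

(* Defs.v *)
From mathcomp Require Import all_boot all_order all_algebra.
From mathcomp Require Import mpoly.
From mathcomp Require Import boolp classical_sets functions cardinality reals.
From mathcomp Require Import ring.

Import Order.TTheory GRing.Theory Num.Theory.
Local Open Scope classical_set_scope.
Local Open Scope card_scope.
Local Open Scope ring_scope.

(** Characters and weights.

    The character group of the cyclic group G generated by
    g = diag (eps, eps^a, eps^(r-a)) is represented by 'Z_r, where i : 'Z_r
    stands for the character chi_i with chi_i (g) = eps^i.  The product of
    characters is therefore the addition of 'Z_r.  Lemmas [character_chi] and
    [monomial_semi_invariant] below justify this encoding and the formula
    for [wt]. *)

Notation mon := 'X_{1..3}.

Definition mono (i j k : nat) : mon := [multinom nth 0%N [:: i; j; k] l | l < 3].

Definition dvdm (X Y : mon) : bool := (X <= Y)%MM.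

Definition chi (r i : nat) : 'Z_r := i%:R.

Definition wt (r a : nat) (X : mon) : 'Z_r :=
  chi r (X 0%R + a * X 1%R + (r - a) * X 2%R).

Definition ggen {C : fieldType} (r a : nat) (eps : C) : 'M[C]_3 :=
  diag_mx (\row_(i < 3) nth 0 [:: eps; eps ^+ a; eps ^+ (r - a)] i).

Definition chi_val {C : fieldType} {r : nat} (eps : C) (i : 'Z_r) (k : nat) : C :=
  eps ^+ (i * k).

Lemma expr_natZp (C : fieldType) (r : nat) (eps : C) (n : nat) : (1 < r)%N ->
  r.-primitive_root eps -> eps ^+ (n%:R : 'Z_r) = eps ^+ n.
Proof.
move=> r_gt1 eps_prim; rewrite val_Zp_nat //.
by apply/eqP; rewrite (eq_prim_root_expr eps_prim) modn_mod.
Qed.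

(* A map f with f k = chi (g ^+ k) for a homomorphism chi : G -> C^* is the
   same thing as an r-periodic multiplicative map on nat. *)
Lemma character_chi (C : fieldType) (r : nat) (eps : C) (f : nat -> C) :
    (1 < r)%N -> r.-primitive_root eps ->
    f 0%N = 1 -> (forall k l, f (k + l)%N = f k * f l) -> f r = 1 ->
  exists! i : 'Z_r, forall k, f k = chi_val eps i k.
Proof.
move=> r_gt1 eps_prim f0 fD fr.
have fX k : f k = f 1%N ^+ k.
  by elim: k => [|k IHk]; rewrite ?expr0 // -addn1 fD IHk exprD expr1.
have [i fi] : {i : 'I_r | f 1%N = eps ^+ i}.
  by apply: (prim_rootP eps_prim); rewrite -fX.
exists (i%:R : 'Z_r); split => [k|j fj].
  by rewrite /chi_val exprM expr_natZp // -fi -fX.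
have := fj 1%N; rewrite fi /chi_val muln1 => /eqP.
rewrite (eq_prim_root_expr eps_prim) => /eqP ij.
apply/ord_inj; rewrite val_Zp_nat // ij modn_small //.
by rewrite -[X in (_ < X)%N](Zp_cast r_gt1).
Qed.

Lemma monomial_semi_invariant (C : fieldType) (r a : nat) (eps : C)
    (X : mon) (k : nat) (p : 'cV[C]_3) :
    (1 < r)%N -> r.-primitive_root eps ->
  ('X_[X] : {mpoly C[3]}).@[fun i => (ggen r a eps ^+ k *m p) i 0] =
  chi_val eps (wt r a X) k * ('X_[X] : {mpoly C[3]}).@[fun i => p i 0].
Proof.
move=> r_gt1 eps_prim.
have gE : ggen r a eps ^+ k *m p =
    \col_i (nth 0 [:: eps; eps ^+ a; eps ^+ (r - a)] i ^+ k * p i 0).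
  elim: k => [|k IHk].
    by rewrite expr0 mul1mx; apply/colP => i; rewrite !mxE expr0 mul1r.
  rewrite exprS -mulmxE -mulmxA IHk /ggen mul_diag_mx.
  by apply/colP => i; rewrite !mxE exprS mulrA.
rewrite gE !mevalX /chi_val /wt /chi exprM expr_natZp //.
rewrite !big_ord_recl !big_ord0 !mxE /= !exprMn.
have -> : lift ord0 ord0 = 1%R :> 'I_3 by apply/val_inj.
have -> : lift ord0 (lift ord0 ord0) = 2%R :> 'I_3 by apply/val_inj.
have -> : ord0 = 0%R :> 'I_3 by apply/val_inj.
rewrite !exprD !exprMn -!exprM.
rewrite (mulnC k (X 0%R)) -(mulnA a k) -(mulnA a (X 1%R)) (mulnC k (X 1%R)).
rewrite -(mulnA (r - a)%N k) -(mulnA (r - a)%N (X 2%R)) (mulnC k (X 2%R)).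
ring.
Qed.

(* A monomial ideal is given by the set of monomials it contains. *)
Definition monomial_ideal (I : set mon) : Prop :=
  forall X Y : mon, I X -> I (X + Y)%MM.

Definition Ggraph (r a : nat) (Gamma : set mon) : Prop :=
  (exists I : set mon, monomial_ideal I /\ Gamma = ~` I) /\
  set_bij Gamma [set: 'Z_r] (wt r a).

Definition min_gen (Gamma : set mon) (X : mon) : Prop :=
  ~ Gamma X /\ forall Y : mon, ~ Gamma Y -> dvdm Y X -> Y = X.

Definition socle (Gamma : set mon) : set mon :=
  [set X | Gamma X /\ forall Y, Gamma Y -> dvdm X Y -> Y = X].

Definition dotm {R : realType} (w : 'rV[R]_3) (X : mon) : R :=
  \sum_(i < 3) w 0 i * (X i)%:R.

(* For a G-graph Gamma, the only Y allowed below is wt_Gamma (X). *)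
Definition sigma {R : realType} (r a : nat) (Gamma : set mon) : set 'rV[R]_3 :=
  [set w | forall X Y : mon, min_gen Gamma X ->
     Gamma Y -> wt r a Y = wt r a X -> dotm w Y <= dotm w X].

Definition is_face {R : realType} (F S : set 'rV[R]_3) : Prop :=
  exists u : 'cV[R]_3, (forall w, S w -> 0 <= (w *m u) 0 0) /\
    F = S `&` [set w | w *m u = 0].

(* The linear span of F has dimension k. *)
Definition has_dim {R : realType} (F : set 'rV[R]_3) (k : nat) : Prop :=
  exists B : 'M[R]_(k, 3), [/\ row_free B, forall i, F (row i B)
    & forall w, F w -> (w <= B)%MS].

Definition facet {R : realType} (F S : set 'rV[R]_3) : Prop :=
  is_face F S /\ has_dim F 2.

Definition fan_cone {R : realType} (r a k : nat) (F : set 'rV[R]_3) : Prop :=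
  exists Gamma : set mon,
    [/\ Ggraph r a Gamma, is_face F (sigma r a Gamma) & has_dim F k].

Definition ray {R : realType} (v : 'rV[R]_3) : set 'rV[R]_3 :=
  [set w | exists2 t : R, 0 <= t & w = t *: v].

Definition cone2 {R : realType} (u v : 'rV[R]_3) : set 'rV[R]_3 :=
  [set w | exists s t : R, [/\ 0 <= s, 0 <= t & w = s *: u + t *: v]].

Definition e_ (R : realType) (i : 'I_3) : 'rV[R]_3 := delta_mx 0 i.

(* A vertex is given by any vector spanning its ray. *)
Definition vertex {R : realType} (r a : nat) (v : 'rV[R]_3) : Prop :=
  fan_cone r a 1 (ray v) /\ forall i : 'I_3, ray v <> ray (e_ R i).

(* For this G every sigma Gamma is three-dimensional, so the three-dimensional
   cones of Fan(G) are exactly the sigma Gamma with Gamma a G-graph. *)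
Definition EC {R : realType} (r a : nat) (v : 'rV[R]_3) : set 'Z_r :=
  \bigcap_(Gamma in [set Gamma | Ggraph r a Gamma /\ sigma r a Gamma v])
    (wt r a @` socle Gamma).

Definition edges {R : realType} (r a : nat) (v : 'rV[R]_3) :
    set (set 'rV[R]_3) :=
  [set E | fan_cone r a 2 E /\ E v].

Definition valency {R : realType} (r a : nat) (v : 'rV[R]_3) (n : nat) : Prop :=
  edges r a v #= `I_n.

Definition invariant (r a : nat) (u : 'rV[int]_3) : Prop :=
  ((u 0 0 + a%:Z * u 0 1 + (r - a)%N%:Z * u 0 2)%:~R : 'Z_r) = 0.

Definition primitive (r a : nat) (u : 'rV[int]_3) : Prop :=
  [/\ invariant r a u, u != 0
    & forall (u' : 'rV[int]_3) (k : nat),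
        invariant r a u' -> u = u' *+ k -> k = 1%N].

Definition quotient (m1 m2 : mon) : 'rV[int]_3 :=
  \row_i ((m1 i)%:Z - (m2 i)%:Z).

Definition coprimem (m1 m2 : mon) : Prop :=
  forall X : mon, dvdm X m1 -> dvdm X m2 -> X = 0%MM.

(* As the primitive vector is unique up to sign, this is symmetric in m1, m2. *)
Definition has_ratio {R : realType} (r a : nat) (E : set 'rV[R]_3)
    (m1 m2 : mon) : Prop :=
  [/\ coprimem m1 m2, primitive r a (quotient m1 m2)
    & forall w, E w -> dotm w m1 = dotm w m2].

Definition marked {R : realType} (r a : nat) (E : set 'rV[R]_3)
    (c : 'Z_r) : Prop :=
  exists m1 m2 : mon,
    [/\ has_ratio r a E m1 m2, wt r a m1 = c & wt r a m2 = c].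

Definition plane {R : realType} (u : 'cV[R]_3) : set 'rV[R]_3 :=
  [set w | w *m u = 0].

(* Meant for v of valency 4, so that E1, E2, E3, E4 are distinct. *)
Definition two_lines {R : realType} (r a : nat) (v : 'rV[R]_3) : Prop :=
  exists (E1 E2 E3 E4 : set 'rV[R]_3) (u1 u2 : 'cV[R]_3),
    [/\ edges r a v = [set E1; E2; E3; E4], u1 != 0 /\ u2 != 0,
        E1 `|` E2 `<=` plane u1 & E3 `|` E4 `<=` plane u2].

Definition y_valley (Gamma : set mon) (m n : nat) : Prop :=
  [/\ Gamma (mono m n 0), Gamma (mono m.+1 n 0), Gamma (mono m n.+1 0)
    & ~ Gamma (mono m.+1 n.+1 0)].

Definition z_valley (Gamma : set mon) (m n : nat) : Prop :=
  [/\ Gamma (mono m 0 n), Gamma (mono m.+1 0 n), Gamma (mono m 0 n.+1)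
    & ~ Gamma (mono m.+1 0 n.+1)].

(* Gamma has one y-valley x^kx y^ky and one z-valley x^jx z^jz.  The two may be
   the same monomial (a power of x), which then counts twice. *)
Definition two_valleys (Gamma : set mon) (kx ky jx jz : nat) : Prop :=
  (forall m n, y_valley Gamma m n <-> m = kx /\ n = ky) /\
  (forall m n, z_valley Gamma m n <-> m = jx /\ n = jz).

Definition least_exponent (Gamma : set mon) (i : 'I_3) (n : nat) : Prop :=
  ~ Gamma (U_(i) *+ n)%MM /\ forall k, (k < n)%N -> Gamma (U_(i) *+ k)%MM.

(* [is_SC r a v S]: S is a value prescribed for SC(D_v) by the case analysis on
   v.  It is a relation because the last three cases involve auxiliary data
   (i, j, Gamma, pairs of edges). *)
Inductive is_SC {R : realType} (r a : nat) (v : 'rV[R]_3) : set 'Z_r -> Prop :=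
| SC_valency3 :
    valency r a v 3 ->
    is_SC r a v [set wt r a (mono 1 0 0) + wt r a (mono 1 0 0)]
| SC_valency4_not_lines (i j : nat) :
    valency r a v 4 -> ~ two_lines r a v ->
    edges r a v (cone2 (e_ R 0) v) ->
    has_ratio r a (cone2 (e_ R 0) v) (mono 0 j 0) (mono 0 0 i) ->
    is_SC r a v [set wt r a (mono 1 0 0) + wt r a (mono 0 j 0)]
| SC_valency4_lines (Gamma : set mon) (kx ky jx jz ix jy kz : nat)
    (F1 F2 : set 'rV[R]_3) :
    valency r a v 4 -> two_lines r a v ->
    Ggraph r a Gamma -> two_valleys Gamma kx ky jx jz ->
    least_exponent Gamma 0 ix -> least_exponent Gamma 1 jy ->
    least_exponent Gamma 2 kz ->
    facet F1 (sigma r a Gamma) -> F1 v ->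
    has_ratio r a F1 (mono 0 jy.-1 0) (mono jx.+1 0 jz.+1) ->
    facet F2 (sigma r a Gamma) -> F2 v ->
    has_ratio r a F2 (mono 0 0 kz.-1) (mono kx.+1 ky.+1 0) ->
    is_SC r a v [set wt r a (mono ix ky.+1 0); wt r a (mono ix 0 jz.+1)]
| SC_valency5 (E1 E2 E3 E4 E5 : set 'rV[R]_3) (cl cm cf : 'Z_r) :
    valency r a v 5 -> edges r a v = [set E1; E2; E3; E4; E5] ->
    marked r a E1 cl -> marked r a E2 cl ->
    marked r a E3 cm -> marked r a E4 cm -> marked r a E5 cf ->
    cl != cm -> cf != cl -> cf != cm ->
    is_SC r a v [set cl + cm].

(* Main.v *)
(* As yz is invariant, a G-graph contains only monomials x^m y^i and x^m z^i.  It
   is therefore a set of points (m, i) and (m, - i) of a half plane, and a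
   fundamental domain for the lattice L = {(m, i) | r divides m + a i}.  If x is in
   the G-graph, the graph is determined by a basis (al, s), (be, - t) of L and a
   pair (j, k) with j + k < min (s, t); otherwise it contains only powers of y and z.

   Put u = w_2 + w_3, P = t w_2 - be w_1 and Q = s w_3 - al w_1.  In the affine
   coordinates (P / u, Q / u) the cone of the first kind of graph is the unit
   square [j, j + 1] x [k, k + 1] cut by P + Q <= min (s, t).  The cones of a given
   basis tile the part P + Q <= min (s, t) of the right triangle with legs t and s; the
   rest of it is the triangle of the basis obtained by one subtraction of Euclid's
   algorithm on (s, t).  The first triangle has al = be = 1, and the second kind of
   graph fills the region between it and e_1.  Up to exchanging y and z, the vertices
   are thus the common corner of the two first sides (valency 3), the points on these
   sides (valency 4, bent), the interior points (valency 4, straight) and the points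
   on the diagonals (valency 5).

   Multiplied by chi_1, the weights of the socles of the graph with parameters
   (j, k) are the multiples of chi_a by t - s + n with n in {k, - j, k + 1, - j - 1},
   up to boundary effects, so EC (D_v) can be read off the squares around v. *)

Require Import Defs.
From mathcomp Require Import all_boot all_order all_algebra.
From mathcomp Require Import mpoly.
From mathcomp Require Import boolp classical_sets functions cardinality reals.
From mathcomp Require Import perm zify ring lra.
Import Order.TTheory GRing.Theory Num.Theory.
Local Open Scope classical_set_scope.
Local Open Scope ring_scope.

Local Notation xdeg X := (X 0%R).
Local Notation ydeg X := (X 1%R).
Local Notation zdeg X := (X 2%R).

Set Implicit Arguments.
Unset Strict Implicit.
Unset Printing Implicit Defensive.

(** Every graph is presented by a terminating rewriting system that preserves weights: the
    irreducible monomials form the graph, the rules are the inequalities of its cone, and the linear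
    weight that makes the system terminate is an interior point of the cone. This interior point is
    used a second time. If listed cones cover all directions around [v], a short move from [v]
    toward the interior of any cone through [v] ends in a listed one, and the two graphs coincide.
    Edges, valency and [EC] therefore need only a finite list of cones around [v], not the global
    fan property. The main obstacle is that the cones inside a triangle at a point of its leg may
    belong to a basis reached only after an unknown number of Euclid steps; [inner_cones] hides this
    number and keeps what the cases use. Characters are compared through their exponents as powers
    of chi_a, which is sound within a window shorter than [r]; this is where [r > 2] enters. The
    exchange of y and z turns [a] into [r - a], so everything before the theorem is stated for
    [a <= r]. *)

Lemma ord3P (P : 'I_3 -> Prop) : P 0 -> P 1 -> P 2 -> forall i, P i.
Proof.
by move=> P0 P1 P2 [[|[|[|//]]] i_lt]; [move: P0|move: P1|move: P2];
  congr P; apply/val_inj.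
Qed.

Lemma mon_eq (X Y : mon) : X 0 = Y 0 -> X 1 = Y 1 -> X 2 = Y 2 -> X = Y.
Proof. by move=> X0 X1 X2; apply/mnmP; apply: ord3P. Qed.

Lemma mono0 i j k : mono i j k 0 = i. Proof. by rewrite mnmE. Qed.
Lemma mono1 i j k : mono i j k 1 = j. Proof. by rewrite mnmE. Qed.
Lemma mono2 i j k : mono i j k 2 = k. Proof. by rewrite mnmE. Qed.
Definition monoE := (mono0, mono1, mono2).

Lemma monoK (X : mon) : mono (X 0) (X 1) (X 2) = X.
Proof. by apply: mon_eq; rewrite monoE. Qed.

Lemma dvdmE (X Y : mon) :
  dvdm X Y = [&& (xdeg X <= xdeg Y)%N, (ydeg X <= ydeg Y)%N & (zdeg X <= zdeg Y)%N].
Proof.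
rewrite /dvdm; apply/mnm_lepP/and3P => [le_XY|[X0 X1 X2]]; last exact: ord3P.
by split; apply: le_XY.
Qed.

Lemma dvdmP (X Y : mon) : reflect (exists Z, Y = (X + Z)%MM) (dvdm X Y).
Proof.
apply: (iffP idP) => [|[Z ->]]; last by rewrite dvdmE !mnmDE !leq_addr.
by move=> XY; exists (Y - X)%MM; rewrite addmBA // addmC addmK.
Qed.

(** * Weights as integers modulo r *)

Lemma intr_Zp_eq0 (r : nat) (n : int) : (1 < r)%N ->
  ((n%:~R : 'Z_r) == 0) = (r%:Z %| n)%Z.
Proof.
move=> r_gt1.
have natE (m : nat) : ((m%:R : 'Z_r) == 0) = (r %| m)%N.
  by rewrite -val_eqE /= val_Zp_nat.
case: n => n; first by rewrite -pmulrn natE.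
by rewrite NegzE mulrNz oppr_eq0 -pmulrn natE dvdzE abszN.
Qed.

Lemma intr_Zp_eq (r : nat) (m n : int) : (1 < r)%N ->
  ((m%:~R : 'Z_r) == n%:~R) = (r%:Z %| m - n)%Z.
Proof. by move=> r_gt1; rewrite -subr_eq0 -rmorphB intr_Zp_eq0. Qed.

(** An integer lift of the weight modulo r: z counts as the inverse of y, because r - a is -a modulo
    r. *)
Definition cls (a : nat) (X : mon) : int := (X 0)%:Z + a%:Z * ((X 1)%:Z - (X 2)%:Z).

Lemma wtE (r a : nat) (X : mon) : (1 < r)%N -> (a <= r)%N ->
  wt r a X = (cls a X)%:~R.
Proof.
move=> r_gt1 le_ar; apply/eqP; rewrite /wt /chi pmulrn intr_Zp_eq // /cls.
by apply/dvdzP; exists (X 2)%:Z; rewrite !PoszD !PoszM -subzn //; ring.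
Qed.

Lemma wt_eqP (r a : nat) (X Y : mon) : (1 < r)%N -> (a <= r)%N ->
  wt r a X = wt r a Y <-> (r%:Z %| cls a X - cls a Y)%Z.
Proof.
by move=> r_gt1 le_ar; rewrite !wtE // -intr_Zp_eq //; split=> /eqP.
Qed.

Lemma wtD r a X Y : wt r a (X + Y)%MM = wt r a X + wt r a Y.
Proof.
rewrite /wt /chi -natrD; congr (_%:R); rewrite !mnmDE; ring.
Qed.

(** The n-th power of chi_a. As [a] is a unit modulo [r], every character has this form, and integer
    arithmetic replaces that of characters. *)
Definition tau (r a : nat) (n : int) : 'Z_r := (a%:Z * n)%:~R.

(** Cancelling the unit [a] leaves a multiple of r of absolute value less than r, which is 0. *)
Lemma tau_inj (r a : nat) (m n : int) : (1 < r)%N -> coprime r a ->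
  `|m - n| < r%:Z -> tau r a m = tau r a n -> m = n.
Proof.
move=> r_gt1 co_ra lt_r /eqP; rewrite intr_Zp_eq // -mulrBr Gauss_dvdzr.
  case/dvdzP => q mn; have: q = 0 by rewrite mn in lt_r; nia.
  by move=> q0; rewrite q0 in mn; lia.
by rewrite /coprimez /gcdz /=; apply/eqP; rewrite (eqP co_ra).
Qed.

Lemma tauD r a m n : tau r a (m + n) = tau r a m + tau r a n.
Proof. by rewrite /tau mulrDr rmorphD. Qed.

(** * G-graphs and rewriting systems *)

Section Ggraphs.
Variables r a : nat.

Lemma Ggraph_inj Gamma X Y : Ggraph r a Gamma -> Gamma X -> Gamma Y ->
  wt r a X = wt r a Y -> X = Y.
Proof. by move=> [_ [_ inj _]] GX GY; apply: inj; rewrite inE. Qed.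

Lemma Ggraph_surj Gamma c : Ggraph r a Gamma -> exists2 Y, Gamma Y & wt r a Y = c.
Proof. by move=> [_ [_ _ surj]]; have [|Y] := surj c; last by exists Y. Qed.

Lemma Ggraph_down Gamma X Y : Ggraph r a Gamma -> Gamma (X + Y)%MM -> Gamma X.
Proof. by move=> [[I [idI ->]] _] nIXY IX; apply: nIXY; apply: idI. Qed.

Lemma Ggraph_dvdm Gamma X Y : Ggraph r a Gamma -> dvdm X Y -> Gamma Y -> Gamma X.
Proof. by move=> GG /dvdmP[Z ->]; apply: Ggraph_down. Qed.

Lemma GgraphP Gamma :
    (forall X Y, dvdm X Y -> Gamma Y -> Gamma X) ->
    (forall X Y, Gamma X -> Gamma Y -> wt r a X = wt r a Y -> X = Y) ->
    (forall c, exists2 Y, Gamma Y & wt r a Y = c) ->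
  Ggraph r a Gamma.
Proof.
move=> down inj surj; split.
  exists (~` Gamma); rewrite setCK; split=> // X Y nGX GXY; apply: nGX.
  by apply: down GXY; apply/dvdmP; exists Y.
split=> //; first by move=> X Y; rewrite !inE; apply: inj.
by move=> c _; have [Y GY <-] := surj c; exists Y.
Qed.

(** Both sides contain each weight exactly once, so the smaller graph leaves no room for a further
    monomial. *)
Lemma Ggraph_sub_eq Gamma Gamma' : Ggraph r a Gamma -> Ggraph r a Gamma' ->
  Gamma `<=` Gamma' -> Gamma = Gamma'.
Proof.
move=> GG GG' sub; apply/seteqP; split=> // X G'X.
have [Y GY wtY] := Ggraph_surj (wt r a X) GG.
by rewrite -(Ggraph_inj GG' (sub _ GY) G'X wtY).
Qed.

Lemma exists_min_gen (Gamma : set mon) X : ~ Gamma X ->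
  exists2 Y, min_gen Gamma Y & dvdm Y X.
Proof.
have [n] := ubnP (mdeg X); elim: n X => // n IHn X /ltnSE le_Xn nGX.
have [X_min|] := pselect (forall Y, ~ Gamma Y -> dvdm Y X -> Y = X).
  by exists X => //; exact: lepm_refl.
move=> /existsNP[Y /not_implyP[nGY /not_implyP[YX neYX]]].
have [|Z Z_min ZY] := IHn Y _ nGY; last by exists Z => //; apply: lepm_trans ZY YX.
apply: leq_trans le_Xn; have /dvdmP[Z XE] := YX.
rewrite XE mdegD -[X in (X < _)%N]addn0 ltn_add2l lt0n mdeg_eq0.
by apply/eqP => Z0; apply: neYX; rewrite XE Z0 addm0.
Qed.

(** Natural coefficients make the induced order on monomials well founded, which [dotm] with real
    coefficients does not provide. *)
Definition nweight (n X : mon) : nat :=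
  (xdeg n * xdeg X + ydeg n * ydeg X + zdeg n * zdeg X)%N.

Lemma nweightD n X Y : nweight n (X + Y)%MM = (nweight n X + nweight n Y)%N.
Proof. by rewrite /nweight !mnmDE; lia. Qed.

Lemma dotmE {R : realType} (w : 'rV[R]_3) X :
  dotm w X = w 0 0 * (xdeg X)%:R + w 0 1 * (ydeg X)%:R + w 0 2 * (zdeg X)%:R.
Proof.
rewrite /dotm !big_ord_recl big_ord0 addr0 addrA.
by congr (_ + _ * (X _)%:R + _ * (X _)%:R); try congr (w _ _); apply/val_inj.
Qed.

Lemma dotmD {R : realType} (w : 'rV[R]_3) X Y : dotm w (X + Y)%MM = dotm w X + dotm w Y.
Proof. by rewrite !dotmE !mnmDE !natrD; ring. Qed.

Definition in_interior (Gamma : set mon) (n : mon) := forall X Y,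
  min_gen Gamma X -> Gamma Y -> wt r a Y = wt r a X -> (nweight n Y < nweight n X)%N.

(** Replacing a minimal generator inside X by its representative does not raise [dotm w] and
    strictly lowers [nweight n]; the latter makes the replacements stop, and they can only stop at
    Y. *)
Lemma sigma_all {R : realType} Gamma n (w : 'rV[R]_3) X Y :
    Ggraph r a Gamma -> in_interior Gamma n -> sigma r a Gamma w ->
    ~ Gamma X -> Gamma Y -> wt r a Y = wt r a X ->
  dotm w Y <= dotm w X /\ (nweight n Y < nweight n X)%N.
Proof.
move=> GG n_int w_sig; have [m] := ubnP (nweight n X).
elim: m X => // m IHm X /ltnSE le_Xm nGX GY wtY.
have [X' X'_min /dvdmP[Z XE]] := exists_min_gen nGX.
have [Y' GY' wtY'] := Ggraph_surj (wt r a X') GG.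
have wX' := w_sig _ _ X'_min GY' wtY'; have nX' := n_int _ _ X'_min GY' wtY'.
have w_le : dotm w (Y' + Z)%MM <= dotm w X by rewrite XE !dotmD lerD2r.
have n_lt : (nweight n (Y' + Z)%MM < nweight n X)%N.
  by rewrite XE !nweightD ltn_add2r.
have wt_eq : wt r a Y = wt r a (Y' + Z)%MM by rewrite wtY XE !wtD wtY'.
have [GYZ|nGYZ] := pselect (Gamma (Y' + Z)%MM).
  by rewrite (Ggraph_inj GG GY GYZ wt_eq).
have [le_wY lt_nY] := IHm _ (leq_trans n_lt le_Xm) nGYZ GY wt_eq.
by split; [apply: le_trans w_le | apply: ltn_trans n_lt].
Qed.

Definition irreducible_set (rs : seq (mon * mon)) : set mon :=
  [set X | all (fun p => ~~ dvdm p.1 X) rs].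

(* Since rules preserve weights and lower n, every monomial has the weight of an
   irreducible one, and n is an interior point of the cone. *)
Definition rewriting (rs : seq (mon * mon)) (n : mon) : Prop :=
  forall p, p \in rs -> [/\ wt r a p.2 = wt r a p.1, irreducible_set rs p.2
    & (nweight n p.2 < nweight n p.1)%N].

Section RewritingSystem.
Variables (rs : seq (mon * mon)) (n : mon).
Hypothesis rs_n : rewriting rs n.

Lemma rewriting_surj X : exists2 Y, irreducible_set rs Y & wt r a Y = wt r a X.
Proof.
have [m] := ubnP (nweight n X); elim: m X => // m IHm X /ltnSE le_Xm.
have [irrX|] := boolP (all (fun p => ~~ dvdm p.1 X) rs); first by exists X.
move=> /allPn[p p_rs]; rewrite negbK => /dvdmP[Z XE].
have [wtp _ np] := rs_n p_rs.
have [|Y irrY wtY] := IHm (p.2 + Z)%MM.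
  by apply: leq_trans le_Xm; rewrite XE !nweightD ltn_add2r.
by exists Y => //; rewrite wtY XE !wtD wtp.
Qed.

Hypothesis irr_inj : forall X Y, irreducible_set rs X -> irreducible_set rs Y ->
  wt r a X = wt r a Y -> X = Y.
Hypothesis wt_surj : forall c : 'Z_r, exists X, wt r a X = c.

Lemma rewriting_Ggraph : Ggraph r a (irreducible_set rs).
Proof.
apply: GgraphP => // [X Y XY|c]; last first.
  by have [X <-] := wt_surj c; apply: rewriting_surj.
move=> /allP irrY; apply/allP => p /irrY; apply: contra => pX.
exact: lepm_trans pX XY.
Qed.

(** A minimal generator is reducible, so some left side divides it; that left side is reducible too,
    and minimality makes them equal. *)
Lemma min_gen_rewriting X Y : min_gen (irreducible_set rs) X ->
    irreducible_set rs Y -> wt r a Y = wt r a X ->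
  exists2 p, p \in rs & X = p.1 /\ Y = p.2.
Proof.
move=> [/negP/allPn[p p_rs]]; rewrite negbK => pX X_min irrY wtY.
have [wtp irrp _] := rs_n p_rs; exists p => //.
have pE : p.1 = X.
  apply: X_min => //; apply/negP/allPn; exists p; rewrite ?negbK //.
  exact: lepm_refl.
by split=> //; apply: irr_inj => //; rewrite wtY wtp pE.
Qed.

Lemma rewriting_interior : in_interior (irreducible_set rs) n.
Proof.
move=> X Y X_min irrY wtY.
by have [p /rs_n[_ _ ?] [-> ->]] := min_gen_rewriting X_min irrY wtY.
Qed.

(** A left side need not be a minimal generator, so the passage from the cone to the rules goes
    through [sigma_all]. *)
Lemma rewriting_sigma {R : realType} (w : 'rV[R]_3) :
  sigma r a (irreducible_set rs) w <->
  forall p, p \in rs -> dotm w p.2 <= dotm w p.1.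
Proof.
split=> [w_sig p p_rs|w_rs X Y X_min irrY wtY]; last first.
  by have [p /w_rs ? [-> ->]] := min_gen_rewriting X_min irrY wtY.
have [wtp irrp _] := rs_n p_rs.
have [] // := sigma_all rewriting_Ggraph rewriting_interior w_sig _ irrp wtp.
by apply/negP/allPn; exists p; rewrite ?negbK //; exact: lepm_refl.
Qed.

End RewritingSystem.

(** An element of Gamma outside Gamma' would be beaten strictly by its representative in Gamma',
    against the weak inequality that it satisfies as an element of Gamma. *)
Lemma Ggraph_eq_of_strict {R : realType} Gamma Gamma' (w : 'rV[R]_3) :
    Ggraph r a Gamma -> Ggraph r a Gamma' ->
    (forall X Y, ~ Gamma X -> Gamma Y -> wt r a Y = wt r a X -> dotm w Y <= dotm w X) ->
    (forall X Y, ~ Gamma' X -> Gamma' Y -> wt r a Y = wt r a X -> dotm w Y < dotm w X) ->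
  Gamma = Gamma'.
Proof.
move=> GG GG' le_w lt_w; apply: Ggraph_sub_eq => // Y GY.
have [//|nG'Y] := pselect (Gamma' Y).
have [Z G'Z wtZ] := Ggraph_surj (wt r a Y) GG'.
have lt_ZY := lt_w _ _ nG'Y G'Z wtZ.
have [GZ|nGZ] := pselect (Gamma Z).
  by move: lt_ZY; rewrite (Ggraph_inj GG GZ GY wtZ) ltxx.
by move: (le_w _ _ nGZ GY (esym wtZ)); rewrite leNgt lt_ZY.
Qed.

End Ggraphs.

(** * The two families of G-graphs *)

(* [Basis al be s t] encodes the vectors (al, s) and (be, - t) of the lattice
   {(m, i) | r divides m + a * i} of exponents of invariant x^m y^i. *)
Record basis := Basis { bal : nat; bbe : nat; bs : nat; bt : nat }.

Record good (r a : nat) (B : basis) : Prop := Good {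
  bal_gt0 : (0 < bal B)%N; bbe_gt0 : (0 < bbe B)%N;
  bs_gt0 : (0 < bs B)%N; bt_gt0 : (0 < bt B)%N;
  bal_inv : (r%:Z %| (bal B)%:Z + a%:Z * (bs B)%:Z)%Z;
  bbe_inv : (r%:Z %| (bbe B)%:Z - a%:Z * (bt B)%:Z)%Z;
  bdet : (bal B * bt B + bbe B * bs B = r)%N }.

(** The truncated subtractions of the first rule serve both orders of s and t: x^(al + be) is
    replaced by y^(t - s) or by z^(s - t), the other exponent being 0. *)
Definition tee_rules (B : basis) (j k : nat) : seq (mon * mon) :=
  [:: (mono (bal B + bbe B) 0 0, mono 0 (bt B - bs B) (bs B - bt B));
      (mono (bal B) k.+1 0, mono 0 0 (bs B - k.+1));
      (mono (bbe B) 0 j.+1, mono 0 (bt B - j.+1) 0);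
      (mono 0 (bt B - j) 0, mono (bbe B) 0 j);
      (mono 0 0 (bs B - k), mono (bal B) k 0);
      (mono 0 1 1, mono 0 0 0)].

Definition tee B j k : set mon := irreducible_set (tee_rules B j k).

Lemma teeP B j k X : tee B j k X <->
  [/\ (xdeg X < bal B + bbe B)%N, (ydeg X <= k \/ xdeg X < bal B)%N,
      (zdeg X <= j \/ xdeg X < bbe B)%N, (ydeg X < bt B - j)%N & (zdeg X < bs B - k)%N] /\
  (ydeg X = 0 \/ zdeg X = 0)%N.
Proof.
rewrite /tee /irreducible_set /= !dvdmE !monoE /= !andbT.
split=> [/and5P[? ? ? ? /andP[? ?]]|[[? ? ? ? ?] ?]].
  by split; [split|]; lia.
by apply/and5P; split; [..|apply/andP; split]; lia.
Qed.

Section Tee.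
Variables (r a : nat) (r_gt1 : (1 < r)%N) (le_ar : (a <= r)%N).

Lemma pure_power_surj (co_ra : coprime r a) (c : 'Z_r) :
  exists n : nat, wt r a (mono 0 n 0) = c.
Proof.
have [b ab] : exists b, a * b = 1 %[mod r].
  have [a0|a_gt0] := posnP a.
    by exists 0%N; move: co_ra; rewrite a0 /coprime gcdn0 => /eqP ->; rewrite !modn1.
  have [km kn def _] := egcdnP r a_gt0.
  by exists km; rewrite mulnC def gcdnC (eqP co_ra) modnMDl.
exists (b * c)%N; rewrite /wt /chi !monoE muln0 addn0 add0n mulnA.
by apply/ord_inj; rewrite val_Zp_nat // -modnMml ab modnMml mul1n -[in RHS](natr_Zp c) val_Zp_nat.
Qed.

Variables (B : basis) (gB : good r a B).

(** Cramer's rule: the coordinates have denominator r, the determinant of the basis up to sign, and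
    invariance makes both numerators divisible by r. *)
Lemma good_decomp (m i : int) : (r%:Z %| m + a%:Z * i)%Z ->
  exists x y : int, m = x * (bal B)%:Z + y * (bbe B)%:Z /\ i = x * (bs B)%:Z - y * (bt B)%:Z.
Proof.
case: gB => _ _ _ _ /dvdzP[qa +] /dvdzP[qb +]; case: B => al be s t /=.
move=> qaE qbE det /dvdzP[q qE].
have detZ : al%:Z * t%:Z + be%:Z * s%:Z = r%:Z by rewrite -det; lia.
have r0 : r%:Z != 0 by lia.
exists (t%:Z * q + i * qb), (s%:Z * q - i * qa).
have xE : r%:Z * (t%:Z * q + i * qb) = t%:Z * m + be%:Z * i.
  by rewrite mulrDr mulrCA (mulrC r%:Z) -qE mulrCA (mulrC r%:Z) -qbE; ring.
have yE : r%:Z * (s%:Z * q - i * qa) = s%:Z * m - al%:Z * i.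
  by rewrite mulrBr mulrCA (mulrC r%:Z) -qE mulrCA (mulrC r%:Z) -qaE; ring.
move: xE yE; set x := t%:Z * q + _; set y := s%:Z * q - _ => xE yE.
split; apply: (mulfI r0).
  have -> : r%:Z * (x * al%:Z + y * be%:Z) = r%:Z * x * al%:Z + r%:Z * y * be%:Z by ring.
  by rewrite xE yE -detZ; ring.
have -> : r%:Z * (x * s%:Z - y * t%:Z) = r%:Z * x * s%:Z - r%:Z * y * t%:Z by ring.
by rewrite xE yE -detZ; ring.
Qed.

Variables j k : nat.
Hypotheses (jk_s : (j + k < bs B)%N) (jk_t : (j + k < bt B)%N).

(** These equations say u = 3r, P/u = j + 1/3 and Q/u = k + 1/3: the centroid of the half of the
    unit square at (j, k) below its antidiagonal. It is strictly inside the cone even if P + Q <= j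
    + k + 1 is one of the constraints; the scaling by 3r makes it integral. *)
Definition tee_weight (n : mon) : Prop :=
  [/\ (ydeg n + zdeg n = 3 * r)%N,
      (bt B * ydeg n = bbe B * xdeg n + (3 * j + 1) * r)%N &
      (bs B * zdeg n = bal B * xdeg n + (3 * k + 1) * r)%N].

Lemma tee_weight_ex : exists n, tee_weight n.
Proof.
rewrite /tee_weight.
case: gB jk_s jk_t => + + + + _ _; case: B => al be s t /=.
move=> al0 be0 s0 t0 det js jt.
have bnd (x y z : nat) : (y < z)%N -> (x * (3 * y + 3) <= x * (3 * z))%N.
  by move=> yz; rewrite leq_mul2l; lia.
(* Inverting the coordinates gives w0 = 3st - s(3j + 1) - t(3k + 1) and similar formulas for w1 and
   w2, so only their nonnegativity is at stake. *)
have [w0 w0E] : exists w0, (w0 + s * (3 * j + 1) + t * (3 * k + 1) = 3 * s * t)%N.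
  suff lt : (s * (3 * j + 1) + t * (3 * k + 1) < 3 * s * t)%N.
    by exists (3 * s * t - (s * (3 * j + 1) + t * (3 * k + 1)))%N; lia.
  case: (leqP s t) => st.
    have : (s * (3 * j + 1) <= t * (3 * j + 1))%N by rewrite leq_mul2r st orbT.
    by have := bnd t _ _ js; lia.
  have : (t * (3 * k + 1) <= s * (3 * k + 1))%N by rewrite leq_mul2r (ltnW st) orbT.
  by have := bnd s _ _ jt; lia.
have [w1 w1E] : exists w1, (w1 + be * (3 * k + 1) = 3 * be * s + al * (3 * j + 1))%N.
  have ks : (k < s)%N by lia.
  exists (3 * be * s + al * (3 * j + 1) - be * (3 * k + 1))%N.
  by have := bnd be _ _ ks; lia.
have [w2 w2E] : exists w2, (w2 + al * (3 * j + 1) = 3 * al * t + be * (3 * k + 1))%N.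
  have jt' : (j < t)%N by lia.
  exists (3 * al * t + be * (3 * k + 1) - al * (3 * j + 1))%N.
  by have := bnd al _ _ jt'; lia.
exists (mono w0 w1 w2).
have := congr1 (muln t) w1E; have := congr1 (muln be) w0E.
have := congr1 (muln s) w2E; have := congr1 (muln al) w0E.
by split; rewrite !monoE /= -det; lia.
Qed.

Lemma tee_rules_wt p : p \in tee_rules B j k -> wt r a p.2 = wt r a p.1.
Proof.
case: gB jk_s jk_t => _ _ _ _ /dvdzP[qa +] /dvdzP[qb +] _.
case: B => al be s t /= qaE qbE js jt.
have wtI X Y q : cls a X - cls a Y = q * r%:Z -> wt r a X = wt r a Y.
  by move=> XY; apply/wt_eqP => //; apply/dvdzP; exists q.
have [s' sE] : exists s', s = (k.+1 + s')%N by exists (s - k.+1)%N; lia.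
have [t' tE] : exists t', t = (j.+1 + t')%N by exists (t - j.+1)%N; lia.
have s1E : (s - k.+1)%N = s' by lia.
have s2E : (s - k)%N = s'.+1 by lia.
have t1E : (t - j.+1)%N = t' by lia.
have t2E : (t - j)%N = t'.+1 by lia.
have [st [ts [stE tsE /(congr1 (muln a)) ts_E]]] :
    exists st ts, [/\ (s - t = st)%N, (t - s = ts)%N & (s + ts = t + st)%N].
  by exists (s - t)%N, (t - s)%N; split; lia.
have as' := congr1 (muln a) sE; have at' := congr1 (muln a) tE.
rewrite !inE; do ![case/predU1P=> [->|]]; last move/eqP->.
- by apply: (wtI _ _ (- qa - qb)); rewrite /cls !monoE /= stE tsE; lia.
- by apply: (wtI _ _ (- qa)); rewrite /cls !monoE /= s1E; lia.
- by apply: (wtI _ _ (- qb)); rewrite /cls !monoE /= t1E; lia.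
- by apply: (wtI _ _ qb); rewrite /cls !monoE /= t2E; lia.
- by apply: (wtI _ _ qa); rewrite /cls !monoE /= s2E; lia.
- by apply: (wtI _ _ 0); rewrite /cls !monoE /=; lia.
Qed.

Lemma tee_rules_irreducible p : p \in tee_rules B j k -> tee B j k p.2.
Proof.
case: gB jk_s jk_t => + + _ _ _ _ _; case: B => al be s t /= al0 be0 js jt.
by rewrite !inE; do ![case/predU1P=> [->|]]; last move/eqP->;
  rewrite teeP !monoE /=; (split; [split|]); lia.
Qed.

Lemma tee_rules_weight n p : tee_weight n -> p \in tee_rules B j k ->
  (nweight n p.2 < nweight n p.1)%N.
Proof.
rewrite /tee_weight /nweight; case: gB jk_s jk_t => _ _ _ _ _ _ _.
case: B => al be s t /=; move: (xdeg n) (ydeg n) (zdeg n) => n0 n1 n2.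
move=> js jt [n12 n1E n2E].
have [s' sE] : exists s', s = (k.+1 + s')%N by exists (s - k.+1)%N; lia.
have [t' tE] : exists t', t = (j.+1 + t')%N by exists (t - j.+1)%N; lia.
have n12j := congr1 (muln j) n12; have n12k := congr1 (muln k) n12.
have n12s := congr1 (muln s) n12; have n12t := congr1 (muln t) n12.
rewrite !inE; do ![case/predU1P=> [->|]]; last move/eqP->; rewrite !monoE /=.
- have bnd (x : nat) : (j + k < x)%N -> (r * (j + k + 1) <= r * x)%N.
    by move=> x_gt; rewrite leq_mul2l; lia.
  have [st|/ltnW ts] := leqP s t.
    have := leq_mul (leqnn n1) st.
    by rewrite (_ : s - t = 0)%N ?mulnBr; have := bnd s js; lia.
  have := leq_mul (leqnn n2) ts.
  by rewrite (_ : t - s = 0)%N ?mulnBr; have := bnd t jt; lia.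
- by rewrite mulnBr; lia.
- by rewrite mulnBr; lia.
- by rewrite mulnBr; lia.
- by rewrite mulnBr; lia.
- by lia.
Qed.

Lemma tee_rewriting n : tee_weight n -> rewriting r a (tee_rules B j k) n.
Proof.
move=> nW p p_rs; split; [exact: tee_rules_wt | exact: tee_rules_irreducible |].
exact: tee_rules_weight.
Qed.

(** The difference of two monomials of equal weight is x (al, s) + y (be, -t). For every choice of
    signs of x and y other than x = y = 0, this vector is too long to join two points of the
    graph. *)
Lemma tee_inj X Y : tee B j k X -> tee B j k Y -> wt r a X = wt r a Y -> X = Y.
Proof.
move=> /teeP[[X1 X2 X3 X4 X5] X6] /teeP[[Y1 Y2 Y3 Y4 Y5] Y6] /wt_eqP.
move=> /(_ r_gt1 le_ar) wtXY.
have [|x [y [mE iE]]] := @good_decomp ((xdeg X)%:Z - (xdeg Y)%:Z)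
  ((ydeg X)%:Z - (zdeg X)%:Z - ((ydeg Y)%:Z - (zdeg Y)%:Z)).
  by rewrite mulrBr; move: wtXY; congr (_ %| _)%Z; rewrite /cls; ring.
case: gB => al0 be0 s0 t0 _ _ _.
suff [x0 y0] : x = 0 /\ y = 0.
  by move: mE iE; rewrite x0 y0 => mE iE; apply: mon_eq; lia.
move: jk_s jk_t X1 X2 X3 X4 X5 Y1 Y2 Y3 Y4 Y5 al0 be0 s0 t0 mE iE.
case: B => al be s t /=; move: (xdeg X) (ydeg X) (zdeg X) (xdeg Y) (ydeg Y) (zdeg Y) X6 Y6.
move=> x0 x1 x2 y0 y1 y2 X6 Y6 js jt X1 X2 X3 X4 X5 Y1 Y2 Y3 Y4 Y5 al0 be0 s0 t0 mE iE.
have ge1 (n : nat) (z : int) : 1 <= z -> n%:Z <= z * n%:Z by move=> z1; nia.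
have le1 (n : nat) (z : int) : z <= -1 -> z * n%:Z <= - n%:Z by move=> z1; nia.
have [x_ge|[x_eq|x_le]] : 1 <= x \/ x = 0 \/ x <= -1 by lia.
- have xal := ge1 al _ x_ge; have xs := ge1 s _ x_ge.
  have [y_ge|[y_eq|y_le]] : 1 <= y \/ y = 0 \/ y <= -1 by lia.
  + by have := ge1 be _ y_ge; lia.
  + by rewrite y_eq in mE iE; lia.
  + by have := le1 t _ y_le; lia.
- rewrite x_eq in mE iE *.
  have [y_ge|[y_eq|y_le]] : 1 <= y \/ y = 0 \/ y <= -1 by lia.
  + by have := ge1 be _ y_ge; have := ge1 t _ y_ge; lia.
  + by [].
  + by have := le1 be _ y_le; have := le1 t _ y_le; lia.
- have xal := le1 al _ x_le; have xs := le1 s _ x_le.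
  have [y_ge|[y_eq|y_le]] : 1 <= y \/ y = 0 \/ y <= -1 by lia.
  + by have := ge1 t _ y_ge; lia.
  + by rewrite y_eq in mE iE; lia.
  + by have := le1 be _ y_le; lia.
Qed.

Lemma tee_Ggraph (co_ra : coprime r a) : Ggraph r a (tee B j k).
Proof.
have [n nW] := tee_weight_ex.
apply: rewriting_Ggraph (tee_rewriting nW) tee_inj _ => c.
by have [m <-] := pure_power_surj co_ra c; exists (mono 0 m 0).
Qed.

End Tee.

(** For al = be = 1 the monomials x, z^s and y^t have the same weight; z^s is in the graph exactly
    when s <= kappa, and otherwise y^t is. *)
Definition flat_rules (r : nat) (B : basis) (kappa : nat) : seq (mon * mon) :=
  [:: (mono 1 0 0, if (bs B <= kappa)%N then mono 0 0 (bs B) else mono 0 (bt B) 0);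
      (mono 0 (r - kappa) 0, mono 0 0 kappa);
      (mono 0 0 kappa.+1, mono 0 (r - kappa.+1) 0);
      (mono 0 1 1, mono 0 0 0)].

Definition flat r B kappa : set mon := irreducible_set (flat_rules r B kappa).

Lemma flatP r B kappa X : flat r B kappa X <->
  [/\ xdeg X = 0, (ydeg X < r - kappa)%N, (zdeg X <= kappa)%N & ydeg X = 0 \/ zdeg X = 0]%N.
Proof.
rewrite /flat /irreducible_set /= !dvdmE !monoE /= !andbT.
split=> [/and4P[? ? ? ?]|[? ? ? ?]]; first by split; lia.
by apply/and4P; split; lia.
Qed.

Lemma first_basis_sum r a B : good r a B -> bal B = 1%N -> bbe B = 1%N ->
  (bs B + bt B = r)%N.
Proof. by move=> gB al1 be1; have := bdet gB; rewrite al1 be1; lia. Qed.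

Lemma basis_sum_le r a B : good r a B -> (bs B + bt B <= r)%N.
Proof.
by case: B => -[|al] [|be] s t [/= al0 be0 s0 t0 _ _ det]; lia.
Qed.

Section Flat.
Variables (r a : nat) (r_gt1 : (1 < r)%N) (le_ar : (a <= r)%N).
Hypothesis co_ra : coprime r a.
Variables (B : basis) (gB : good r a B) (kappa : nat).
Hypotheses (al1 : bal B = 1%N) (be1 : bbe B = 1%N) (lt_kr : (kappa < r)%N).

(** The weights of y and z put r w_2 / (w_2 + w_3) halfway between kappa and kappa + 1, while the
    weight of x exceeds those of z^s and y^t. *)
Definition flat_weight : mon :=
  mono (2 * r * r).+1 (2 * kappa).+1 (2 * r - (2 * kappa).+1).

Lemma flat_rewriting : rewriting r a (flat_rules r B kappa) flat_weight.
Proof.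
have := first_basis_sum gB al1 be1; case: gB => _ _ s0 t0.
rewrite al1 be1 /flat_rules /flat; case: B s0 t0 => m1 m2 s t /= s0 t0.
move=> /dvdzP[qa qaE] /dvdzP[qb qbE] _ st.
have wtI X Y q : cls a X - cls a Y = q * r%:Z -> wt r a X = wt r a Y.
  by move=> XY; apply/wt_eqP => //; apply/dvdzP; exists q.
have [k' rE] : exists k', r = (kappa.+1 + k')%N by exists (r - kappa.+1)%N; lia.
have k1E : (r - kappa.+1)%N = k' by lia.
have k2E : (r - kappa)%N = k'.+1 by lia.
have kw : (2 * kappa < 2 * r)%N by lia.
have W2 : (2 * r - (2 * kappa).+1 = (2 * k').+1)%N by lia.
have st2 : (t * (2 * kappa).+1 < 2 * r * r)%N.
  have h1 : (t * (2 * kappa).+1 <= t * (2 * r))%N by rewrite leq_mul2l kw orbT.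
  have h2 : (t * (2 * r) < r * (2 * r))%N by rewrite ltn_mul2r; lia.
  by lia.
have st1 : (s * (2 * k').+1 < 2 * r * r)%N.
  have h1 : (s * (2 * k').+1 <= s * (2 * r))%N by rewrite leq_mul2l; lia.
  have h2 : (s * (2 * r) < r * (2 * r))%N by rewrite ltn_mul2r; lia.
  by lia.
move=> p; rewrite /flat_weight /nweight !inE.
do ![case/predU1P=> [->|]]; last move/eqP->; (split;
  [|apply/(@flatP r (Basis m1 m2 s t) kappa); split|]); rewrite ?monoE /= ?k1E ?k2E ?W2; try by lia.
- have [sk|sk] := leqP s kappa; first by apply: (wtI _ _ (- qa)); rewrite /cls !monoE; lia.
  by apply: (wtI _ _ (- qb)); rewrite /cls !monoE; lia.
- by have [sk|sk] := leqP s kappa; rewrite ?monoE.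
- by have [sk|sk] := leqP s kappa; rewrite ?monoE; lia.
- by have [sk|sk] := leqP s kappa; rewrite ?monoE; lia.
- by have [sk|sk] := leqP s kappa; rewrite ?monoE; lia.
- by have [sk|sk] := leqP s kappa; rewrite ?monoE; lia.
- by apply: (wtI _ _ (- a%:Z)); rewrite /cls !monoE; lia.
- by apply: (wtI _ _ (a%:Z)); rewrite /cls !monoE; lia.
- by apply: (wtI _ _ 0); rewrite /cls !monoE; lia.
Qed.

Lemma flat_inj X Y : flat r B kappa X -> flat r B kappa Y ->
  wt r a X = wt r a Y -> X = Y.
Proof.
move=> /flatP[X1 X2 X3 X4] /flatP[Y1 Y2 Y3 Y4] /wt_eqP => /(_ r_gt1 le_ar).
have -> : cls a X - cls a Y = a%:Z * ((ydeg X)%:Z - (zdeg X)%:Z - ((ydeg Y)%:Z - (zdeg Y)%:Z)).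
  by rewrite /cls X1 Y1; ring.
rewrite Gauss_dvdzr; last by rewrite /coprimez /gcdz /=; apply/eqP; rewrite (eqP co_ra).
case/dvdzP => q qE; have q0 : q = 0 by nia.
by rewrite q0 in qE; apply: mon_eq; lia.
Qed.

Lemma flat_Ggraph : Ggraph r a (flat r B kappa).
Proof.
apply: rewriting_Ggraph flat_rewriting flat_inj _ => c.
by have [m <-] := pure_power_surj r_gt1 co_ra c; exists (mono 0 m 0).
Qed.

End Flat.

(** * Exchange of y and z on monomials and graphs *)

Lemma coprime_subr r a : (a <= r)%N -> coprime r a -> coprime r (r - a).
Proof.
move=> le_ar; have rE := subnKC le_ar; rewrite /coprime -{1}rE gcdnC gcdnDl.
by move=> co; rewrite -{1}rE addnC gcdnC gcdnDl gcdnC.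
Qed.

Definition swapm (X : mon) : mon := mono (xdeg X) (zdeg X) (ydeg X).

Lemma swapmK : involutive swapm.
Proof. by move=> X; rewrite /swapm !monoE monoK. Qed.

Lemma swapm_mono i j k : swapm (mono i j k) = mono i k j.
Proof. by rewrite /swapm !monoE. Qed.

Lemma dvdm_swapm X Y : dvdm (swapm X) (swapm Y) = dvdm X Y.
Proof. by rewrite !dvdmE !monoE [X in _ && X]andbC. Qed.

Lemma wt_swapm r a X : (1 < r)%N -> (a <= r)%N -> wt r (r - a) (swapm X) = wt r a X.
Proof.
move=> r_gt1 le_ar; rewrite !wtE ?leq_subr //; apply/eqP; rewrite intr_Zp_eq //.
by apply/dvdzP; exists ((zdeg X)%:Z - (ydeg X)%:Z); rewrite /cls !monoE -subzn //; ring.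
Qed.

Definition swapG (Gamma : set mon) : set mon := [set X | Gamma (swapm X)].

Lemma swapGK : involutive swapG.
Proof. by move=> Gamma; apply/seteqP; split=> X; rewrite /swapG /= swapmK. Qed.

Lemma Ggraph_swap r a Gamma : (1 < r)%N -> (a <= r)%N ->
  Ggraph r a Gamma -> Ggraph r (r - a) (swapG Gamma).
Proof.
move=> r_gt1 le_ar GG; apply: GgraphP => [X Y XY|X Y GX GY XY|c].
- by apply: (Ggraph_dvdm GG); rewrite dvdm_swapm.
- apply: (can_inj swapmK); apply: (Ggraph_inj GG) => //.
  by rewrite -!(wt_swapm _ r_gt1 le_ar) !swapmK.
- have [Y GY <-] := Ggraph_surj c GG; exists (swapm Y); rewrite ?wt_swapm //.
  by rewrite /swapG /= swapmK.
Qed.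

Lemma mulz_small (r : nat) (q z : int) : z = q * r%:Z ->
  - r%:Z < z -> z < r%:Z -> z = 0.
Proof.
move=> zE z_gt z_lt.
have q0 : q = 0 by nia.
by rewrite zE q0 mul0r.
Qed.

(** * Classification of G-graphs *)

Section Classification.
Variables (r a : nat) (r_gt1 : (1 < r)%N) (le_ar : (a <= r)%N).
Hypothesis co_ra : coprime r a.
Variables (Gamma : set mon) (GG : Ggraph r a Gamma).

Lemma Ggraph_cls X Y q : Gamma X -> Gamma Y -> cls a X - cls a Y = q * r%:Z -> X = Y.
Proof.
move=> GX GY XY; apply: (Ggraph_inj GG) => //.
by apply/wt_eqP => //; apply/dvdzP; exists q.
Qed.

Lemma Ggraph_rep X : exists2 Y, Gamma Y & exists q, cls a X - cls a Y = q * r%:Z.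
Proof.
have [Y GY /wt_eqP YX] := Ggraph_surj (wt r a X) GG; exists Y => //.
have /dvdzP[q qE] := YX r_gt1 le_ar.
by exists (- q); rewrite mulNr -qE opprB.
Qed.

Lemma Ggraph_le i j k i' j' k' : Gamma (mono i j k) ->
  (i' <= i)%N -> (j' <= j)%N -> (k' <= k)%N -> Gamma (mono i' j' k').
Proof.
by move=> G_ijk ii jj kk; apply: (Ggraph_dvdm GG) G_ijk; rewrite dvdmE !monoE ii jj.
Qed.

Lemma Ggraph_one : Gamma (mono 0 0 0).
Proof.
have [Y GY _] := Ggraph_rep 0%MM.
by move: GY; rewrite -(monoK Y) => /Ggraph_le; apply.
Qed.

Lemma Ggraph_yz X : Gamma X -> ydeg X = 0%N \/ zdeg X = 0%N.
Proof.
rewrite -(monoK X) !monoE => GX.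
have [->|y0] := posnP (ydeg X); [by left | have [->|z0] := posnP (zdeg X)]; first by right.
have Gyz : Gamma (mono 0 1 1) by apply: Ggraph_le GX _ _ _.
have yz1 : cls a (mono 0 1 1) - cls a (mono 0 0 0) = 0 * r%:Z.
  by rewrite /cls !monoE; lia.
by have := congr1 (fun X : mon => ydeg X) (Ggraph_cls Gyz Ggraph_one yz1); rewrite !monoE.
Qed.

Lemma ex_least (f : nat -> mon) : ~ Gamma (f r) ->
  exists n, [/\ ~ Gamma (f n), (n <= r)%N & forall m, (m < n)%N -> Gamma (f m)].
Proof.
move=> nGr; have exn : exists n, `[< ~ Gamma (f n) >] by exists r; apply/asboolP.
exists (ex_minn exn); case: ex_minnP => n /asboolP nGn n_min; split=> //.
  by apply: n_min; apply/asboolP.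
move=> m mn; have [//|nGm] := pselect (Gamma (f m)).
by have := n_min m; rewrite asboolT // => /(_ isT); rewrite leqNgt mn.
Qed.

Lemma least_y : exists n, [/\ ~ Gamma (mono 0 n 0), (0 < n <= r)%N
  & forall m, (m < n)%N -> Gamma (mono 0 m 0)].
Proof.
have [|n [nGn nr n_lt]] := @ex_least (fun n => mono 0 n 0).
  move=> Gr; have yr1 : cls a (mono 0 r 0) - cls a (mono 0 0 0) = a%:Z * r%:Z.
    by rewrite /cls !monoE; lia.
  have := congr1 (fun X : mon => ydeg X) (Ggraph_cls Gr Ggraph_one yr1).
  by rewrite !monoE; lia.
exists n; split=> //; rewrite nr andbT lt0n; apply/eqP => n0.
by apply: nGn; rewrite n0; exact: Ggraph_one.
Qed.

Lemma least_z : exists n, [/\ ~ Gamma (mono 0 0 n), (0 < n <= r)%N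
  & forall m, (m < n)%N -> Gamma (mono 0 0 m)].
Proof.
have [|n [nGn nr n_lt]] := @ex_least (fun n => mono 0 0 n).
  move=> Gr; have zr1 : cls a (mono 0 0 r) - cls a (mono 0 0 0) = - a%:Z * r%:Z.
    by rewrite /cls !monoE; lia.
  have := congr1 (fun X : mon => zdeg X) (Ggraph_cls Gr Ggraph_one zr1).
  by rewrite !monoE; lia.
exists n; split=> //; rewrite nr andbT lt0n; apply/eqP => n0.
by apply: nGn; rewrite n0; exact: Ggraph_one.
Qed.

(** As [a] is a unit, some y^s with s < r has the weight of x^(r - 1), inverse to that of x. Then x
    y^s is invariant, and t = r - s. *)
Lemma first_basis_ex : exists s t, good r a (Basis 1 1 s t).
Proof.
have [b wtb] := pure_power_surj r_gt1 co_ra (wt r a (mono (r - 1) 0 0)).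
have /dvdzP[q] : (r%:Z %| cls a (mono 0 (b %% r) 0) - cls a (mono (r - 1) 0 0))%Z.
  apply/wt_eqP => //; rewrite -wtb /wt /chi !monoE !muln0 !addn0 !add0n.
  by apply/ord_inj; rewrite !val_Zp_nat // modnMmr.
rewrite /cls !monoE => qE; have br := ltn_pmod b (ltnW r_gt1).
set s := (b %% r)%N in qE br.
have s0 : (0 < s)%N.
  rewrite lt0n; apply/eqP => s0; rewrite s0 in qE.
  have q1 : 1 = (q + 1) * r%:Z by lia.
  by have : 1 = 0 :> int by apply: (mulz_small q1); lia.
exists s, (r - s)%N; split=> /=; try lia.
  by apply/dvdzP; exists (q + 1); lia.
by apply/dvdzP; exists (q + 1 - a%:Z); lia.
Qed.

Lemma flat_classification : ~ Gamma (mono 1 0 0) ->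
  exists B kappa, [/\ good r a B, bal B = 1%N, bbe B = 1%N, (kappa < r)%N
    & Gamma = flat r B kappa].
Proof.
move=> nGx; have [s [t gB]] := first_basis_ex.
have [[|kappa] [nGz /andP[// _ kr] Gz]] := least_z.
exists (Basis 1 1 s t), kappa; split=> //.
apply: (Ggraph_sub_eq GG); first exact: flat_Ggraph.
move=> X GX; apply/flatP; have yz := Ggraph_yz GX; move: GX yz; rewrite -(monoK X) !monoE.
move: (xdeg X) (ydeg X) (zdeg X) => x y z GX yz; split=> //.
- by case: x GX => // x GX; case: nGx; apply: Ggraph_le GX _ _ _.
- rewrite ltnNge; apply/negP => yk.
  have Gy : Gamma (mono 0 (r - kappa) 0) by apply: Ggraph_le GX _ _ _.
  have yzE : cls a (mono 0 (r - kappa) 0) - cls a (mono 0 0 kappa) = a%:Z * r%:Z.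
    rewrite /cls !monoE -subzn; lia.
  have := congr1 (fun X : mon => ydeg X) (Ggraph_cls Gy (Gz _ (leqnn _)) yzE).
  by rewrite !monoE; lia.
- rewrite leqNgt; apply/negP => zk; apply: nGz.
  by apply: Ggraph_le GX _ _ _.
Qed.

Section WithX.
Hypothesis Gx : Gamma (mono 1 0 0).
Variables jy kz : nat.
Hypotheses (nGy : ~ Gamma (mono 0 jy 0)) (jy_gt0 : (0 < jy)%N).
Hypothesis Gy : forall m, (m < jy)%N -> Gamma (mono 0 m 0).
Hypotheses (nGz : ~ Gamma (mono 0 0 kz)) (kz_gt0 : (0 < kz)%N).
Hypothesis Gz : forall m, (m < kz)%N -> Gamma (mono 0 0 m).

(* If all classes of pure powers were represented, x would be one of them. *)
Lemma pure_powers_lt j : Gamma (mono 0 0 j) -> (jy + j < r)%N.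
Proof.
move=> Gj; rewrite ltnNge; apply/negP => r_le.
have [c wtc] := pure_power_surj r_gt1 co_ra (wt r a (mono 1 0 0)).
have /dvdzP[q] := (wt_eqP _ _ r_gt1 le_ar).1 wtc; rewrite /cls !monoE => qE.
(* The powers z^j, ..., z, 1, y, ..., y^(jy - 1) have exponents -j, ..., jy - 1 over chi_a. If there
   are at least r of them, the class of c is met by w - j, so x shares its weight with one of these
   powers. *)
have cE := divn_eq (c + j) r; have := ltn_pmod (c + j) (ltnW r_gt1).
set u := ((c + j) %/ r)%N in cE; set w := ((c + j) %% r)%N in cE * => wr.
have [jw|wj] := leqP j w.
  have Gw : Gamma (mono 0 (w - j) 0) by apply: Gy; lia.
  have wx : cls a (mono 1 0 0) - cls a (mono 0 (w - j) 0) = (a%:Z * u%:Z - q) * r%:Z.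
    by rewrite /cls !monoE -subzn //; lia.
  by have := congr1 (fun X : mon => xdeg X) (Ggraph_cls Gx Gw wx); rewrite !monoE.
have Gw : Gamma (mono 0 0 (j - w)) by apply: Ggraph_le Gj _ _ _ => //; lia.
have wx : cls a (mono 1 0 0) - cls a (mono 0 0 (j - w)) = (a%:Z * u%:Z - q) * r%:Z.
  by rewrite /cls !monoE -subzn ?(ltnW wj) //; lia.
by have := congr1 (fun X : mon => xdeg X) (Ggraph_cls Gx Gw wx); rewrite !monoE.
Qed.

(** The representative of y^jy contains no y: otherwise dividing by y would give the representative
    of y^(jy - 1), which is y^(jy - 1) itself, and y^jy would be in the graph. It contains x:
    otherwise y^jy and z^j would have the same weight although 0 < jy + j < r. *)
Lemma rep_y : exists be j qb, [/\ Gamma (mono be 0 j), (0 < be)%N, (j < kz)%N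
  & be%:Z - a%:Z * (jy%:Z + j%:Z) = qb * r%:Z].
Proof.
have [Y GY [q qE]] := Ggraph_rep (mono 0 jy 0).
have yz := Ggraph_yz GY; move: GY qE yz; rewrite -(monoK Y) /cls !monoE.
move: (xdeg Y) (ydeg Y) (zdeg Y) => be i j GY qE yz.
have i0 : i = 0%N.
  case: i GY qE yz => // i GY qE [//|j0]; rewrite j0 in GY qE; exfalso.
  have GY' : Gamma (mono be i 0) by apply: Ggraph_le GY _ _ _.
  have yy : cls a (mono 0 jy.-1 0) - cls a (mono be i 0) = q * r%:Z.
    by rewrite /cls !monoE predn_int //; lia.
  have jy1 : (jy.-1 < jy)%N by lia.
  have eqm := Ggraph_cls (Gy jy1) GY' yy.
  have := congr1 (fun X : mon => ydeg X) eqm; rewrite !monoE => ii.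
  by apply: nGy; apply: Ggraph_le GY _ _ _; lia.
rewrite i0 in GY qE; exists be, j, (- q); split=> //.
- have jr := pure_powers_lt (Ggraph_le GY (leq0n _) (leqnn _) (leqnn _)).
  rewrite lt0n; apply/eqP => be0; rewrite be0 in qE.
  have : (r%:Z %| a%:Z * (jy%:Z + j%:Z))%Z by apply/dvdzP; exists q; lia.
  rewrite Gauss_dvdzr; last by rewrite /coprimez /gcdz /=; apply/eqP; rewrite (eqP co_ra).
  case/dvdzP => p pE; have : jy%:Z + j%:Z = 0 by apply: (mulz_small pE); lia.
  by lia.
- rewrite ltnNge; apply/negP => kj; apply: nGz.
  by apply: Ggraph_le GY _ _ _.
- lia.
Qed.

End WithX.
End Classification.

Lemma rep_z r a Gamma jy kz : (1 < r)%N -> (a <= r)%N -> coprime r a ->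
    Ggraph r a Gamma -> Gamma (mono 1 0 0) ->
    ~ Gamma (mono 0 jy 0) -> (0 < jy)%N ->
    ~ Gamma (mono 0 0 kz) -> (0 < kz)%N -> (forall m, (m < kz)%N -> Gamma (mono 0 0 m)) ->
  exists al k qa, [/\ Gamma (mono al k 0), (0 < al)%N, (k < jy)%N
  & al%:Z + a%:Z * (kz%:Z + k%:Z) = qa * r%:Z].
Proof.
move=> r_gt1 le_ar co_ra GG Gx nGy jy_gt0 nGz kz_gt0 Gz.
have GG' := Ggraph_swap r_gt1 le_ar GG.
have co_ra' := coprime_subr le_ar co_ra.
have swapGE i j k : swapG Gamma (mono i j k) = Gamma (mono i k j).
  by rewrite /swapG /= swapm_mono.
have [||||al [k [q [Gal al0 kj alE]]]] :=
    @rep_y _ _ r_gt1 (leq_subr _ _) co_ra' _ GG' _ kz jy _ kz_gt0 _ _ jy_gt0.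
1,2,4: by rewrite swapGE.
  by move=> m; rewrite swapGE; exact: Gz.
exists al, k, (q + kz%:Z + k%:Z); split=> //.
  by rewrite -swapGE.
by move: alE; rewrite -subzn //; lia.
Qed.

Section Classification.
Variables (r a : nat) (r_gt1 : (1 < r)%N) (le_ar : (a <= r)%N).
Hypothesis co_ra : coprime r a.
Variables (Gamma : set mon) (GG : Ggraph r a Gamma).
Hypothesis Gx : Gamma (mono 1 0 0).
Variables jy kz : nat.
Hypotheses (nGy : ~ Gamma (mono 0 jy 0)) (jy_gt0 : (0 < jy)%N).
Hypothesis Gy : forall m, (m < jy)%N -> Gamma (mono 0 m 0).
Hypotheses (nGz : ~ Gamma (mono 0 0 kz)) (kz_gt0 : (0 < kz)%N).
Hypothesis Gz : forall m, (m < kz)%N -> Gamma (mono 0 0 m).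
Variables (be j al k : nat) (qa qb : int).
Hypotheses (Gbe : Gamma (mono be 0 j)) (be_gt0 : (0 < be)%N) (lt_jk : (j < kz)%N).
Hypothesis beE : be%:Z - a%:Z * (jy%:Z + j%:Z) = qb * r%:Z.
Hypotheses (Gal : Gamma (mono al k 0)) (al_gt0 : (0 < al)%N) (lt_kj : (k < jy)%N).
Hypothesis alE : al%:Z + a%:Z * (kz%:Z + k%:Z) = qa * r%:Z.

Lemma Ggraph_ex_eq X Y q : Gamma X -> Gamma Y -> cls a X - cls a Y = q * r%:Z ->
  xdeg X = xdeg Y.
Proof. by move=> GX GY XY; rewrite (Ggraph_cls r_gt1 le_ar GG GX GY XY). Qed.

Local Notation s := (kz + k)%N.
Local Notation t := (jy + j)%N.

(** Here x and y are coordinates multiplied by the determinant, so (m, i) is a point of the triangle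
    with vertices 0, (al, s), (be, -t), other than these vertices. If it were in the lattice, two
    monomials of Gamma with different powers of x would have the same weight; the divisors of x^al
    y^k and x^be z^j and the pure powers below y^jy and z^kz suffice to find them. *)
Lemma no_relation_in_triangle (m i x y : int) :
    (al%:Z * t%:Z + be%:Z * s%:Z) * m = x * al%:Z + y * be%:Z ->
    (al%:Z * t%:Z + be%:Z * s%:Z) * i = x * s%:Z - y * t%:Z ->
    0 <= x < al%:Z * t%:Z + be%:Z * s%:Z -> 0 <= y < al%:Z * t%:Z + be%:Z * s%:Z ->
    0 < x + y <= al%:Z * t%:Z + be%:Z * s%:Z ->
  ~ (r%:Z %| m + a%:Z * i)%Z.
Proof.
set D := _ + _ => mE iE /andP[x0 xD] /andP[y0 yD] /andP[xy0 xyD] /dvdzP[q qE].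
have D0 : 0 < D by lia.
have m0 : 0 < m by nia.
have is_ : i < s%:Z by nia.
have it : - t%:Z < i by nia.
have mle : m <= al%:Z \/ m <= be%:Z.
  by have [ab|ba] := leqP al be; [right | left]; nia.
clear x y mE iE x0 xD y0 yD xy0 xyD D0.
case: m m0 mle qE => // m m0 mle qE.
have Gm : Gamma (mono m 0 0).
  by case: mle => mle; [apply: (Ggraph_le GG Gal) | apply: (Ggraph_le GG Gbe)].
have no_rel p X Y : Gamma X -> Gamma Y -> cls a X - cls a Y = p * r%:Z ->
    (xdeg Y < xdeg X)%N -> False.
  by move=> GX GY XY; rewrite (Ggraph_ex_eq GX GY XY) ltnn.
case: i is_ it qE => i is_ it; rewrite ?NegzE => qE.
  (* The relation compares x^m with z^i. If z^i may be missing, x^m y^(i - kz + 1) is compared with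
     z^(kz - 1); if moreover m > al, the vertex (al, s) is subtracted, leaving x^(m - al) against
     y^(s - i). *)
  have [ik|ki] := ltnP i kz.
    by apply: (no_rel q _ _ Gm (Gz ik)); rewrite ?monoE // /cls !monoE; lia.
  have kz1 : (kz.-1 < kz)%N by lia.
  have [ma|am] := leqP m al.
    have Gx' : Gamma (mono m (i - kz.-1) 0) by apply: (Ggraph_le GG Gal); lia.
    apply: (no_rel q _ _ Gx' (Gz kz1)); rewrite ?monoE // /cls !monoE.
    by rewrite -subzn ?predn_int //; lia.
  have Gx' : Gamma (mono (m - al) 0 0) by apply: (Ggraph_le GG Gbe); lia.
  have Gy' : Gamma (mono 0 (s - i) 0) by apply: (Ggraph_le GG Gal); lia.
  apply: (no_rel (q - qa) _ _ Gx' Gy'); rewrite ?monoE; last by lia.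
  by rewrite /cls !monoE -!subzn //; lia.
have [ij|ji] := ltnP i.+1 jy.
  by apply: (no_rel q _ _ Gm (Gy ij)); rewrite ?monoE // /cls !monoE; lia.
have jy1 : (jy.-1 < jy)%N by lia.
have [mb|bm] := leqP m be.
  have Gx' : Gamma (mono m 0 (i.+1 - jy.-1)) by apply: (Ggraph_le GG Gbe); lia.
  apply: (no_rel q _ _ Gx' (Gy jy1)); rewrite ?monoE // /cls !monoE.
  by rewrite -subzn ?predn_int //; lia.
have Gx' : Gamma (mono (m - be) 0 0) by apply: (Ggraph_le GG Gal); lia.
have Gz' : Gamma (mono 0 0 (t - i.+1)) by apply: (Ggraph_le GG Gbe); lia.
apply: (no_rel (q - qb) _ _ Gx' Gz'); rewrite ?monoE; last by lia.
by rewrite /cls !monoE -!subzn //; lia.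
Qed.

(* Reduce the coordinates of (m, i) modulo the lattice spanned by (al, s) and
   (be, -t), and reflect the parallelogram if needed. *)
Lemma dvd_coordinates (m i : int) : (r%:Z %| m + a%:Z * i)%Z ->
  (al%:Z * t%:Z + be%:Z * s%:Z %| t%:Z * m + be%:Z * i)%Z /\
  (al%:Z * t%:Z + be%:Z * s%:Z %| s%:Z * m - al%:Z * i)%Z.
Proof.
set D := al%:Z * t%:Z + _; set x := t%:Z * m + _; set y := s%:Z * m - _ => /dvdzP[q qE].
have D0 : 0 < D.
  by rewrite /D -!PoszM -PoszD ltz_nat addn_gt0 muln_gt0 al_gt0 addn_gt0 jy_gt0.
have xE := divz_eq x D; have yE := divz_eq y D.
have := modz_ge0 x (lt0r_neq0 D0); have := modz_ge0 y (lt0r_neq0 D0).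
have := ltz_pmod x D0; have := ltz_pmod y D0.
set x1 := (x %% D)%Z in xE *; set y1 := (y %% D)%Z in yE *.
move: (x %/ D)%Z (y %/ D)%Z xE yE => x0 y0 xE yE y1D x1D y1_ge0 x1_ge0.
suff [x10 y10] : x1 = 0 /\ y1 = 0.
  by split; apply/dvdzP; [exists x0|exists y0]; rewrite ?xE ?yE ?x10 ?y10 addr0.
have [//|nz] := pselect (x1 = 0 /\ y1 = 0).
pose m1 := m - al%:Z * x0 - be%:Z * y0; pose i1 := i - s%:Z * x0 + t%:Z * y0.
have m1E : D * m1 = x1 * al%:Z + y1 * be%:Z.
  have -> : x1 = x - x0 * D by rewrite xE; ring.
  have -> : y1 = y - y0 * D by rewrite yE; ring.
  by rewrite /m1 /D /x /y; ring.
have i1E : D * i1 = x1 * s%:Z - y1 * t%:Z.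
  have -> : x1 = x - x0 * D by rewrite xE; ring.
  have -> : y1 = y - y0 * D by rewrite yE; ring.
  by rewrite /i1 /D /x /y; ring.
have q1E : m1 + a%:Z * i1 = (q - qa * x0 - qb * y0) * r%:Z.
  by rewrite !mulrBl -qE (mulrAC qa) (mulrAC qb) -alE -beE /m1 /i1 !PoszD; ring.
have [le_D|gt_D] := leP (x1 + y1) D.
  case: (@no_relation_in_triangle m1 i1 x1 y1); rewrite -/D //; try lia.
  by apply/dvdzP; exists (q - qa * x0 - qb * y0).
case: (@no_relation_in_triangle (al%:Z + be%:Z - m1) (s%:Z - t%:Z - i1) (D - x1) (D - y1));
  rewrite -/D; try lia.
- apply/dvdzP; exists (qa + qb - (q - qa * x0 - qb * y0)).
  by rewrite mulrBl -q1E mulrDl -alE -beE !PoszD; ring.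
Qed.

(** The lattice vectors (r, 0) and (-a, 1) have integral coordinates over (al, s) and (be, -t). With
    determinant D r, this makes s, t, qa and qb divisible by D, so D = t qa + s qb is divisible by
    D^2 and D = 1. *)
Lemma det_eq : (al * t + be * s = r)%N.
Proof.
have r0 : r%:Z != 0 by lia.
set D := t%:Z * qa + s%:Z * qb.
have DE : al%:Z * t%:Z + be%:Z * s%:Z = D * r%:Z.
  have -> : D * r%:Z = t%:Z * (qa * r%:Z) + s%:Z * (qb * r%:Z) by rewrite /D; ring.
  by rewrite -alE -beE !PoszD; ring.
have D0 : 0 < D by nia.
have cancel x y : D * r%:Z * x = y * r%:Z -> y = x * D.
  by move=> /esym; rewrite mulrAC => /(mulIf r0) ->; rewrite mulrC.
have [|/dvdzP[t' tE] /dvdzP[s' sE]] := @dvd_coordinates r%:Z 0.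
  by rewrite mulr0 addr0.
have [|/dvdzP[b' bE] /dvdzP[a' aE]] := @dvd_coordinates (- a%:Z) 1.
  by rewrite mulr1 addNr.
have t'E : t%:Z = t' * D by apply: cancel; rewrite mulrC -DE -tE; ring.
have s'E : s%:Z = s' * D by apply: cancel; rewrite mulrC -DE -sE; ring.
have b'E : qb = b' * D.
  by apply: cancel; rewrite mulrC -DE -bE -beE !PoszD; ring.
have a'E : qa = - a' * D.
  by apply: cancel; rewrite mulrC mulNr -DE -aE -alE !PoszD; ring.
have D1 : D = 1.
  have : D = (t' * - a' + s' * b') * D * D by rewrite {1}/D t'E s'E a'E b'E; ring.
  set u := t' * - a' + _ => uE; have u1 : u * D = 1.
    by apply: (mulIf (lt0r_neq0 D0)); rewrite mul1r -uE.
  have : (D %| 1)%Z by apply/dvdzP; exists u.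
  by rewrite dvdz1; move: D0; clear; lia.
by move: DE; rewrite D1; lia.
Qed.

(** Only the inclusion of Gamma in [tee B j k] needs an argument: a monomial violating a bound of
    [teeP] forces either an excluded pure power or two monomials of equal weight into Gamma. *)
Lemma tee_classification : exists B, [/\ good r a B, (j + k < bs B)%N,
  (j + k < bt B)%N & Gamma = tee B j k].
Proof.
have det := det_eq.
have gB : good r a (Basis al be s t).
  split=> /=; try lia; first by apply/dvdzP; exists qa; rewrite -alE PoszD.
  by apply/dvdzP; exists qb; rewrite -beE PoszD.
exists (Basis al be s t); split=> //=; try lia.
apply: (Ggraph_sub_eq GG); first by apply: tee_Ggraph => //=; lia.
have no_rel p X Y : Gamma X -> Gamma Y -> cls a X - cls a Y = p * r%:Z ->
    (xdeg Y < xdeg X)%N -> False.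
  by move=> GX GY' XY; rewrite (Ggraph_ex_eq GX GY' XY) ltnn.
move=> X GX; apply/teeP; have yz := Ggraph_yz r_gt1 le_ar co_ra GG GX.
move: GX yz; rewrite -(monoK X) !monoE; move: (xdeg X) (ydeg X) (zdeg X) => x y z GX yz /=.
have jy1 : (jy.-1 < jy)%N by lia.
have kz1 : (kz.-1 < kz)%N by lia.
split=> //; split.
- rewrite ltnNge; apply/negP => x_ge.
  have Gx' : Gamma (mono (al + be) 0 0) by apply: (Ggraph_le GG GX).
  have [ts|st] := leqP s t.
    have lt_y : (t - s < jy)%N by lia.
    apply: (no_rel (qa + qb) _ _ Gx' (Gy lt_y)); rewrite ?monoE //; last by lia.
    by rewrite /cls !monoE -subzn //; lia.
  have lt_z : (s - t < kz)%N by lia.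
  apply: (no_rel (qa + qb) _ _ Gx' (Gz lt_z)); rewrite ?monoE //; last by lia.
  by rewrite /cls !monoE -subzn ?(ltnW st) //; lia.
- have [yk|ky] := leqP y k; [by left | right; rewrite ltnNge; apply/negP => x_ge].
  have Gx' : Gamma (mono al k.+1 0) by apply: (Ggraph_le GG GX).
  apply: (no_rel qa _ _ Gx' (Gz kz1)); rewrite ?monoE //.
  by rewrite /cls !monoE predn_int //; lia.
- have [zj|jz] := leqP z j; [by left | right; rewrite ltnNge; apply/negP => x_ge].
  have Gx' : Gamma (mono be 0 j.+1) by apply: (Ggraph_le GG GX).
  apply: (no_rel qb _ _ Gx' (Gy jy1)); rewrite ?monoE //.
  by rewrite /cls !monoE predn_int //; lia.
- rewrite ltnNge; apply/negP => y_ge; apply: nGy.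
  by apply: (Ggraph_le GG GX) => //; lia.
- rewrite ltnNge; apply/negP => z_ge; apply: nGz.
  by apply: (Ggraph_le GG GX) => //; lia.
Qed.

End Classification.

Lemma Ggraph_classification r a Gamma : (1 < r)%N -> (a <= r)%N -> coprime r a ->
    Ggraph r a Gamma ->
  (exists B j k, [/\ good r a B, (j + k < bs B)%N, (j + k < bt B)%N & Gamma = tee B j k]) \/
  (exists B kappa, [/\ good r a B, bal B = 1%N, bbe B = 1%N, (kappa < r)%N
    & Gamma = flat r B kappa]).
Proof.
move=> r_gt1 le_ar co_ra GG.
have [Gx|nGx] := pselect (Gamma (mono 1 0 0)); [left | by right; apply: flat_classification].
have [jy [nGy /andP[jy0 _] Gy]] := least_y r_gt1 le_ar co_ra GG.
have [kz [nGz /andP[kz0 _] Gz]] := least_z r_gt1 le_ar co_ra GG.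
have [be [j [qb [Gbe be0 jk beE]]]] := rep_y r_gt1 le_ar co_ra GG Gx nGy jy0 Gy nGz kz0.
have [al [k [qa [Gal al0 kj alE]]]] := rep_z r_gt1 le_ar co_ra GG Gx nGy jy0 nGz kz0 Gz.
have [B HB] := tee_classification r_gt1 le_ar co_ra GG nGy jy0 Gy nGz kz0 Gz
  Gbe be0 jk beE Gal al0 kj alE.
by exists B, j, k.
Qed.

(** * Cones and their faces *)

Section LinearForms.
Variable R : realType.
Implicit Types (c f g h : 'cV[R]_3) (v w : 'rV[R]_3) (S F : set 'rV[R]_3).

Definition ev c w : R := (w *m c) 0 0.

Lemma evDl c w w' : ev c (w + w') = ev c w + ev c w'.
Proof. by rewrite /ev mulmxDl mxE. Qed.
Lemma evZl c x w : ev c (x *: w) = x * ev c w.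
Proof. by rewrite /ev -scalemxAl mxE. Qed.
Lemma evNl c w : ev c (- w) = - ev c w.
Proof. by rewrite /ev mulNmx mxE. Qed.
Lemma evDr c c' w : ev (c + c') w = ev c w + ev c' w.
Proof. by rewrite /ev mulmxDr mxE. Qed.
Lemma evZr c x w : ev (x *: c) w = x * ev c w.
Proof. by rewrite /ev -scalemxAr mxE. Qed.
Lemma evNr c w : ev (- c) w = - ev c w.
Proof. by rewrite /ev mulmxN mxE. Qed.
Lemma ev0l c : ev c 0 = 0.
Proof. by rewrite /ev mul0mx mxE. Qed.
Definition ev_lin := (evDl, evDr, evZl, evZr, evNl, evNr).

Lemma mulmx_ev0 c w : (w *m c = 0) <-> ev c w = 0.
Proof.
rewrite /ev; split=> [->|wc]; first by rewrite mxE.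
by apply/matrixP => i j; rewrite !ord1 wc mxE.
Qed.

Definition slice S f : set 'rV[R]_3 := S `&` [set w | ev f w = 0].

Lemma is_faceP F S : is_face F S <->
  exists c, (forall w, S w -> 0 <= ev c w) /\ F = slice S c.
Proof.
split=> -[c [Sc ->]]; exists c; split=> //; apply/seteqP;
  by split=> w [Sw] /mulmx_ev0.
Qed.

Definition indep (b0 b1 : 'rV[R]_3) :=
  forall x y : R, x *: b0 + y *: b1 = 0 -> x = 0 /\ y = 0.

Lemma has_dim2P F : has_dim F 2 <-> exists b0 b1, [/\ F b0, F b1, indep b0 b1
  & forall w, F w -> exists x y : R, w = x *: b0 + y *: b1].
Proof.
have rowE (u : 'rV[R]_2) (B : 'M[R]_(2, 3)) :
    u *m B = u 0 0 *: row 0 B + u 0 1 *: row 1 B.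
  rewrite mulmx_sum_row !big_ord_recl big_ord0 addr0.
  by congr (_ + u 0 _ *: row _ B); apply/val_inj.
split=> [[B [Bfree FB Fsub]]|[b0 [b1 [F0 F1 ind Fsub]]]].
  exists (row 0 B), (row 1 B); split=> // [x y xy0|w Fw].
    have : (\row_i (if i == 0 then x else y)) *m B = 0 by rewrite rowE !mxE.
    move/eqP; rewrite (mulmx_free_eq0 _ Bfree) => /eqP/rowP u0.
    by have := u0 0; have := u0 1; rewrite !mxE /=.
  by have /submxP[u ->] := Fsub w Fw; exists (u 0 0), (u 0 1); rewrite rowE.
pose B := \matrix_(i < 2) (if i == 0 then b0 else b1).
have B0 : row 0 B = b0 by rewrite rowK.
have B1 : row 1 B = b1 by rewrite rowK.
exists B; split=> [|i|w Fw].
- apply: inj_row_free => u; rewrite rowE B0 B1 => /ind[u0 u1].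
  apply/rowP => i; rewrite mxE; case: i => [[|[|//]] i_lt].
    by rewrite -[RHS]u0; congr (u 0 _); apply/val_inj.
  by rewrite -[RHS]u1; congr (u 0 _); apply/val_inj.
- by rewrite rowK; case: ifP.
- have [x [y ->]] := Fsub w Fw.
  apply/submxP; exists (\row_i (if i == 0 then x else y)).
  by rewrite rowE B0 B1 !mxE.
Qed.

Lemma has_dim1P F : has_dim F 1 -> exists b, [/\ F b, b != 0
  & forall w, F w -> exists x : R, w = x *: b].
Proof.
move=> [B [Bfree FB Fsub]]; exists (row 0 B); split=> // [|w Fw].
  apply/eqP => B0; have : (1%:M : 'M[R]_1) *m B = 0.
    by rewrite mul1mx; apply/row_matrixP => i; rewrite ord1 B0 row0.
  by move/eqP; rewrite (mulmx_free_eq0 _ Bfree) oner_eq0.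
have /submxP[u ->] := Fsub w Fw; exists (u 0 0).
by rewrite mulmx_sum_row big_ord_recl big_ord0 addr0.
Qed.

(** The forms [f] and [g] are coordinates on the quotient of the space by the line of [v]. *)
Record frame v f g : Prop := Frame {
  frame_nz : v != 0;
  frame_f0 : ev f v = 0;
  frame_g0 : ev g v = 0;
  frame_dualf : exists p, ev f p = 1 /\ ev g p = 0;
  frame_dualg : exists q, ev f q = 0 /\ ev g q = 1;
  frame_line : forall w, ev f w = 0 -> ev g w = 0 -> exists x : R, w = x *: v }.

Lemma frame_sym v f g : frame v f g -> frame v g f.
Proof.
case=> v0 fv gv [p [fp gp]] [q [fq gq]] line; split=> //.
- by exists q.
- by exists p.
- by move=> w gw fw; apply: line.
Qed.

Lemma frame_comb v f g f' g' (x y x' y' : R) : frame v f g ->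
    (forall w, ev f' w = x * ev f w + y * ev g w) ->
    (forall w, ev g' w = x' * ev f w + y' * ev g w) ->
    x * y' - x' * y != 0 ->
  frame v f' g'.
Proof.
case=> v0 fv gv [p [fp gp]] [q [fq gq]] line f'E g'E.
set d := x * y' - _ => d0; split=> //.
- by rewrite f'E fv gv !mulr0 addr0.
- by rewrite g'E fv gv !mulr0 addr0.
- exists ((y' / d) *: p - (x' / d) *: q).
  rewrite f'E g'E !ev_lin fp fq gp gq /d; split; field; exact: d0.
- exists ((x / d) *: q - (y / d) *: p).
  rewrite f'E g'E !ev_lin fp fq gp gq /d; split; field; exact: d0.
- move=> w; rewrite f'E g'E => f'0 g'0.
  have fw : d * ev f w = 0.
    by transitivity (y' * (x * ev f w + y * ev g w) - y * (x' * ev f w + y' * ev g w));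
      [rewrite /d; ring | rewrite f'0 g'0; ring].
  have gw : d * ev g w = 0.
    by transitivity (x * (x' * ev f w + y' * ev g w) - x' * (x * ev f w + y * ev g w));
      [rewrite /d; ring | rewrite f'0 g'0; ring].
  by apply: line; apply: (mulfI d0); rewrite mulr0.
Qed.

(* Near v, the cone S is the wedge 0 <= f, 0 <= g. *)
Record wedge S v f g : Prop := Wedge {
  wedge_frame : frame v f g;
  wedge_v : S v;
  wedge_ge : forall w, S w -> 0 <= ev f w /\ 0 <= ev g w;
  wedge_loc : forall w, 0 <= ev f w -> 0 <= ev g w ->
    exists2 e : R, 0 < e & S (v + e *: w) }.

Lemma wedge_sym S v f g : wedge S v f g -> wedge S v g f.
Proof.
case=> /frame_sym fr Sv ge loc; split=> // [w /ge[? ?] //|w gw fw].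
exact: loc.
Qed.

Lemma frame_indep v f g w (e : R) : frame v f g -> e != 0 -> ev g w = 1 ->
  indep v (v + e *: w).
Proof.
move=> fr e0 gw x y xy0.
have := ev0l g; rewrite -xy0 !ev_lin (frame_g0 fr) gw mulr0 add0r mulr1 add0r.
move=> /eqP; rewrite mulf_eq0 (negbTE e0) orbF => /eqP y0; split=> //.
move: xy0; rewrite y0 scale0r addr0 => /eqP.
by rewrite scaler_eq0 (negbTE (frame_nz fr)) orbF => /eqP.
Qed.

Lemma slice_dim S v f g : wedge S v f g -> has_dim (slice S f) 2.
Proof.
case=> fr Sv ge loc; have [q [fq gq]] := frame_dualg fr.
have [||e e0 Se] := loc q; rewrite ?fq ?gq //.
have e_n0 := lt0r_neq0 e0; apply/has_dim2P; exists v, (v + e *: q); split.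
- by split=> //; exact: frame_f0 fr.
- by split=> //=; rewrite !ev_lin fq (frame_f0 fr) mulr0 addr0.
- exact: frame_indep fr e_n0 gq.
move=> w [Sw /= fw]; have [||x wE] := frame_line fr (w := w - ev g w *: q).
- by rewrite !ev_lin fw fq mulr0 subr0.
- by rewrite !ev_lin gq mulr1 subrr.
exists (x - ev g w / e), (ev g w / e).
rewrite scalerDr scalerA divfK // addrA -scalerDl subrK -wE.
by rewrite subrK.
Qed.

Lemma slice_face S v f g : wedge S v f g ->
  [/\ is_face (slice S f) S, has_dim (slice S f) 2 & slice S f v].
Proof.
move=> W; split; last by split; [exact: wedge_v W | exact: frame_f0 (wedge_frame W)].
  by apply/is_faceP; exists f; split=> // w /(wedge_ge W)[].
exact: slice_dim W.
Qed.

Lemma dim2_not_line F v : has_dim F 2 -> (forall w, F w -> exists x : R, w = x *: v) -> False.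
Proof.
move=> /has_dim2P[b0 [b1 [F0 F1 ind _]]] line.
have [x0 b0E] := line _ F0; have [x1 b1E] := line _ F1.
have [|_ x00] := ind x1 (- x0); first by rewrite b0E b1E !scalerA -scalerDl mulrC mulNr
    subrr scale0r.
have [] := ind 1 0; last by move/eqP; rewrite oner_eq0.
by rewrite scale0r addr0 scale1r b0E -[x0]opprK x00 oppr0 scale0r.
Qed.

(** A supporting form c that vanishes at v is a combination of f and g, and its coefficients are
    nonnegative because the wedge contains points in both dual directions. One zero coefficient
    gives a side; none gives only the line of v; two give all of S. *)
Lemma wedge_faces S v f g F : wedge S v f g ->
  is_face F S -> has_dim F 2 -> F v -> F = slice S f \/ F = slice S g.
Proof.
move=> W /is_faceP[c [Sc FE]] F2 Fv; have fr := wedge_frame W.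
have [p [fp gp]] := frame_dualf fr; have [q [fq gq]] := frame_dualg fr.
have cv : ev c v = 0 by move: Fv; rewrite FE => -[].
have [||e e0 Sp] := wedge_loc W (w := p); rewrite ?fp ?gp //.
have [||e' e'0 Sq] := wedge_loc W (w := q); rewrite ?fq ?gq //.
have cp : 0 <= ev c p.
  by have := Sc _ Sp; rewrite !ev_lin cv add0r pmulr_rge0.
have cq : 0 <= ev c q.
  by have := Sc _ Sq; rewrite !ev_lin cv add0r pmulr_rge0.
have cE w : ev c w = ev f w * ev c p + ev g w * ev c q.
  have [||x wE] := frame_line fr (w := w - ev f w *: p - ev g w *: q).
  - by rewrite !ev_lin fp fq; ring.
  - by rewrite !ev_lin gp gq; ring.
  have -> : w = x *: v + ev g w *: q + ev f w *: p by rewrite -wE !subrK.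
  by rewrite !ev_lin cv fp fq gp gq (frame_f0 fr) (frame_g0 fr); ring.
have [cp0|cp_n0] := eqVneq (ev c p) 0; have [cq0|cq_n0] := eqVneq (ev c q) 0.
(* The face would be S itself, but v, v + e p and v + e' q are three independent vectors of S. *)
- have F_all w : S w -> F w by rewrite FE => Sw; split=> //=; rewrite cE cp0 cq0; ring.
  move/has_dim2P: F2 => [b0 [b1 [_ _ _ Fsub]]]; exfalso.
  have [x0 [y0 E0]] := Fsub _ (F_all _ (wedge_v W)).
  have [x1 [y1 E1]] := Fsub _ (F_all _ Sp); have [x2 [y2 E2]] := Fsub _ (F_all _ Sq).
  have rel : (x1 * y2 - x2 * y1) *: v - (x0 * y2 - x2 * y0) *: (v + e *: p)
      + (x0 * y1 - x1 * y0) *: (v + e' *: q) = 0.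
    rewrite E1 E2 E0; apply/rowP => i; rewrite !mxE; ring.
  have gE := congr1 (ev g) rel; have fE := congr1 (ev f) rel.
  move: fE gE; rewrite !ev_lin !ev0l fp fq gp gq (frame_f0 fr) (frame_g0 fr).
  rewrite !(mulr0, add0r, addr0, mulr1, oppr0) => /eqP.
  rewrite oppr_eq0 mulf_eq0 (gt_eqF e0) orbF => /eqP d1 /eqP.
  rewrite mulf_eq0 (gt_eqF e'0) orbF => /eqP d2.
  have d2' : x0 * y1 = x1 * y0 by apply/eqP; rewrite -subr_eq0 d2.
  have v_n0 := frame_nz fr.
  have key : y0 *: (v + e *: p) = y1 *: v.
    rewrite E1 E0; apply/rowP => i; rewrite !mxE.
    have -> : y0 * (x1 * b0 0 i + y1 * b1 0 i) = x1 * y0 * b0 0 i + y0 * y1 * b1 0 i by ring.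
    by rewrite -d2'; ring.
  have key' : x0 *: (v + e *: p) = x1 *: v.
    rewrite E1 E0; apply/rowP => i; rewrite !mxE.
    have -> : x0 * (x1 * b0 0 i + y1 * b1 0 i) = x0 * x1 * b0 0 i + x0 * y1 * b1 0 i by ring.
    by rewrite d2'; ring.
  have := congr1 (ev f) key; have := congr1 (ev f) key'.
  rewrite !ev_lin fp (frame_f0 fr) !mulr0 !add0r !mulr1 => /eqP.
  rewrite mulf_eq0 (gt_eqF e0) orbF => /eqP x00 /eqP.
  rewrite mulf_eq0 (gt_eqF e0) orbF => /eqP y00.
  by move: v_n0; rewrite E0 x00 y00 !scale0r addr0 eqxx.
- right; rewrite FE; apply/seteqP; split=> w [Sw /= cw]; split=> //=.
    by move: cw; rewrite cE cp0 mulr0 add0r => /eqP; rewrite mulf_eq0 (negbTE cq_n0) orbF => /eqP.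
  by rewrite cE cw cp0; ring.
- left; rewrite FE; apply/seteqP; split=> w [Sw /= cw]; split=> //=.
    by move: cw; rewrite cE cq0 mulr0 addr0 => /eqP; rewrite mulf_eq0 (negbTE cp_n0) orbF => /eqP.
  by rewrite cE cw cq0; ring.
- exfalso; apply: (dim2_not_line (v := v) F2) => w; rewrite FE => -[Sw /= cw].
  have [fw gw] := wedge_ge W Sw.
  move/eqP: cw; rewrite cE paddr_eq0 ?mulr_ge0 // !mulf_eq0.
  rewrite (negbTE cp_n0) (negbTE cq_n0) !orbF => /andP[/eqP f0 /eqP g0].
  exact: (frame_line fr f0 g0).
Qed.

(** Constraints positive at v stay satisfied for a short move, and the others at v follow from f and
    g being nonnegative; finitely many constraints leave a common step length. *)
Lemma wedge_poly S v f g (H : seq 'cV[R]_3) :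
    (forall w, S w <-> forall h, h \in H -> 0 <= ev h w) ->
    frame v f g ->
    (forall w, S w -> 0 <= ev f w /\ 0 <= ev g w) ->
    (forall h, h \in H -> 0 < ev h v \/ exists x y : R,
       [/\ 0 <= x, 0 <= y & forall w, ev h w = x * ev f w + y * ev g w]) ->
  wedge S v f g.
Proof.
move=> SH fr ge hH; split=> //.
  apply/SH => h /hH[/ltW //|[x [y [_ _ ->]]]].
  by rewrite (frame_f0 fr) (frame_g0 fr) !mulr0 addr0.
move=> w fw gw.
suff [e e0 he] : exists2 e : R, 0 < e &
    forall h, h \in H -> forall e', 0 < e' <= e -> 0 <= ev h (v + e' *: w).
  by exists e => //; apply/SH => h /he; apply; rewrite e0 lexx.
clear SH; elim: H hH => [|h H IHH] hH; first by exists 1.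
have [h' h'H|e e0 he] := IHH; first by apply: hH; rewrite inE h'H orbT.
have [hv|[x [y [x0 y0 hE]]]] := hH h (mem_head _ _); last first.
  exists e => // h' /predU1P[-> e' /andP[e'0 _]|]; last exact: he.
  rewrite hE !ev_lin (frame_f0 fr) (frame_g0 fr) !add0r.
  by rewrite addr_ge0 // mulr_ge0 // mulr_ge0 // ltW.
(* For e' <= d the value at v outweighs the change e' [ev h w]; the summand 1 avoids a division by
   zero. *)
pose d := ev h v / (1 + `|ev h w|).
have n0 : 0 < 1 + `|ev h w| by rewrite ltr_pwDl.
have d0 : 0 < d by rewrite divr_gt0.
exists (Num.min e d); first by rewrite lt_min e0.
move=> h' /predU1P[->|h'H] e' /andP[e'0]; rewrite le_min => /andP[e'e e'd]; last first.
  by apply: he => //; rewrite e'0.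
rewrite !ev_lin; move: e'd; rewrite ler_pdivlMr // mulrDr mulr1 => e'd.
have : - (e' * `|ev h w|) <= e' * ev h w.
  by rewrite -mulrN ler_pM2l // lerNl -normrN ler_norm.
by lra.
Qed.

End LinearForms.

(** * The cones around a ray, and affine coordinates for them *)

Section Fan.
Variables (R : realType) (r a : nat) (r_gt1 : (1 < r)%N) (le_ar : (a <= r)%N).
Hypothesis co_ra : coprime r a.
Implicit Types (f g h : 'cV[R]_3) (v w : 'rV[R]_3) (B : basis).

Lemma Ggraph_interior Gamma : Ggraph r a Gamma -> exists n, in_interior r a Gamma n.
Proof.
move=> GG; have := Ggraph_classification r_gt1 le_ar co_ra GG.
case=> [[B [j [k [gB js jt ->]]]]|[B [kappa [gB al1 be1 kr ->]]]].
  have [n nW] := tee_weight_ex r_gt1 le_ar gB js jt; exists n.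
  exact: (rewriting_interior (tee_rewriting r_gt1 le_ar gB js jt nW)
    (tee_inj r_gt1 le_ar gB js jt)).
exists (flat_weight r kappa).
exact: (rewriting_interior (flat_rewriting r_gt1 le_ar co_ra gB al1 be1 kr)
  (flat_inj r_gt1 le_ar co_ra al1 be1 kr)).
Qed.

Lemma dotm_nweight (n X : mon) : dotm (\row_i (n i)%:R : 'rV[R]_3) X = (nweight n X)%:R.
Proof. by rewrite dotmE !mxE /nweight !natrD !natrM. Qed.

(** An interior direction of the cone of Gamma points from v into some listed wedge. After a small
    step the point is in the listed cone and satisfies the inequalities of Gamma strictly, so both
    graphs are the one it selects. *)
Lemma Ggraph_of_wedges v Gamma (cs : seq (set mon * 'cV[R]_3 * 'cV[R]_3)) :
    (forall c, List.In c cs -> Ggraph r a c.1.1 /\ wedge (sigma r a c.1.1) v c.1.2 c.2) ->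
    (forall w, exists2 c, List.In c cs & 0 <= ev c.1.2 w /\ 0 <= ev c.2 w) ->
    Ggraph r a Gamma -> sigma r a Gamma v ->
  exists2 c, List.In c cs & Gamma = c.1.1.
Proof.
move=> cs_wedge cover GG Gv; have [n n_int] := Ggraph_interior GG.
pose w0 : 'rV[R]_3 := \row_i (n i)%:R.
have [c c_in [fw gw]] := cover w0; exists c => //.
have [Gc W] := cs_wedge c c_in; have [e e0 Sw] := wedge_loc W fw gw.
have [nc nc_int] := Ggraph_interior Gc.
apply/esym; apply: (Ggraph_eq_of_strict (w := v + e *: w0) Gc GG) => X Y nX GY wtY.
  by have [] := sigma_all Gc nc_int Sw nX GY wtY.
have [le_v lt_n] := sigma_all GG n_int Gv nX GY wtY.
have dotmDl w w' Z : dotm (w + w') Z = dotm w Z + dotm w' Z :> R.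
  by rewrite !dotmE !mxE; ring.
have dotmZl x w Z : dotm (x *: w) Z = x * dotm w Z :> R.
  by rewrite !dotmE !mxE; ring.
by rewrite !dotmDl !dotmZl !dotm_nweight ler_ltD // ltr_pM2l // ltr_nat.
Qed.

Lemma edges_of_wedges v (cs : seq (set mon * 'cV[R]_3 * 'cV[R]_3)) :
    (forall c, List.In c cs -> Ggraph r a c.1.1 /\ wedge (sigma r a c.1.1) v c.1.2 c.2) ->
    (forall w, exists2 c, List.In c cs & 0 <= ev c.1.2 w /\ 0 <= ev c.2 w) ->
  forall E, edges r a v E <-> exists2 c, List.In c cs &
    E = slice (sigma r a c.1.1) c.1.2 \/ E = slice (sigma r a c.1.1) c.2.
Proof.
move=> cs_wedge cover E; split=> [[[Gamma [GG E_face E2]] Ev]|[c c_in]].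
  have Gv : sigma r a Gamma v by move: E_face Ev => [u [_ ->]] [].
  have [c c_in GE] := Ggraph_of_wedges cs_wedge cover GG Gv; exists c => //.
  have [_ W] := cs_wedge c c_in; rewrite GE in E_face.
  exact: wedge_faces W E_face E2 Ev.
have [Gc W] := cs_wedge c c_in.
case=> ->; [have [? ? ?] := slice_face W | have [? ? ?] := slice_face (wedge_sym W)].
all: by split=> //; exists c.1.1.
Qed.

Definition cov3 (x y z : R) : 'cV[R]_3 := \col_i nth 0 [:: x; y; z] i.

Lemma ev_cov3 x y z w : ev (cov3 x y z) w = x * w 0 0 + y * w 0 1 + z * w 0 2.
Proof.
rewrite /ev mxE !big_ord_recl big_ord0 !mxE /= addr0 addrA.
by rewrite ![_ * (w _ _)]mulrC; congr (w _ _ * _ + w _ _ * _ + w _ _ * _); apply/val_inj.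
Qed.

Lemma rV3_eq w w' : w 0 0 = w' 0 0 -> w 0 1 = w' 0 1 -> w 0 2 = w' 0 2 -> w = w'.
Proof. by move=> w0 w1 w2; apply/rowP; apply: ord3P. Qed.

Lemma cV3_eq f g : f 0 0 = g 0 0 -> f 1 0 = g 1 0 -> f 2 0 = g 2 0 -> f = g.
Proof. by move=> f0 f1 f2; apply/colP; apply: ord3P. Qed.

(* The cone of [tee B j k] is a piece of the unit square with corner (j, k) in the
   affine coordinates Pf / uf, Qf / uf. *)
Definition uf : 'cV[R]_3 := cov3 0 1 1.
Definition Pf B : 'cV[R]_3 := cov3 (- (bbe B)%:R) (bt B)%:R 0.
Definition Qf B : 'cV[R]_3 := cov3 (- (bal B)%:R) 0 (bs B)%:R.
Definition pform B j := Pf B - j%:R *: uf.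
Definition qform B k := Qf B - k%:R *: uf.

Lemma ev_pform B j w : ev (pform B j) w = ev (Pf B) w - j%:R * ev uf w.
Proof. by rewrite /pform evDr evNr evZr. Qed.
Lemma ev_qform B k w : ev (qform B k) w = ev (Qf B) w - k%:R * ev uf w.
Proof. by rewrite /qform evDr evNr evZr. Qed.
Definition evforms := (ev_pform, ev_qform, evDr, evNr, evZr).

Lemma pform0 B : pform B 0 = Pf B. Proof. by rewrite /pform scale0r subr0. Qed.
Lemma qform0 B : qform B 0 = Qf B. Proof. by rewrite /qform scale0r subr0. Qed.

Section Basis.
Variables (B : basis) (gB : good r a B).

Lemma detR : (bal B)%:R * (bt B)%:R + (bbe B)%:R * (bs B)%:R = r%:R :> R.
Proof. by rewrite -!natrM -natrD (bdet gB). Qed.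

Lemma rR_neq0 : r%:R != 0 :> R.
Proof. by rewrite pnatr_eq0 -lt0n ltnW. Qed.

Lemma coord_w0 w : r%:R * w 0 0 =
  (bs B)%:R * (bt B)%:R * ev uf w - (bs B)%:R * ev (Pf B) w - (bt B)%:R * ev (Qf B) w.
Proof. by rewrite -detR !ev_cov3; ring. Qed.
Lemma coord_w1 w : r%:R * w 0 1 =
  (bbe B)%:R * (bs B)%:R * ev uf w + (bal B)%:R * ev (Pf B) w - (bbe B)%:R * ev (Qf B) w.
Proof. by rewrite -detR !ev_cov3; ring. Qed.
Lemma coord_w2 w : r%:R * w 0 2 =
  (bal B)%:R * (bt B)%:R * ev uf w - (bal B)%:R * ev (Pf B) w + (bbe B)%:R * ev (Qf B) w.
Proof. by rewrite -detR !ev_cov3; ring. Qed.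

Lemma coord_inj w w' : ev uf w = ev uf w' -> ev (Pf B) w = ev (Pf B) w' ->
  ev (Qf B) w = ev (Qf B) w' -> w = w'.
Proof.
move=> u P Q; apply: rV3_eq; apply: (mulfI rR_neq0).
- by rewrite !coord_w0 u P Q.
- by rewrite !coord_w1 u P Q.
- by rewrite !coord_w2 u P Q.
Qed.

Definition at_point v (j k : nat) : Prop :=
  [/\ 0 < ev uf v, ev (Pf B) v = j%:R * ev uf v & ev (Qf B) v = k%:R * ev uf v].

Lemma frame_at v j k : at_point v j k -> frame v (pform B j) (qform B k).
Proof.
move=> [u0 Pv Qv]; have rn0 := rR_neq0; split.
- by apply: contraTneq u0 => ->; rewrite ev0l ltxx.
- by rewrite !evforms Pv subrr.
- by rewrite !evforms Qv subrr.
(* The two dual vectors solve (u, P, Q) = (0, 1, 0) and (u, P, Q) = (0, 0, 1). *)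
- exists (\row_i nth 0 [:: - (bs B)%:R / r%:R; (bal B)%:R / r%:R; - (bal B)%:R / r%:R] i).
  by rewrite !evforms !ev_cov3 !mxE /= -detR; split; field; rewrite detR.
- exists (\row_i nth 0 [:: - (bt B)%:R / r%:R; - (bbe B)%:R / r%:R; (bbe B)%:R / r%:R] i).
  by rewrite !evforms !ev_cov3 !mxE /= -detR; split; field; rewrite detR.
move=> w; rewrite !evforms => /eqP; rewrite subr_eq0 => /eqP Pw /eqP.
rewrite subr_eq0 => /eqP Qw; exists (ev uf w / ev uf v).
by apply: coord_inj; rewrite !evZl ?Pv ?Qv ?Pw ?Qw; field; rewrite gt_eqF.
Qed.

(** Unit segments of the grid lines, described without reference to a square, so that the common
    side of two neighbouring squares is literally one set. *)
Definition segP j k : set 'rV[R]_3 := [set w | [/\ ev (Pf B) w = j%:R * ev uf w,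
  k%:R * ev uf w <= ev (Qf B) w & ev (Qf B) w <= k.+1%:R * ev uf w]].
Definition segQ k j : set 'rV[R]_3 := [set w | [/\ ev (Qf B) w = k%:R * ev uf w,
  j%:R * ev uf w <= ev (Pf B) w & ev (Pf B) w <= j.+1%:R * ev uf w]].

Section TeeCone.
Variables j k : nat.
Hypotheses (jk_s : (j + k < bs B)%N) (jk_t : (j + k < bt B)%N).

Definition tee_forms : seq 'cV[R]_3 :=
  [:: uf; pform B j; qform B k; - pform B j.+1; - qform B k.+1;
      (minn (bs B) (bt B))%:R *: uf - Pf B - Qf B].

Lemma tee_sigma w : sigma r a (tee B j k) w <-> forall h, h \in tee_forms -> 0 <= ev h w.
Proof.
have [n nW] := tee_weight_ex r_gt1 le_ar gB jk_s jk_t.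
have js : (k < bs B)%N by lia.
have jt : (j < bt B)%N by lia.
rewrite (rewriting_sigma (tee_rewriting r_gt1 le_ar gB jk_s jk_t nW)
  (tee_inj r_gt1 le_ar gB jk_s jk_t)) => [|c]; last first.
  by have [m <-] := pure_power_surj r_gt1 co_ra c; exists (mono 0 m 0).
have in6 (T : eqType) (Q : T -> Prop) x1 x2 x3 x4 x5 x6 :
    (forall x, x \in [:: x1; x2; x3; x4; x5; x6] -> Q x) <->
    [/\ Q x1, Q x2, Q x3, Q x4 & Q x5] /\ Q x6.
  split=> [Qx|[[? ? ? ? ?] ?] x]; last first.
    by rewrite !inE; do ![case/predU1P=> [->//|]]; move/eqP->.
  by do !split; apply: Qx; rewrite !inE eqxx ?orbT.
rewrite /tee_rules /tee_forms !in6 /= !dotmE !monoE !evforms !ev_cov3.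
rewrite (natrB _ js) (natrB _ jt) (natrB _ (ltnW js)) (natrB _ (ltnW jt)).
rewrite -!natr1 natrD; set w0 := w 0 0; set w1 := w 0 1; set w2 := w 0 2.
have [st|/ltnW ts] := leqP (bs B) (bt B).
  rewrite (_ : bs B - bt B = 0)%N ?(natrB _ st); last by lia.
  by split=> -[[? ? ? ? ?] ?]; (split; [split|]); lra.
rewrite (_ : bt B - bs B = 0)%N ?(natrB _ ts); last by lia.
by split=> -[[? ? ? ? ?] ?]; (split; [split|]); lra.
Qed.

End TeeCone.
End Basis.
End Fan.

Arguments uf {R}.
Arguments Pf {R} B.
Arguments Qf {R} B.
Arguments pform {R} B j.
Arguments qform {R} B k.
Arguments tee_forms {R} B j k.

(** * The cones of the two families *)

Section TeeWedges.
Variables (R : realType) (r a : nat) (r_gt1 : (1 < r)%N) (le_ar : (a <= r)%N).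
Hypothesis co_ra : coprime r a.
Variables (B : basis) (gB : good r a B) (j k : nat).
Hypotheses (jk_s : (j + k < bs B)%N) (jk_t : (j + k < bt B)%N).
Local Notation m := (minn (bs B) (bt B)).
Local Notation u := (ev (uf : 'cV[R]_3)).
Local Notation P := (ev (Pf B : 'cV[R]_3)).
Local Notation Q := (ev (Qf B : 'cV[R]_3)).
Implicit Types v w : 'rV[R]_3.

Lemma tee_sigmaE w : sigma r a (tee B j k) w <->
  [/\ 0 <= u w, j%:R * u w <= P w <= j.+1%:R * u w,
    k%:R * u w <= Q w <= k.+1%:R * u w & P w + Q w <= m%:R * u w].
Proof.
rewrite (tee_sigma r_gt1 le_ar co_ra gB jk_s jk_t); split=> [H|[u0 /andP[P1 P2] /andP[Q1 Q2] PQ] h].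
  have := H uf; have := H (pform B j); have := H (qform B k).
  have := H (- pform B j.+1); have := H (- qform B k.+1).
  have := H (m%:R *: uf - Pf B - Qf B).
  rewrite !inE !eqxx ?orbT !evforms => /(_ isT) ? /(_ isT) ? /(_ isT) ? /(_ isT) ?.
  by move=> /(_ isT) ? /(_ isT) ?; split; [|apply/andP; split..|]; lra.
by rewrite !inE; do ![case/predU1P=> [->|]]; last move/eqP->; rewrite ?evforms; lra.
Qed.

Lemma corner_bound v : 0 < u v -> (j%:R + k%:R + 1) * u v <= m%:R * u v.
Proof.
by move=> u0; rewrite ler_pM2r // -natrD natr1 ler_nat leq_min jk_s.
Qed.

Lemma tee_wedge v f g :
    frame v f g ->
    (forall w, sigma r a (tee B j k) w -> 0 <= ev f w /\ 0 <= ev g w) ->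
    (forall h, h \in tee_forms B j k -> 0 < ev h v \/ exists x y : R,
       [/\ 0 <= x, 0 <= y & forall w, ev h w = x * ev f w + y * ev g w]) ->
  wedge (sigma r a (tee B j k)) v f g.
Proof.
move=> fr ge H; apply: wedge_poly fr ge H => w.
exact: (tee_sigma r_gt1 le_ar co_ra gB jk_s jk_t).
Qed.

(** The digits in these names locate [v] among the corners of the square: 00 is (j, k) and 11 is (j
    + 1, k + 1). Here all constraints except the two sides through (j, k) are slack. *)
Lemma tee_wedge00 v : at_point B v j k ->
  wedge (sigma r a (tee B j k)) v (pform B j) (qform B k).
Proof.
move=> Bv; have fr := frame_at r_gt1 gB Bv; have [u0 Pv Qv] := Bv.
have mu := corner_bound u0.
apply: tee_wedge => // [w /tee_sigmaE[_ /andP[? ?] /andP[? ?] _]|h].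
  by rewrite !evforms; lra.
rewrite !inE; do ![case/predU1P=> [->|]]; last move/eqP->; rewrite ?evforms ?Pv ?Qv -?natr1.
- by left.
- by right; exists 1, 0; split=> // w; rewrite !evforms; ring.
- by right; exists 0, 1; split=> // w; rewrite !evforms; ring.
- by left; lra.
- by left; lra.
- by left; lra.
Qed.

Lemma tee_wedge10 v : (j + k.+1 < bs B)%N -> (j + k.+1 < bt B)%N -> at_point B v j.+1 k ->
  wedge (sigma r a (tee B j k)) v (- pform B j.+1) (qform B k).
Proof.
move=> js jt Bv; have fr0 := frame_at r_gt1 gB Bv; have [u0 Pv Qv] := Bv.
have mu : (j%:R + k%:R + 2) * u v <= m%:R * u v.
  by rewrite ler_pM2r // -!natrD ler_nat; lia.
apply: tee_wedge => [|w /tee_sigmaE[_ /andP[? ?] /andP[? ?] _]|h].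
- apply: (frame_comb (x := -1) (y := 0) (x' := 0) (y' := 1) fr0) => [w|w|].
  + by rewrite !evforms; ring.
  + by rewrite !evforms; ring.
  + by rewrite mulr1 mul0r subr0 oppr_eq0 oner_neq0.
- by rewrite !evforms; lra.
rewrite !inE; do ![case/predU1P=> [->|]]; last move/eqP->; rewrite ?evforms ?Pv ?Qv -?natr1.
- by left.
- by left; lra.
- by right; exists 0, 1; split=> // w; rewrite !evforms; ring.
- by right; exists 1, 0; split=> // w; rewrite !evforms -?natr1; ring.
- by left; lra.
- by left; lra.
Qed.

Lemma tee_wedge01 v : (j + k.+1 < bs B)%N -> (j + k.+1 < bt B)%N -> at_point B v j k.+1 ->
  wedge (sigma r a (tee B j k)) v (pform B j) (- qform B k.+1).
Proof.
move=> js jt Bv; have fr0 := frame_at r_gt1 gB Bv; have [u0 Pv Qv] := Bv.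
have mu : (j%:R + k%:R + 2) * u v <= m%:R * u v.
  by rewrite ler_pM2r // -!natrD ler_nat; lia.
apply: tee_wedge => [|w /tee_sigmaE[_ /andP[? ?] /andP[? ?] _]|h].
- apply: (frame_comb (x := 1) (y := 0) (x' := 0) (y' := -1) fr0) => [w|w|].
  + by rewrite !evforms; ring.
  + by rewrite !evforms; ring.
  + by rewrite mul1r mul0r subr0 oppr_eq0 oner_neq0.
- by rewrite !evforms; lra.
rewrite !inE; do ![case/predU1P=> [->|]]; last move/eqP->; rewrite ?evforms ?Pv ?Qv -?natr1.
- by left.
- by right; exists 1, 0; split=> // w; rewrite !evforms; ring.
- by left; lra.
- by left; lra.
- by right; exists 0, 1; split=> // w; rewrite !evforms -?natr1; ring.
- by left; lra.
Qed.

Lemma tee_wedge11 v : (j + k.+1 < bs B)%N -> (j + k.+1 < bt B)%N ->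
  at_point B v j.+1 k.+1 ->
  wedge (sigma r a (tee B j k)) v (- pform B j.+1) (- qform B k.+1).
Proof.
move=> js jt Bv; have fr0 := frame_at r_gt1 gB Bv; have [u0 Pv Qv] := Bv.
have mu : (j%:R + k%:R + 2) * u v <= m%:R * u v.
  by rewrite ler_pM2r // -!natrD ler_nat; lia.
apply: tee_wedge => [|w /tee_sigmaE[_ /andP[? ?] /andP[? ?] _]|h].
- apply: (frame_comb (x := -1) (y := 0) (x' := 0) (y' := -1) fr0) => [w|w|].
  + by rewrite !evforms; ring.
  + by rewrite !evforms; ring.
  + by rewrite mulN1r mul0r subr0 opprK oner_neq0.
- by rewrite !evforms; lra.
rewrite !inE; do ![case/predU1P=> [->|]]; last move/eqP->; rewrite ?evforms ?Pv ?Qv -?natr1.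
- by left.
- by left; lra.
- by left; lra.
- by right; exists 1, 0; split=> // w; rewrite !evforms -?natr1; ring.
- by right; exists 0, 1; split=> // w; rewrite !evforms -?natr1; ring.
(* If m = j + k + 2, the line P + Q = m u touches the square at this very corner, and its constraint
   is the sum of the two sides; otherwise it is slack. *)
- have [mE|mN] := eqVneq m (j + k.+1).+1.
    right; exists 1, 1; split=> // w.
    by rewrite mE !evforms addnS -!natr1 natrD; ring.
  have mu' : (j%:R + k%:R + 3) * u v <= m%:R * u v.
    by rewrite ler_pM2r // -!natrD ler_nat; lia.
  by left; lra.
Qed.

(** For m = j + k + 1 half of the square remains. At (j + 1, k) the hypotenuse takes the place of
    the side P = (j + 1) u, whose constraint is the sum of those of the hypotenuse and of
    [qform B k]. *)
Lemma tee_wedge10_diag v : m = (j + k).+1 -> at_point B v j.+1 k ->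
  wedge (sigma r a (tee B j k)) v (- (pform B j.+1 + qform B k)) (qform B k).
Proof.
move=> mE Bv; have fr0 := frame_at r_gt1 gB Bv; have [u0 Pv Qv] := Bv.
have mR : m%:R = j%:R + k%:R + 1 :> R by rewrite mE -natr1 natrD.
apply: tee_wedge => [|w /tee_sigmaE[_ /andP[? ?] /andP[? ?]]|h]; rewrite ?mR.
- apply: (frame_comb (x := -1) (y := -1) (x' := 0) (y' := 1) fr0) => [w|w|].
  + by rewrite !evforms; ring.
  + by rewrite !evforms; ring.
  + by rewrite mulr1 mul0r subr0 oppr_eq0 oner_neq0.
- by rewrite !evforms -natr1 => ?; lra.
rewrite !inE; do ![case/predU1P=> [->|]]; last move/eqP->;
  rewrite ?evforms ?Pv ?Qv ?mR -?natr1.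
- by left.
- by left; lra.
- by right; exists 0, 1; split=> // w; rewrite !evforms; ring.
- by right; exists 1, 1; split=> // w; rewrite !evforms -?natr1; ring.
- by left; lra.
- by right; exists 1, 0; split=> // w; rewrite !evforms -?natr1; ring.
Qed.

Lemma tee_wedge01_diag v : m = (j + k).+1 -> at_point B v j k.+1 ->
  wedge (sigma r a (tee B j k)) v (pform B j) (- (pform B j + qform B k.+1)).
Proof.
move=> mE Bv; have fr0 := frame_at r_gt1 gB Bv; have [u0 Pv Qv] := Bv.
have mR : m%:R = j%:R + k%:R + 1 :> R by rewrite mE -natr1 natrD.
apply: tee_wedge => [|w /tee_sigmaE[_ /andP[? ?] /andP[? ?]]|h]; rewrite ?mR.
- apply: (frame_comb (x := 1) (y := 0) (x' := -1) (y' := -1) fr0) => [w|w|].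
  + by rewrite !evforms; ring.
  + by rewrite !evforms; ring.
  + by rewrite mul1r mulr0 subr0 oppr_eq0 oner_neq0.
- by rewrite !evforms -natr1 => ?; lra.
rewrite !inE; do ![case/predU1P=> [->|]]; last move/eqP->;
  rewrite ?evforms ?Pv ?Qv ?mR -?natr1.
- by left.
- by right; exists 1, 0; split=> // w; rewrite !evforms; ring.
- by left; lra.
- by left; lra.
- by right; exists 1, 1; split=> // w; rewrite !evforms -?natr1; ring.
- by right; exists 0, 1; split=> // w; rewrite !evforms -?natr1; ring.
Qed.

Lemma slice_p0 : slice (R := R) (sigma r a (tee B j k)) (pform B j) = segP B j k.
Proof.
have mn : (j + k).+1%:R <= m%:R :> R by rewrite ler_nat leq_min jk_s.
apply/seteqP; split=> w.
  move=> [/tee_sigmaE[? /andP[? ?] /andP[? ?] ?] /=]; rewrite evforms => ?.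
  by split=> //; lra.
move=> [Pw Q1 Q2]; have u0 : 0 <= u w by move: Q2; rewrite -natr1; lra.
have := ler_wpM2r u0 mn; rewrite -natr1 natrD => mu; move: Q2; rewrite -natr1 => Q2.
split; last by rewrite /= evforms Pw subrr.
by apply/tee_sigmaE; rewrite -!natr1; split=> //; rewrite ?Q1 ?Pw ?lexx /=; lra.
Qed.

Lemma slice_q0 : slice (R := R) (sigma r a (tee B j k)) (qform B k) = segQ B k j.
Proof.
have mn : (j + k).+1%:R <= m%:R :> R by rewrite ler_nat leq_min jk_s.
apply/seteqP; split=> w.
  move=> [/tee_sigmaE[? /andP[? ?] /andP[? ?] ?] /=]; rewrite evforms => ?.
  by split=> //; lra.
move=> [Qw P1 P2]; have u0 : 0 <= u w by move: P2; rewrite -natr1; lra.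
have := ler_wpM2r u0 mn; rewrite -natr1 natrD => mu; move: P2; rewrite -natr1 => P2.
split; last by rewrite /= evforms Qw subrr.
by apply/tee_sigmaE; rewrite -!natr1; split=> //; rewrite ?P1 ?Qw ?lexx /=; lra.
Qed.

Lemma slice_p1 : (j + k.+1 < bs B)%N -> (j + k.+1 < bt B)%N ->
  slice (R := R) (sigma r a (tee B j k)) (- pform B j.+1) = segP B j.+1 k.
Proof.
move=> js jt.
have mn : (j + k).+2%:R <= m%:R :> R by rewrite ler_nat; lia.
apply/seteqP; split=> w.
  move=> [/tee_sigmaE[? /andP[? ?] /andP[? ?] ?] /=]; rewrite !evforms => ?.
  by split=> //; lra.
move=> [Pw Q1 Q2]; have u0 : 0 <= u w by move: Q2; rewrite -natr1; lra.
have := ler_wpM2r u0 mn; rewrite -!natr1 natrD => mu; move: Q2 Pw; rewrite -!natr1 => Q2 Pw.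
split; last by rewrite /= !evforms Pw -natr1; lra.
by apply/tee_sigmaE; rewrite -!natr1; split=> //; rewrite ?Q1 ?Pw ?lexx /=; lra.
Qed.

Lemma slice_q1 : (j + k.+1 < bs B)%N -> (j + k.+1 < bt B)%N ->
  slice (R := R) (sigma r a (tee B j k)) (- qform B k.+1) = segQ B k.+1 j.
Proof.
move=> js jt.
have mn : (j + k).+2%:R <= m%:R :> R by rewrite ler_nat; lia.
apply/seteqP; split=> w.
  move=> [/tee_sigmaE[? /andP[? ?] /andP[? ?] ?] /=]; rewrite !evforms => ?.
  by split=> //; lra.
move=> [Qw P1 P2]; have u0 : 0 <= u w by move: P2; rewrite -natr1; lra.
have := ler_wpM2r u0 mn; rewrite -!natr1 natrD => mu; move: P2 Qw; rewrite -!natr1 => P2 Qw.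
split; last by rewrite /= !evforms Qw -natr1; lra.
by apply/tee_sigmaE; rewrite -!natr1; split=> //; rewrite ?P1 ?Qw ?lexx /=; lra.
Qed.

Definition segD : set 'rV[R]_3 := [set w | [/\ P w + Q w = m%:R * u w,
  j%:R * u w <= P w & P w <= j.+1%:R * u w]].

Lemma slice_diag (f : 'cV[R]_3) : m = (j + k).+1 ->
    (forall w, ev f w = m%:R * u w - P w - Q w) ->
  slice (R := R) (sigma r a (tee B j k)) f = segD.
Proof.
move=> mE fE; have mR : m%:R = j%:R + k%:R + 1 :> R by rewrite mE -natr1 natrD.
apply/seteqP; split=> w.
  move=> [/tee_sigmaE[? /andP[? ?] /andP[? ?] ?] /=]; rewrite fE => ?.
  by split=> //; lra.
move=> [PQ P1 P2]; have u0 : 0 <= u w by move: P2; rewrite -natr1; lra.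
move: PQ P2; rewrite mR -natr1 => PQ P2.
split; last by rewrite /= fE mR; lra.
by apply/tee_sigmaE; rewrite mR -!natr1; split=> //; rewrite ?P1 ?Pw ?lexx /=; lra.
Qed.

End TeeWedges.

(** * Flat graphs: strips between the first triangle and e_1 *)

Section FlatWedges.
Variables (R : realType) (r a : nat) (r_gt1 : (1 < r)%N) (le_ar : (a <= r)%N).
Hypothesis co_ra : coprime r a.
Variables (B : basis) (gB : good r a B).
Hypotheses (al1 : bal B = 1%N) (be1 : bbe B = 1%N).
Local Notation u := (ev (uf : 'cV[R]_3)).
Local Notation P := (ev (Pf B : 'cV[R]_3)).
Local Notation Q := (ev (Qf B : 'cV[R]_3)).
Implicit Types v w : 'rV[R]_3.

(** This is r w_2 - kappa (w_2 + w_3), written in the coordinates of the first basis. Its zero set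
    is a plane through e_1, which has u = 0 and P = Q = -1: the point at infinity in direction (-1,
    -1). Flat cones are the strips between consecutive lines of that direction. *)
Definition xi (kappa : nat) : 'cV[R]_3 :=
  Pf B - Qf B + (bs B)%:R *: uf - kappa%:R *: uf.

Lemma ev_xi kappa w : ev (xi kappa) w = P w - Q w + (bs B)%:R * u w - kappa%:R * u w.
Proof. by rewrite /xi !evforms. Qed.

Definition flat_forms (kappa : nat) : seq 'cV[R]_3 :=
  [:: if (bs B <= kappa)%N then - Qf B else - Pf B;
      xi kappa; - xi kappa.+1; uf].

Lemma flat_sigma kappa w : (kappa < r)%N ->
  sigma r a (flat r B kappa) w <-> forall h, h \in flat_forms kappa -> 0 <= ev h w.
Proof.
move=> kr; rewrite (rewriting_sigma (flat_rewriting r_gt1 le_ar co_ra gB al1 be1 kr)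
  (flat_inj r_gt1 le_ar co_ra al1 be1 kr)) => [|c]; last first.
  by have [m <-] := pure_power_surj r_gt1 co_ra c; exists (mono 0 m 0).
have in4 (T : eqType) (H : T -> Prop) x1 x2 x3 x4 :
    (forall x, x \in [:: x1; x2; x3; x4] -> H x) <-> [/\ H x1, H x2, H x3 & H x4].
  split=> [Hx|[? ? ? ?] x]; last first.
    by rewrite !inE; do ![case/predU1P=> [->//|]]; move/eqP->.
  by split; apply: Hx; rewrite !inE eqxx ?orbT.
have kE : kappa.+1%:R = kappa%:R + 1 :> R by rewrite natr1.
have rE : r%:R = (bs B)%:R + (bt B)%:R :> R by rewrite -natrD (first_basis_sum gB al1 be1).
rewrite /flat_rules /flat_forms !in4 /= !dotmE !monoE !(ev_xi, evforms) !ev_cov3 al1 be1.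
rewrite (natrB _ kr) (natrB _ (ltnW kr)) rE kE.
case: ifP => _; rewrite !monoE !evforms !ev_cov3 ?al1 ?be1.
  by split=> -[? ? ? ?]; split; lra.
by split=> -[? ? ? ?]; split; lra.
Qed.

Lemma flat_sigmaE kappa w : (kappa < r)%N -> sigma r a (flat r B kappa) w <->
  [/\ 0 <= u w, kappa%:R * u w <= P w - Q w + (bs B)%:R * u w,
    P w - Q w + (bs B)%:R * u w <= kappa.+1%:R * u w
    & if (bs B <= kappa)%N then Q w <= 0 else P w <= 0].
Proof.
move=> kr; rewrite flat_sigma //; split=> [H|[? ? ? HQ] h].
  have := H uf; have := H (xi kappa); have := H (- xi kappa.+1).
  have := H (if (bs B <= kappa)%N then - Qf B else - Pf B).
  rewrite !inE !eqxx ?orbT !(ev_xi, evforms) => /(_ isT) HQ /(_ isT) ? /(_ isT) ? /(_ isT) ?.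
  by split; [lra..|]; move: HQ; case: ifP; rewrite evforms => _; rewrite oppr_ge0.
rewrite !inE; do ![case/predU1P=> [->|]]; last move/eqP->; rewrite ?(ev_xi, evforms); try by lra.
by case: ifP HQ => _; rewrite ?evforms => ?; lra.
Qed.

Lemma flat_wedge v kappa f g : (kappa < r)%N -> frame v f g ->
    (forall w, sigma r a (flat r B kappa) w -> 0 <= ev f w /\ 0 <= ev g w) ->
    (forall h, h \in flat_forms kappa -> 0 < ev h v \/ exists x y : R,
       [/\ 0 <= x, 0 <= y & forall w, ev h w = x * ev f w + y * ev g w]) ->
  wedge (sigma r a (flat r B kappa)) v f g.
Proof.
by move=> kr fr ge H; apply: wedge_poly fr ge H => w; exact: flat_sigma.
Qed.

(** The strip kappa = j + s stands on the segment from (j, 0) to (j + 1, 0), so it lies to the right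
    of [v]. *)
Lemma flat_wedge_right v j : (j + bs B < r)%N -> at_point B v j 0 ->
  wedge (sigma r a (flat r B (j + bs B))) v (- Qf B) (xi (j + bs B)).
Proof.
move=> kr Bv; have fr0 := frame_at r_gt1 gB Bv; have [u0 Pv Qv] := Bv.
apply: flat_wedge => // [|w /(flat_sigmaE _ kr)[]|h].
- apply: (frame_comb (x := 0) (y := -1) (x' := 1) (y' := -1) fr0) => [w|w|].
  + by rewrite !evforms; ring.
  + by rewrite !(ev_xi, evforms) natrD; ring.
  + by rewrite mul0r mul1r sub0r opprK oner_neq0.
- by rewrite leq_addl !(ev_xi, evforms) => *; lra.
rewrite !inE leq_addl; do ![case/predU1P=> [->|]]; last move/eqP->;
  rewrite ?(ev_xi, evforms) ?Pv ?Qv -?natr1 ?natrD.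
- by right; exists 1, 0; split=> // w; rewrite !evforms; ring.
- by right; exists 0, 1; split=> // w; rewrite !evforms; ring.
- by left; lra.
- by left.
Qed.

Lemma flat_wedge_left v j : (j + bs B < r)%N -> at_point B v j.+1 0 ->
  wedge (sigma r a (flat r B (j + bs B))) v (- Qf B) (- xi (j.+1 + bs B)).
Proof.
move=> kr Bv; have fr0 := frame_at r_gt1 gB Bv; have [u0 Pv Qv] := Bv.
apply: flat_wedge => // [|w /(flat_sigmaE _ kr)[]|h].
- apply: (frame_comb (x := 0) (y := -1) (x' := -1) (y' := 1) fr0) => [w|w|].
  + by rewrite !evforms; ring.
  + by rewrite !(ev_xi, evforms) natrD; ring.
  + by rewrite mul0r mulrNN mul1r sub0r oppr_eq0 oner_neq0.
- by rewrite leq_addl addSn !(ev_xi, evforms) => *; lra.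
rewrite !inE leq_addl; do ![case/predU1P=> [->|]]; last move/eqP->;
  rewrite ?(ev_xi, evforms) ?Pv ?Qv -?natr1 ?natrD -?natr1.
- by right; exists 1, 0; split=> // w; rewrite !evforms; ring.
- by left; lra.
- by right; exists 0, 1; split=> // w; rewrite addSn !(ev_xi, evforms); ring.
- by left.
Qed.

(** The strip kappa = s - 1 is the one standing on the segment from (0, 0) to (0, 1) of the other
    side. *)
Lemma flat_wedge_apex v kappa : kappa.+1 = bs B -> at_point B v 0 0 ->
  wedge (sigma r a (flat r B kappa)) v (- Pf B) (- xi (bs B)).
Proof.
move=> ks Bv; have fr0 := frame_at r_gt1 gB Bv; have [u0 Pv Qv] := Bv.
have kr : (kappa < r)%N by have := first_basis_sum gB al1 be1; lia.
have kF : (bs B <= kappa)%N = false by rewrite -ks ltnn.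
apply: flat_wedge => // [|w /(flat_sigmaE _ kr)[]|h].
- apply: (frame_comb (x := -1) (y := 0) (x' := -1) (y' := 1) fr0) => [w|w|].
  + by rewrite !evforms; ring.
  + by rewrite !(ev_xi, evforms); ring.
  + by rewrite mulr1 mulr0 subr0 oppr_eq0 oner_neq0.
- by rewrite kF ks !(ev_xi, evforms) => *; lra.
rewrite !inE kF ks; do ![case/predU1P=> [->|]]; last move/eqP->;
  rewrite ?(ev_xi, evforms) ?Pv ?Qv -?ks -?natr1.
- by right; exists 1, 0; split=> // w; rewrite !evforms; ring.
- by left; lra.
- by right; exists 0, 1; split=> // w; rewrite !(ev_xi, evforms) -ks; ring.
- by left.
Qed.

Lemma flat_slice_q j : (j + bs B < r)%N ->
  slice (R := R) (sigma r a (flat r B (j + bs B))) (- Qf B) = segQ B 0 j.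
Proof.
move=> kr; apply/seteqP; split=> w.
  move=> [/(flat_sigmaE _ kr)[? + + +] /=]; rewrite leq_addl !evforms -addSn !natrD => *.
  by split; lra.
move=> [Qw P1 P2]; have u0 : 0 <= u w by move: P2; rewrite -natr1; lra.
split; last by rewrite /= !evforms Qw mul0r oppr0.
by apply/(flat_sigmaE _ kr); rewrite leq_addl -addSn !natrD; split=> //; lra.
Qed.

Lemma flat_slice_p kappa : kappa.+1 = bs B ->
  slice (R := R) (sigma r a (flat r B kappa)) (- Pf B) = segP B 0 0.
Proof.
move=> ks; have kr : (kappa < r)%N by have := first_basis_sum gB al1 be1; lia.
have kF : (bs B <= kappa)%N = false by rewrite -ks ltnn.
have sE : (bs B)%:R = kappa%:R + 1 :> R by rewrite -ks natr1.
apply/seteqP; split=> w.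
  move=> [/(flat_sigmaE _ kr)[? + + +] /=]; rewrite kF ks !evforms sE => *.
  by split; lra.
move=> [Pw Q1 Q2]; have u0 : 0 <= u w by lra.
split; last by rewrite /= !evforms Pw mul0r oppr0.
by apply/(flat_sigmaE _ kr); rewrite kF ks sE; split=> //; lra.
Qed.

Definition segE (j : nat) : set 'rV[R]_3 := [set w | [/\ 0 <= u w, Q w <= 0
  & P w - Q w = j%:R * u w]].

Lemma flat_slice_right j : (j + bs B < r)%N ->
  slice (sigma r a (flat r B (j + bs B))) (xi (j + bs B)) = segE j.
Proof.
move=> kr; apply/seteqP; split=> w.
  move=> [/(flat_sigmaE _ kr)[? + + +] /=]; rewrite leq_addl ev_xi -addSn !natrD => *.
  by split; lra.
move=> [u0 Qw PQ]; split; last by rewrite /= ev_xi PQ natrD; lra.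
by apply/(flat_sigmaE _ kr); rewrite leq_addl -addSn !natrD -natr1; split=> //; lra.
Qed.

Lemma flat_slice_left j : (j + bs B < r)%N ->
  slice (sigma r a (flat r B (j + bs B))) (- xi (j.+1 + bs B)) = segE j.+1.
Proof.
move=> kr; apply/seteqP; split=> w.
  move=> [/(flat_sigmaE _ kr)[? + + +] /=]; rewrite leq_addl !(ev_xi, evforms) -addSn !natrD => *.
  by split; lra.
move=> [u0 Qw PQ]; split; last by rewrite /= !(ev_xi, evforms) PQ natrD; lra.
move: PQ; rewrite -natr1 => PQ.
by apply/(flat_sigmaE _ kr); rewrite leq_addl -addSn !natrD -natr1; split=> //; lra.
Qed.

Lemma flat_slice_apex kappa : kappa.+1 = bs B ->
  slice (sigma r a (flat r B kappa)) (- xi (bs B)) = segE 0.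
Proof.
move=> ks; have kr : (kappa < r)%N by have := first_basis_sum gB al1 be1; lia.
have kF : (bs B <= kappa)%N = false by rewrite -ks ltnn.
have sE : (bs B)%:R = kappa%:R + 1 :> R by rewrite -ks natr1.
apply/seteqP; split=> w.
  move=> [/(flat_sigmaE _ kr)[? + + +] /=]; rewrite kF ks !(ev_xi, evforms) sE => *.
  by split; lra.
move=> [u0 Qw PQ]; split; last by rewrite /= !(ev_xi, evforms) sE; lra.
by apply/(flat_sigmaE _ kr); rewrite kF ks sE; split=> //; lra.
Qed.

Lemma segE_cone2 v j : at_point B v j 0 -> segE j = cone2 (e_ R 0) v.
Proof.
move=> [u0 Pv Qv].
have [ue Pe Qe] : [/\ u (e_ R 0) = 0, P (e_ R 0) = -1 & Q (e_ R 0) = -1].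
  by rewrite !ev_cov3 !mxE /= al1 be1; split; ring.
apply/seteqP; split=> w.
  move=> [uw Qw PQ]; exists (- Q w), (u w / u v); split.
  - by rewrite oppr_ge0.
  - by rewrite divr_ge0 // ltW.
  apply: (coord_inj r_gt1 gB); rewrite !ev_lin ?ue ?Pe ?Qe ?Pv ?Qv.
  - by field; rewrite gt_eqF.
  - rewrite [P w](_ : _ = Q w + j%:R * u w); last by rewrite -PQ; ring.
    by field; rewrite gt_eqF.
  - by field; rewrite gt_eqF.
move=> [s [t [s0 t0 ->]]].
rewrite /segE /= !ev_lin ue Pe Qe Pv Qv; split.
- by rewrite mulr0 add0r mulr_ge0 // ltW.
- by lra.
- by ring.
Qed.

End FlatWedges.

Arguments xi {R} B kappa.
Arguments segE {R} B j.

(** * Monomial ratios *)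

Section Ratios.
Variables (R : realType) (r a : nat) (r_gt1 : (1 < r)%N) (le_ar : (a <= r)%N).
Hypothesis co_ra : coprime r a.
Implicit Types (E : set 'rV[R]_3) (v w : 'rV[R]_3) (q : 'rV[int]_3).

Lemma invariantE q : Defs.invariant r a q <->
  (q 0 0 + a%:Z * (q 0 1 - q 0 2) \in dvdz r%:Z).
Proof.
have -> : (q 0 0 + a%:Z * (q 0 1 - q 0 2) \in dvdz r%:Z) =
    (q 0 0 + a%:Z * q 0 1 + (r - a)%N%:Z * q 0 2 \in dvdz r%:Z).
  rewrite -subzn //; apply/dvdzP/dvdzP => -[p pE].
    by exists (p + q 0 2); rewrite [RHS]mulrDl -pE; ring.
  by exists (p - q 0 2); rewrite [RHS]mulrBl -pE; ring.
by rewrite -intr_Zp_eq0 // /invariant; split=> /eqP.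
Qed.

Lemma quotientE X Y : [/\ quotient X Y 0 0 = (xdeg X)%:Z - (xdeg Y)%:Z,
  quotient X Y 0 1 = (ydeg X)%:Z - (ydeg Y)%:Z & quotient X Y 0 2 = (zdeg X)%:Z - (zdeg Y)%:Z].
Proof. by rewrite !mxE. Qed.

(* The determinant of (m, i) and a lattice vector (m', i') is divisible by r;
   if it equals r then (m, i) is primitive. *)
Lemma primitiveP q (m' i' : int) : Defs.invariant r a q ->
    (r%:Z %| m' + a%:Z * i')%Z ->
    q 0 0 * i' - (q 0 1 - q 0 2) * m' = r%:Z \/ q 0 0 * i' - (q 0 1 - q 0 2) * m' = - r%:Z ->
  primitive r a q.
Proof.
move=> q_inv /dvdzP[p pE] detE; split=> //.
  by apply/eqP => q0; move: detE; rewrite q0 !mxE; lia.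
move=> q' k /invariantE/dvdzP[p' p'E] qE.
have qiE i : q 0 i = q' 0 i * k%:Z by rewrite qE mulmxnE -mulr_natr natz.
have key : q 0 0 * i' - (q 0 1 - q 0 2) * m' = k%:Z * (p' * i' - (q' 0 1 - q' 0 2) * p) * r%:Z.
  have -> : k%:Z * (p' * i' - (q' 0 1 - q' 0 2) * p) * r%:Z =
    k%:Z * ((p' * r%:Z) * i' - (q' 0 1 - q' 0 2) * (p * r%:Z)) by ring.
  by rewrite -p'E -pE !qiE; ring.
have r0 : r%:Z != 0 by lia.
have : (k%:Z %| 1)%Z.
  case: detE => detE; rewrite key in detE.
    apply/dvdzP; exists (p' * i' - (q' 0 1 - q' 0 2) * p).
    by apply: (mulIf r0); rewrite mul1r -{1}detE; ring.
  apply/dvdzP; exists (- (p' * i' - (q' 0 1 - q' 0 2) * p)).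
  by apply: (mulIf r0); rewrite mul1r -[LHS]opprK -detE; ring.
by rewrite dvdz1 => /eqP.
Qed.

Section Basis.
Variables (B : basis) (gB : good r a B).

(** The equation P = j u reads (t - j) w_2 = be w_1 + j w_3. Its covector is the vector (be, -t) up
    to sign and powers of yz, so (al, s) certifies that it is primitive. *)
Lemma ratioP E j : (j <= bt B)%N ->
    (forall w, E w -> ev (Pf B) w = j%:R * ev uf w) ->
  has_ratio r a E (mono 0 (bt B - j) 0) (mono (bbe B) 0 j).
Proof.
move=> jt EP; have [q0 q1 q2] := quotientE (mono 0 (bt B - j) 0) (mono (bbe B) 0 j).
split=> [X|/=|w /EP].
- rewrite !dvdmE !monoE => /and3P[x0 _ z0] /and3P[_ y0 _].
  by apply: mon_eq; rewrite mnm0E; lia.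
- apply: (@primitiveP _ (bal B)%:Z (bs B)%:Z (_ : Defs.invariant r a _) (bal_inv gB)).
    apply/invariantE; rewrite q0 q1 q2 !monoE -subzn //.
    by rewrite -rpredN; move: (bbe_inv gB); congr (_ %| _)%Z; ring.
  by right; rewrite q0 q1 q2 !monoE -subzn // -(bdet gB) PoszD !PoszM; ring.
- by rewrite !ev_cov3 !dotmE !monoE natrB //; lra.
Qed.

Lemma ratioQ E k : (k <= bs B)%N ->
    (forall w, E w -> ev (Qf B) w = k%:R * ev uf w) ->
  has_ratio r a E (mono 0 0 (bs B - k)) (mono (bal B) k 0).
Proof.
move=> ks EQ; have [q0 q1 q2] := quotientE (mono 0 0 (bs B - k)) (mono (bal B) k 0).
split=> [X|/=|w /EQ].
- rewrite !dvdmE !monoE => /and3P[x0 y0 _] /and3P[_ _ z0].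
  by apply: mon_eq; rewrite mnm0E; lia.
- apply: (@primitiveP _ (bbe B)%:Z (- (bt B)%:Z) (_ : Defs.invariant r a _)).
  + apply/invariantE; rewrite q0 q1 q2 !monoE -subzn //.
    by rewrite -rpredN; move: (bal_inv gB); congr (_ %| _)%Z; ring.
  + by rewrite mulrN; exact: bbe_inv gB.
  by left; rewrite q0 q1 q2 !monoE -subzn // -(bdet gB) PoszD !PoszM; ring.
- by rewrite !ev_cov3 !dotmE !monoE natrB //; lra.
Qed.

Lemma wt_tau X n : (r%:Z %| cls a X - a%:Z * n)%Z -> wt r a X = tau r a n.
Proof. by move=> d; rewrite wtE //; apply/eqP; rewrite intr_Zp_eq. Qed.

Lemma markP E j : (j <= bt B)%N ->
    (forall w, E w -> ev (Pf B) w = j%:R * ev uf w) ->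
  marked r a E (tau r a ((bt B)%:Z - j%:Z)).
Proof.
move=> jt EP; exists (mono 0 (bt B - j) 0), (mono (bbe B) 0 j); split.
- exact: ratioP.
- by apply: wt_tau; rewrite /cls !monoE -subzn // subr0 add0r subrr dvdz0.
- apply: wt_tau; have := bbe_inv gB; rewrite /cls !monoE.
  by congr (_ %| _)%Z; ring.
Qed.

Lemma markQ E k : (k <= bs B)%N ->
    (forall w, E w -> ev (Qf B) w = k%:R * ev uf w) ->
  marked r a E (tau r a (k%:Z - (bs B)%:Z)).
Proof.
move=> ks EQ; exists (mono 0 0 (bs B - k)), (mono (bal B) k 0); split.
- exact: ratioQ.
- apply: wt_tau; rewrite /cls !monoE -subzn //.
  by rewrite (_ : _ - _ = 0) ?dvdz0 //; ring.
- apply: wt_tau; have := bal_inv gB; rewrite /cls !monoE.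
  by congr (_ %| _)%Z; ring.
Qed.

Lemma ratioE E j : bal B = 1%N -> bbe B = 1%N -> (j <= bt B)%N ->
    (forall w, E w -> ev (Pf B) w - ev (Qf B) w = j%:R * ev uf w) ->
  has_ratio r a E (mono 0 (bt B - j) 0) (mono 0 0 (j + bs B)).
Proof.
move=> al1 be1 jt EPQ; have rE := first_basis_sum gB al1 be1.
have [q0 q1 q2] := quotientE (mono 0 (bt B - j) 0) (mono 0 0 (j + bs B)).
split=> [X|/=|w /EPQ].
- rewrite !dvdmE !monoE => /and3P[x0 _ z0] /and3P[_ y0 _].
  by apply: mon_eq; rewrite mnm0E; lia.
- apply: (@primitiveP _ (bal B)%:Z (bs B)%:Z (_ : Defs.invariant r a _) (bal_inv gB)).
    apply/invariantE; rewrite q0 q1 q2 !monoE -subzn // -rE.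
    by apply/dvdzP; exists a%:Z; rewrite !PoszD; ring.
  by right; rewrite q0 q1 q2 !monoE -subzn // al1 -rE !PoszD; ring.
- by rewrite !ev_cov3 !dotmE !monoE natrB // natrD al1 be1; lra.
Qed.

End Basis.

(** Bezout coefficients for the entries in a fixed position produce z, a combination of the two
    vectors, of which both are integral multiples. Like them z is invariant, so both multiples are 1
    or -1. *)
Lemma int_proportional q q' : primitive r a q -> primitive r a q' ->
    (forall i j, q 0 i * q' 0 j = q 0 j * q' 0 i) ->
  q' = q \/ q' = - q.
Proof.
move=> [inv_q q0 prim_q] [inv_q' q'0 prim_q'] prop.
have [i qi0] : exists i, q 0 i != 0.
  by have [//|/forallNP all0] := pselect (exists i, q 0 i != 0); case/eqP: q0;
    apply/rowP => i; rewrite mxE; apply/eqP; apply: contrapT => /negP/all0.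
have [j q'j0] : exists j, q' 0 j != 0.
  by have [//|/forallNP all0] := pselect (exists i, q' 0 i != 0); case/eqP: q'0;
    apply/rowP => j; rewrite mxE; apply/eqP; apply: contrapT => /negP/all0.
set g := gcdz (q 0 i) (q' 0 i).
have g0 : g != 0 by rewrite /g gcdz_eq0 (negbTE qi0).
have [p pE] : exists p, q 0 i = p * g by apply/dvdzP; exact: dvdz_gcdl.
have [p' p'E] : exists p', q' 0 i = p' * g by apply/dvdzP; exact: dvdz_gcdr.
have [x [y xy]] := Bezoutz (q 0 i) (q' 0 i).
have xy1 : x * p + y * p' = 1.
  by apply: (mulIf g0); rewrite mul1r -[RHS]xy mulrDl -!mulrA -pE -p'E.
have pp' l : p * q' 0 l = p' * q 0 l.
  by apply: (mulIf g0); rewrite mulrAC -pE prop p'E; ring.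
pose z := x *: q + y *: q'.
have qz : q = p *: z.
  apply/rowP => l; rewrite !mxE -[LHS]mul1r -xy1.
  have -> : p * (x * q 0 l + y * q' 0 l) = x * p * q 0 l + y * (p * q' 0 l) by ring.
  by rewrite pp'; ring.
have q'z : q' = p' *: z.
  apply/rowP => l; rewrite !mxE -[LHS]mul1r -xy1.
  have -> : p' * (x * q 0 l + y * q' 0 l) = x * (p' * q 0 l) + y * p' * q' 0 l by ring.
  by rewrite -pp'; ring.
have inv_z : Defs.invariant r a z.
  apply/invariantE; rewrite !mxE.
  have -> : x * q 0 0 + y * q' 0 0 + a%:Z * (x * q 0 1 + y * q' 0 1 - (x * q 0 2 + y * q' 0 2))
      = x * (q 0 0 + a%:Z * (q 0 1 - q 0 2)) + y * (q' 0 0 + a%:Z * (q' 0 1 - q' 0 2)) by ring.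
  by rewrite rpredD // dvdz_mull //; apply/invariantE.
have inv_Nz : Defs.invariant r a (- z).
  apply/invariantE; rewrite !mxE; move/invariantE: inv_z; rewrite -rpredN !mxE.
  by congr (_ %| _)%Z; ring.
have unit_of c u :
    (forall (u' : 'rV[int]_3) (k : nat), Defs.invariant r a u' -> u = u' *+ k -> k = 1%N) ->
    u = c *: z -> c = 1 \/ c = -1.
  move=> prim; case: c => k kE.
    by left; rewrite (prim z k) // kE -natz scaler_nat.
  have : k.+1 = 1%N.
    by apply: (prim (- z)) => //; rewrite kE NegzE scaleNr -natz scaler_nat mulNrn.
  by case=> ->; right.
have [p1|p1] := unit_of p q prim_q qz; have [p'1|p'1] := unit_of p' q' prim_q' q'z.
- by left; rewrite q'z qz p1 p'1.
- by right; rewrite q'z qz p1 p'1 scaleN1r scale1r.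
- by right; rewrite q'z qz p1 p'1 scaleN1r scale1r opprK.
- by left; rewrite q'z qz p1 p'1.
Qed.

Lemma coprimem_min m1 m2 i : coprimem m1 m2 -> (m1 i = 0 \/ m2 i = 0)%N.
Proof.
move=> co; have [->|i1] := posnP (m1 i); [by left | have [->|i2] := posnP (m2 i)]; first by right.
have : U_(i)%MM = 0%MM :> mon.
  by apply: co; apply/mnm_lepP => l; rewrite mnmE; case: eqP => // <-.
by move/mnmP/(_ i); rewrite mnmE mnm0E eqxx.
Qed.

(** Both quotients are orthogonal to the plane of E, hence equal up to sign; coprimality recovers
    the two monomials from the signs of the entries. *)
Lemma ratio_unique E m1 m2 m1' m2' : has_dim E 2 ->
    has_ratio r a E m1 m2 -> has_ratio r a E m1' m2' ->
  (m1' = m1 /\ m2' = m2) \/ (m1' = m2 /\ m2' = m1).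
Proof.
move=> E2 [co prim Ew] [co' prim' Ew'].
have evq X Y w : dotm w X = dotm w Y ->
    \sum_i (quotient X Y 0 i)%:~R * w 0 i = 0.
  rewrite /dotm => /eqP; rewrite -subr_eq0 -sumrB => /eqP E0.
  rewrite -[RHS]E0; apply: eq_bigr => i _.
  by rewrite !mxE rmorphB /= -!pmulrn -mulrBr mulrC.
set q := quotient m1 m2 in prim *; set q' := quotient m1' m2' in prim' *.
have [qq'|qq'] : q' = q \/ q' = - q.
  apply: int_proportional => // i j.
  have [//|nE] := eqVneq (q 0 i * q' 0 j) (q 0 j * q' 0 i).
  (* The cross product n of two quotients that are not proportional is nonzero, and E, orthogonal to
     both, would lie on the line of n. *)
  pose c (x y : 'I_3) : R := (q 0 x * q' 0 y - q 0 y * q' 0 x)%:~R.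
  pose n : 'rV[R]_3 := \row_l nth 0 [:: c 1 2; c 2 0; c 0 1] l.
  exfalso; apply: (dim2_not_line (v := n) E2) => w Fw.
  have := evq _ _ _ (Ew w Fw); have := evq _ _ _ (Ew' w Fw).
  rewrite -/q -/q' !big_ord_recl !big_ord0 !addr0.
  have -> : lift ord0 ord0 = 1 :> 'I_3 by apply/val_inj.
  have -> : lift ord0 (lift ord0 ord0) = 2 :> 'I_3 by apply/val_inj.
  have -> : ord0 = 0 :> 'I_3 by apply/val_inj.
  have [l nl] : exists l, n 0 l != 0.
    have [//|/forallNP n0] := pselect (exists l, n 0 l != 0).
    have c0 x y : c x y = 0 -> q 0 x * q' 0 y = q 0 y * q' 0 x.
      by move/eqP; rewrite intr_eq0 subr_eq0 => /eqP.
    have nE0 m : n 0 m = 0 by apply/eqP; apply: contrapT => /negP/n0.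
    case/eqP: nE; move: i j; apply: ord3P; apply: ord3P => //;
      by [apply: c0; have := nE0 0; have := nE0 1; have := nE0 2; rewrite !mxE
         |apply/esym/c0; have := nE0 0; have := nE0 1; have := nE0 2; rewrite !mxE].
  move=> w'0 w0; exists (w 0 l / n 0 l).
  suff sym x y : w 0 x * n 0 y = w 0 y * n 0 x.
    apply/rowP => m; rewrite mxE; apply: (mulIf nl).
    by rewrite sym mulrAC divfK.
  have cE x1 x2 : c x1 x2 = (q 0 x1)%:~R * (q' 0 x2)%:~R - (q 0 x2)%:~R * (q' 0 x1)%:~R.
    by rewrite /c rmorphB !rmorphM.
  have n0E : n 0 0 = c 1 2 by rewrite mxE.
  have n1E : n 0 1 = c 2 0 by rewrite mxE.
  have n2E : n 0 2 = c 0 1 by rewrite mxE.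
  have id01 : w 0 0 * n 0 1 = w 0 1 * n 0 0.
    have := congr1 ( *%R (q 0 2)%:~R) w'0; have := congr1 ( *%R (q' 0 2)%:~R) w0.
    by rewrite ?n0E ?n1E ?n2E !cE; lra.
  have id12 : w 0 1 * n 0 2 = w 0 2 * n 0 1.
    have := congr1 ( *%R (q 0 0)%:~R) w'0; have := congr1 ( *%R (q' 0 0)%:~R) w0.
    by rewrite ?n0E ?n1E ?n2E !cE; lra.
  have id20 : w 0 2 * n 0 0 = w 0 0 * n 0 2.
    have := congr1 ( *%R (q 0 1)%:~R) w'0; have := congr1 ( *%R (q' 0 1)%:~R) w0.
    by rewrite ?n0E ?n1E ?n2E !cE; lra.
  by move: x y; apply: ord3P; apply: ord3P.
- left; split; apply/mnmP => i; have := coprimem_min i co; have := coprimem_min i co';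
    by have /rowP/(_ i) := qq'; rewrite !mxE; lia.
- right; split; apply/mnmP => i; have := coprimem_min i co; have := coprimem_min i co';
    by have /rowP/(_ i) := qq'; rewrite !mxE; lia.
Qed.

Lemma marked_unique E c c' : has_dim E 2 -> marked r a E c -> marked r a E c' -> c = c'.
Proof.
move=> E2 [m1 [m2 [rat w1 w2]]] [m1' [m2' [rat' w1' w2']]].
by have [[mE _]|[mE _]] := ratio_unique E2 rat rat'; rewrite -w1' mE.
Qed.

End Ratios.

(** * Socles *)

Section Labels.
Variables (r a : nat) (r_gt1 : (1 < r)%N) (le_ar : (a <= r)%N).

Definition label (Gamma : set mon) : set 'Z_r :=
  [set wt r a X + chi r 1 | X in socle Gamma].

Lemma label_tau X n : (r%:Z %| cls a X + 1 - a%:Z * n)%Z -> wt r a X + chi r 1 = tau r a n.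
Proof.
move=> d; rewrite wtE // /chi -[1%N%:R](rmorph1 (intmul (1 : 'Z_r))) -rmorphD.
by apply/eqP; rewrite intr_Zp_eq.
Qed.

Lemma labelP Gamma (s : seq (mon * int)) c :
    (forall X, socle Gamma X -> X \in map fst s) ->
    (forall p, p \in s -> socle Gamma p.1) ->
    (forall p, p \in s -> wt r a p.1 + chi r 1 = tau r a p.2) ->
  label Gamma c <-> exists2 n, n \in map snd s & c = tau r a n.
Proof.
move=> sub1 sub2 wts; split=> [[X /sub1/mapP[p ps ->] <-]|[n /mapP[p ps ->] ->]].
  by exists p.2; [exact: map_f | exact: wts].
by exists p.1; [exact: sub2 | exact: wts].
Qed.

Section Tee.
Variables (B : basis) (gB : good r a B) (j k : nat).
Hypotheses (jk_s : (j + k < bs B)%N) (jk_t : (j + k < bt B)%N).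

(** The four corners of the graph, by exponents counted from t - s. A side condition fails when the
    corner properly divides another one: for instance, if k = 0 < j then x^(al + be - 1) divides
    x^(al + be - 1) z^j. *)
Definition tee_label (n : int) : Prop :=
  [\/ n = k%:Z /\ (0 < k \/ j = 0)%N, n = - j%:Z /\ (0 < j \/ k = 0)%N,
      n = k%:Z + 1 /\ (j + k.+1 < bs B)%N | n = - j%:Z - 1 /\ (j + k.+1 < bt B)%N].

Definition tee_socles : seq (mon * int) :=
  let: Basis al be s t := B in let d := t%:Z - s%:Z in
  (if (0 < k)%N || (j == 0)%N then [:: (mono (al + be).-1 k 0, d + k%:Z)] else [::]) ++
  (if (0 < j)%N || (k == 0)%N then [:: (mono (al + be).-1 0 j, d - j%:Z)] else [::]) ++
  (if (j + k.+1 < s)%N then [:: (mono be.-1 0 (s - k.+1), d + (k%:Z + 1))] else [::]) ++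
  (if (j + k.+1 < t)%N then [:: (mono al.-1 (t - j.+1) 0, d + (- j%:Z - 1))] else [::]).

Lemma tee_socles_sub X : socle (tee B j k) X -> X \in map fst tee_socles.
Proof.
move=> [/teeP[[X1 X2 X3 X4 X5] X6] X_max]; rewrite /tee_socles.
case: gB X1 X2 X3 X4 X5 jk_s jk_t X_max; case: B => al be s t /= al0 be0 _ _ _ _ _.
move: X6; rewrite -(monoK X) !monoE; move: (xdeg X) (ydeg X) (zdeg X) => x y z.
move=> X6 X1 X2 X3 X4 X5 js jt X_max.
have use x' y' z' : tee (Basis al be s t) j k (mono x' y' z') ->
    (x <= x' -> y <= y' -> z <= z' -> mono x y z = mono x' y' z')%N.
  by move=> GX xx yy zz; rewrite (X_max _ GX) // dvdmE !monoE xx yy zz.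
rewrite !map_cat !mem_cat.
have [yk|ky] := leqP y k; have [zj|jz] := leqP z j; last by lia.
- have [zk|nzk] := boolP ((z == 0%N) && ((0 < k)%N || (j == 0)%N)).
    case/andP: zk => /eqP z0 kj; apply/orP; left; rewrite kj /= inE; apply/eqP.
    by apply: use; [apply/teeP; rewrite !monoE /=; (split; [split|]); lia|lia..].
  have jk : (0 < j)%N || (k == 0)%N by lia.
  apply/orP; right; apply/orP; left; rewrite jk /= inE; apply/eqP.
  by apply: use; [apply/teeP; rewrite !monoE /=; (split; [split|]); lia|lia..].
- have -> : (j + k.+1 < s)%N by lia.
  apply/orP; right; apply/orP; right; apply/orP; left; rewrite /= inE; apply/eqP.
  by apply: use; [apply/teeP; rewrite !monoE /=; (split; [split|]); lia|lia..].
- have -> : (j + k.+1 < t)%N by lia.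
  apply/orP; right; apply/orP; right; apply/orP; right; rewrite /= inE; apply/eqP.
  by apply: use; [apply/teeP; rewrite !monoE /=; (split; [split|]); lia|lia..].
Qed.

Lemma tee_socles_socle p : p \in tee_socles -> socle (tee B j k) p.1.
Proof.
rewrite /tee_socles; case: gB jk_s jk_t; case: B => al be s t /= al0 be0 _ _ _ _ _ js jt.
have max x y z : tee (Basis al be s t) j k (mono x y z) ->
    (forall x' y' z', tee (Basis al be s t) j k (mono x' y' z') ->
       x <= x' -> y <= y' -> z <= z' -> [/\ x' = x, y' = y & z' = z])%N ->
    socle (tee (Basis al be s t) j k) (mono x y z).
  move=> GX X_max; split=> // Y GY; rewrite dvdmE !monoE => /and3P[xx yy zz].
  have GY' : tee (Basis al be s t) j k (mono (xdeg Y) (ydeg Y) (zdeg Y)) by rewrite monoK.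
  by rewrite -[LHS]monoK; have [-> -> ->] := X_max _ _ _ GY' xx yy zz.
rewrite !mem_cat => /or4P[]; case: ifP => // b; rewrite inE => /eqP->; apply: max;
  try by apply/teeP; rewrite !monoE /=; (split; [split|]); lia.
all: move=> x' y' z' /teeP; rewrite !monoE /= => -[[? ? ? ? ?] ?] ? ? ?; by split; lia.
Qed.

Lemma tee_socles_wt p : p \in tee_socles -> wt r a p.1 + chi r 1 = tau r a p.2.
Proof.
rewrite /tee_socles; case: gB jk_s jk_t; case: B => al be s t /= al0 be0 _ _.
move=> /dvdzP[qa qaE] /dvdzP[qb qbE] _ js jt.
have dv (z q : int) : z = q * r%:Z -> (r%:Z %| z)%Z by move=> ->; exact: dvdz_mull.
rewrite !mem_cat => /or4P[]; case: ifP => // b; rewrite inE => /eqP->;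
  apply: label_tau; rewrite /cls !monoE /= ?predn_int ?addn_gt0 ?al0 //.
- by apply: (dv _ (qa + qb)); rewrite PoszD; lia.
- by apply: (dv _ (qa + qb)); rewrite PoszD; lia.
- by apply: (dv _ qb); rewrite -subzn //; lia.
- by apply: (dv _ qa); rewrite -subzn //; lia.
Qed.

Lemma tee_labelP c : label (tee B j k) c <->
  exists2 n, tee_label n & c = tau r a ((bt B)%:Z - (bs B)%:Z + n).
Proof.
rewrite (labelP _ tee_socles_sub tee_socles_socle tee_socles_wt) /tee_label /tee_socles.
clear gB; case: B jk_s jk_t => al be s t /= js jt; split.
  move=> [n]; rewrite !map_cat !mem_cat => /or4P[]; case: ifP => // b; rewrite inE => /eqP-> ->.
  - by exists k%:Z => //; constructor 1; split=> //; lia.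
  - by exists (- j%:Z) => //; constructor 2; split=> //; lia.
  - by exists (k%:Z + 1) => //; constructor 3; split=> //; lia.
  - by exists (- j%:Z - 1) => //; constructor 4; split=> //; lia.
move=> [n Hn ->]; exists (t%:Z - s%:Z + n) => //; rewrite !map_cat !mem_cat.
case: Hn => -[-> b]; apply/or4P.
- by constructor 1; rewrite ifT ?inE //; lia.
- by constructor 2; rewrite ifT ?inE //; lia.
- by constructor 3; rewrite ifT ?inE //; lia.
- by constructor 4; rewrite ifT ?inE //; lia.
Qed.

End Tee.

Section Flat.
Variables (B : basis) (gB : good r a B) (kappa : nat).
Hypotheses (al1 : bal B = 1%N) (be1 : bbe B = 1%N) (lt_kr : (kappa < r)%N).

(** The factor chi_1 is the weight of y^t, whence the shift by t; the exponent r - kappa - 1 of y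
    counts as -kappa - 1. *)
Definition flat_socles : seq (mon * int) :=
  let t := (bt B)%:Z in
  (if (0 < kappa)%N then [:: (mono 0 0 kappa, t - kappa%:Z)] else [::]) ++
  (if (kappa.+1 < r)%N then [:: (mono 0 (r - kappa.+1) 0, t - kappa%:Z - 1)] else [::]).

Lemma flat_labelP c : label (flat r B kappa) c <->
  exists2 n, (n = 0 /\ (0 < kappa)%N) \/ (n = -1 /\ (kappa.+1 < r)%N) &
    c = tau r a ((bt B)%:Z - kappa%:Z + n).
Proof.
have [sub soc wts] : [/\ forall X, socle (flat r B kappa) X -> X \in map fst flat_socles,
  forall p, p \in flat_socles -> socle (flat r B kappa) p.1
  & forall p, p \in flat_socles -> wt r a p.1 + chi r 1 = tau r a p.2].
  split=> [X|p|p]; rewrite /flat_socles.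
  - move=> [/flatP[x0 yk zk yz] X_max]; rewrite map_cat mem_cat.
    have use y' z' : flat r B kappa (mono 0 y' z') ->
        (ydeg X <= y' -> zdeg X <= z' -> X = mono 0 y' z')%N.
      by move=> GX yy zz; rewrite (X_max _ GX) // dvdmE !monoE x0 yy zz.
    have [y0|y_n0] := posnP (ydeg X).
      have [k0|k_n0] := posnP kappa.
        rewrite ifT /=; last by lia.
        by rewrite inE; apply/eqP; apply: use; [apply/flatP; rewrite !monoE; split|..]; lia.
      by apply/orP; left; rewrite /= inE; apply/eqP; apply: use;
        [apply/flatP; rewrite !monoE; split|..]; lia.
    apply/orP; right; rewrite ifT /=; last by lia.
    by rewrite inE; apply/eqP; apply: use; [apply/flatP; rewrite !monoE; split|..]; lia.
  - rewrite mem_cat => /orP[]; case: ifP => // b; rewrite inE => /eqP-> /=.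
      split; first by apply/flatP; rewrite !monoE; split; lia.
      move=> Y /flatP[? ? ? ?]; rewrite dvdmE !monoE => /and3P[? ? ?].
      by apply: mon_eq; rewrite !monoE; lia.
    split; first by apply/flatP; rewrite !monoE; split; lia.
    move=> Y /flatP[? ? ? ?]; rewrite dvdmE !monoE => /and3P[? ? ?].
    by apply: mon_eq; rewrite !monoE; lia.
  - have [qb qbE] := dvdzP (bbe_inv gB); rewrite be1 in qbE.
    rewrite mem_cat => /orP[]; case: ifP => // b; rewrite inE => /eqP->;
      apply: label_tau; rewrite /cls !monoE /=; apply/dvdzP.
      by exists qb; lia.
    by exists (qb + a%:Z); rewrite -subzn //; lia.
rewrite (labelP _ sub soc wts) /flat_socles; split.
  move=> [n]; rewrite map_cat mem_cat => /orP[]; case: ifP => // b; rewrite inE => /eqP-> ->.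
    by exists 0; [left | rewrite addr0].
  by exists (-1); [right|].
move=> [n Hn ->]; exists ((bt B)%:Z - kappa%:Z + n) => //; rewrite map_cat mem_cat.
case: Hn => -[-> b]; apply/orP; [left|right]; rewrite ifT ?inE ?addr0 //.
Qed.

End Flat.
End Labels.

Arguments label : clear implicits.

Lemma EC_label (R : realType) r a (v : 'rV[R]_3) c :
  [set x + chi r 1 | x in EC r a v] c <->
  forall Gamma, Ggraph r a Gamma -> sigma r a Gamma v -> label r a Gamma c.
Proof.
split=> [[x ECx <-] Gamma GG Gv|H].
  by have [X SX <-] := ECx Gamma (conj GG Gv); exists X.
exists (c - chi r 1); last by rewrite subrK.
move=> Gamma [GG Gv]; have [X SX XE] := H Gamma GG Gv.
by exists X => //; rewrite -XE addrK.
Qed.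

(** * Vertices *)

Section Steps.
Variables (R : realType) (r a : nat).
Implicit Types (v w : 'rV[R]_3) (B : basis).

(* Subtraction steps of Euclid's algorithm on (bs, bt). *)
Definition stepQ B := Basis (bal B + bbe B) (bbe B) (bs B - bt B) (bt B).
Definition stepP B := Basis (bal B) (bal B + bbe B) (bs B) (bt B - bs B).

Lemma good_stepQ B : good r a B -> (bt B < bs B)%N -> good r a (stepQ B).
Proof.
case: B => al be s t [/= al0 be0 s0 t0 /dvdzP[qa qaE] /dvdzP[qb qbE] det] ts.
split=> /=; try lia.
  by apply/dvdzP; exists (qa + qb); rewrite -subzn ?(ltnW ts) //; lia.
by apply/dvdzP; exists qb.
Qed.

Lemma good_stepP B : good r a B -> (bs B < bt B)%N -> good r a (stepP B).
Proof.
case: B => al be s t [/= al0 be0 s0 t0 /dvdzP[qa qaE] /dvdzP[qb qbE] det] st.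
split=> /=; try lia.
  by apply/dvdzP; exists qa.
by apply/dvdzP; exists (qa + qb); rewrite -subzn ?(ltnW st) //; lia.
Qed.

Lemma ev_stepQ B w : (bt B <= bs B)%N ->
  ev (Qf (stepQ B)) w = ev (Pf B) w + ev (Qf B) w - (bt B)%:R * ev uf w.
Proof. by move=> ts; rewrite !ev_cov3 /= natrB // natrD; ring. Qed.

Lemma ev_stepP B w : (bs B <= bt B)%N ->
  ev (Pf (stepP B)) w = ev (Pf B) w + ev (Qf B) w - (bs B)%:R * ev uf w.
Proof. by move=> st; rewrite !ev_cov3 /= natrB // natrD; ring. Qed.

Lemma good_backQ B : good r a B -> (bbe B < bal B)%N ->
  exists2 B0, good r a B0 & B = stepQ B0 /\ (bt B0 < bs B0)%N.
Proof.
case: B => al be s t [/= al0 be0 s0 t0 /dvdzP[qa qaE] /dvdzP[qb qbE] det] ba.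
exists (Basis (al - be) be (s + t) t).
  split=> /=; try lia.
    by apply/dvdzP; exists (qa - qb); rewrite -subzn ?(ltnW ba) //; lia.
  by apply/dvdzP; exists qb.
by rewrite /stepQ /=; split; [congr Basis; lia | lia].
Qed.

Lemma good_backP B : good r a B -> (bal B < bbe B)%N ->
  exists2 B0, good r a B0 & B = stepP B0 /\ (bs B0 < bt B0)%N.
Proof.
case: B => al be s t [/= al0 be0 s0 t0 /dvdzP[qa qaE] /dvdzP[qb qbE] det] ab.
exists (Basis al (be - al) s (s + t)).
  split=> /=; try lia.
    by apply/dvdzP; exists qa.
  by apply/dvdzP; exists (qb - qa); rewrite -subzn ?(ltnW ab) //; lia.
by rewrite /stepP /=; split; [congr Basis; lia | lia].
Qed.

Hypotheses (r_gt1 : (1 < r)%N) (le_ar : (a <= r)%N) (co_ra : coprime r a).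

(** The number al would divide the first coordinate of every lattice vector, and the first basis
    contains one with first coordinate 1. *)
Lemma good_al_eq_be B : good r a B -> bal B = bbe B -> bal B = 1%N.
Proof.
move=> gB ab; have [s [t g1]] := first_basis_ex r_gt1 le_ar co_ra.
have [x [y [xy _]]] := good_decomp r_gt1 le_ar gB (bal_inv g1).
have : ((bal B)%:Z %| 1)%Z.
  by apply/dvdzP; exists (x + y); rewrite mulrDl [in y * _]ab; exact: xy.
by rewrite dvdz1 => /eqP.
Qed.

(** Likewise s would divide the second coordinate of the lattice vector (-a, 1). *)
Lemma good_s_eq_t B : good r a B -> bs B = bt B -> bs B = 1%N.
Proof.
move=> gB st.
have [|x [y [_ xy]]] := @good_decomp r a r_gt1 le_ar B gB (- a%:Z) 1.
  by rewrite mulr1 addNr dvdz0.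
have : ((bs B)%:Z %| 1)%Z.
  by apply/dvdzP; exists (x - y); rewrite mulrBl [in y * _]st; exact: xy.
by rewrite dvdz1 => /eqP.
Qed.

(** Points on a diagonal are recorded in the basis before the subtraction; the order of s and t then
    tells on which leg of the next triangle they lie. *)
Variant normal_vertex v : Prop :=
| VertexApex B of good r a B & bal B = 1%N & bbe B = 1%N & at_point B v 0 0
| VertexSideQ B j of good r a B & bal B = 1%N & bbe B = 1%N &
    (0 < j < bt B)%N & at_point B v j 0
| VertexSideP B k of good r a B & bal B = 1%N & bbe B = 1%N &
    (0 < k < bs B)%N & at_point B v 0 k
| VertexInner B j k of good r a B & (0 < j)%N & (0 < k)%N &
    (j + k < bs B)%N & (j + k < bt B)%N & at_point B v j k
| VertexDiagQ B j of good r a B & (bt B < bs B)%N &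
    (0 < j < bt B)%N & at_point B v j (bt B - j)
| VertexDiagP B k of good r a B & (bs B < bt B)%N &
    (0 < k < bs B)%N & at_point B v (bs B - k) k.

(** Undoing a Euclid step decreases al + be. One leg of the smaller triangle continues a leg of the
    larger one, at a shifted position, and the other is its diagonal. The descent ends at al = be,
    which is the first basis. *)
Lemma normal_vertex_line v B : good r a B ->
  (forall j, (j < bt B)%N -> at_point B v j 0 -> normal_vertex v) /\
  (forall k, (k < bs B)%N -> at_point B v 0 k -> normal_vertex v).
Proof.
have [n] := ubnP (bal B + bbe B); elim: n B => // n IHn B /ltnSE le_n gB.
have [ab|ba|ab] := ltngtP (bal B) (bbe B).
- have [B0 gB0 [BE st]] := good_backP gB ab.
  have [|IHj IHk] := IHn B0 _ gB0.
    by move: le_n; rewrite BE /=; have := bal_gt0 gB0; lia.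
  rewrite BE /= in ab *; split=> [j jt|k ks] [u0 Pv Qv].
    apply: (IHj (j + bs B0)%N); first by lia.
    by split=> //; move: Pv; rewrite ev_stepP ?(ltnW st) // natrD [Qf _]/(Qf B0) Qv; lra.
  (* The end k = 0 of the diagonal is also the point (s, 0) on a leg of the larger triangle, where
     the induction continues. *)
  have [k0|k_gt0] := posnP k.
    apply: (IHj (bs B0)) => //; rewrite k0 in Qv.
    by split=> //; move: Pv; rewrite ev_stepP ?(ltnW st) // [Qf _]/(Qf B0) Qv; lra.
  apply: (VertexDiagP (B := B0) (k := k)) => //; first by rewrite k_gt0.
  split=> //; move: Pv; rewrite ev_stepP ?(ltnW st) // natrB ?(ltnW ks) //.
  by rewrite (Qv : ev (Qf B0) v = _); lra.
- have [B0 gB0 [BE ts]] := good_backQ gB ba.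
  have [|IHj IHk] := IHn B0 _ gB0.
    by move: le_n; rewrite BE /=; have := bbe_gt0 gB0; lia.
  rewrite BE /= in ba *; split=> [j jt|k ks] [u0 Pv Qv]; last first.
    apply: (IHk (k + bt B0)%N); first by lia.
    split=> //; move: Qv; rewrite ev_stepQ ?(ltnW ts) // natrD.
    by rewrite (Pv : ev (Pf B0) v = _); lra.
  have [j0|j_gt0] := posnP j.
    apply: (IHk (bt B0)) => //; rewrite j0 in Pv.
    split=> //; move: Qv; rewrite ev_stepQ ?(ltnW ts) //.
    by rewrite (Pv : ev (Pf B0) v = _); lra.
  apply: (VertexDiagQ (B := B0) (j := j)) => //; first by rewrite j_gt0.
  split=> //; move: Qv; rewrite ev_stepQ ?(ltnW ts) // natrB ?(ltnW jt) //.
  by rewrite (Pv : ev (Pf B0) v = _); lra.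
- have al1 := good_al_eq_be gB ab; have be1 : bbe B = 1%N by rewrite -ab.
  split=> [[|j] jt|[|k] ks] Bv; try exact: VertexApex Bv.
    exact: VertexSideQ Bv.
  exact: VertexSideP Bv.
Qed.

Lemma normal_vertex_corner v B j k : good r a B ->
    (j + k <= bs B)%N -> (j + k <= bt B)%N -> at_point B v j k ->
    ~ at_point B v (bt B) 0 -> ~ at_point B v 0 (bs B) ->
  normal_vertex v.
Proof.
move=> gB js jt Bv nv2 nv3; have [linej linek] := normal_vertex_line v gB.
have [k0|k_gt0] := posnP k.
  rewrite k0 addn0 in jt Bv; apply: (linej j) => //.
  by rewrite ltn_neqAle jt andbT; apply/eqP => jE; rewrite jE in Bv.
have [j0|j_gt0] := posnP j.
  rewrite j0 add0n in js Bv; apply: (linek k) => //.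
  by rewrite ltn_neqAle js andbT; apply/eqP => kE; rewrite kE in Bv.
have [st|ts|st] := ltngtP (bs B) (bt B).
- have [js'|js'] := ltnP (j + k) (bs B); first by apply: VertexInner Bv => //; lia.
  have jE : j = (bs B - k)%N by lia.
  by rewrite jE in Bv; apply: VertexDiagP Bv => //; lia.
- have [jt'|jt'] := ltnP (j + k) (bt B); first by apply: VertexInner Bv => //; lia.
  have kE : k = (bt B - j)%N by lia.
  by rewrite kE in Bv; apply: VertexDiagQ Bv => //; lia.
- by have := good_s_eq_t gB st; lia.
Qed.

Lemma ray_scale v w (c : R) : 0 < c -> v = c *: w -> ray v = ray w.
Proof.
move=> c0 ->; apply/seteqP; split=> x [t t0 ->].
  by exists (t * c); rewrite ?scalerA // mulr_ge0 // ltW.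
by exists (t / c); rewrite ?scalerA ?divfK ?gt_eqF // divr_ge0 // ltW.
Qed.

Section Vertex.
Variables (v : 'rV[R]_3) (v_vertex : vertex r a v).

Lemma vertex_neq0 : v != 0.
Proof.
have [[Gamma [_ _ /has_dim1P[b [[t _ ->] + _]]]] _] := v_vertex.
by apply: contraNneq => ->; rewrite scaler0.
Qed.

Lemma vertex_rigid (S : set 'rV[R]_3) d : is_face (ray v) S ->
  S (v + d) -> S (v - d) -> exists x : R, d = x *: v.
Proof.
move=> /is_faceP[c [Sc vE]] Sp Sm.
have vv : ray v v by exists 1; rewrite ?ler01 ?scale1r.
have [_ /= cv] : slice S c v by rewrite -vE.
have := Sc _ Sp; have := Sc _ Sm; rewrite !ev_lin cv !add0r => cd1 cd2.
have : ray v (v + d) by rewrite vE; split=> //=; rewrite ev_lin cv; lra.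
by case=> t _ tE; exists (t - 1); rewrite scalerBl scale1r -tE addrC addKr.
Qed.

Lemma not_at_e2 B : good r a B -> ~ at_point B v (bt B) 0.
Proof.
move=> gB [u0 Pv Qv]; have [_ /(_ 1)] := v_vertex; apply.
have vE : v 0 1 = ev uf v.
  apply: (mulfI (rR_neq0 R r_gt1)); rewrite (coord_w1 gB) Pv Qv -[in RHS](detR R gB); ring.
have c0 : 0 < v 0 1 by rewrite vE.
apply: (ray_scale c0); apply: rV3_eq; rewrite !mxE /= ?mulr0 ?mulr1 //;
  apply: (mulfI (rR_neq0 R r_gt1)); rewrite mulr0.
  by rewrite (coord_w0 gB) Pv Qv; ring.
by rewrite (coord_w2 gB) Pv Qv; ring.
Qed.

Lemma not_at_e3 B : good r a B -> ~ at_point B v 0 (bs B).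
Proof.
move=> gB [u0 Pv Qv]; have [_ /(_ 2)] := v_vertex; apply.
have vE : v 0 2 = ev uf v.
  apply: (mulfI (rR_neq0 R r_gt1)); rewrite (coord_w2 gB) Pv Qv -[in RHS](detR R gB); ring.
have c0 : 0 < v 0 2 by rewrite vE.
apply: (ray_scale c0); apply: rV3_eq; rewrite !mxE /= ?mulr0 ?mulr1 //;
  apply: (mulfI (rR_neq0 R r_gt1)); rewrite mulr0.
  by rewrite (coord_w0 gB) Pv Qv; ring.
by rewrite (coord_w1 gB) Pv Qv; ring.
Qed.

Lemma coord_vec B (x y z : R) : good r a B ->
  exists w : 'rV[R]_3, [/\ ev uf w = x, ev (Pf B) w = y & ev (Qf B) w = z].
Proof.
move=> gB; have rn0 := rR_neq0 R r_gt1; have det := detR R gB.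
exists (\row_i nth 0 [::
  ((bs B)%:R * (bt B)%:R * x - (bs B)%:R * y - (bt B)%:R * z) / r%:R;
  ((bbe B)%:R * (bs B)%:R * x + (bal B)%:R * y - (bbe B)%:R * z) / r%:R;
  ((bal B)%:R * (bt B)%:R * x - (bal B)%:R * y + (bbe B)%:R * z) / r%:R] i).
by rewrite !ev_cov3 !mxE /= -det; split; field; rewrite det.
Qed.

End Vertex.
End Steps.

(** * Every vertex has one of the six normal forms *)

Section VertexClassification.
Variables (R : realType) (r a : nat) (r_gt1 : (1 < r)%N) (le_ar : (a <= r)%N).
Hypothesis co_ra : coprime r a.
Variables (v : 'rV[R]_3) (v_vertex : vertex r a v).
Local Notation u := (ev (uf : 'cV[R]_3)).

Lemma gap (s : seq R) : all (fun x => 0 < x) s ->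
  exists2 e : R, 0 < e & all (fun x => e <= x) s.
Proof.
elim: s => [|x s IHs] /=; first by exists 1.
move=> /andP[x0 /IHs[e e0 es]]; exists (Num.min e x).
  by rewrite lt_min e0.
rewrite ge_min lexx orbT /=; apply: sub_all es => y; apply: le_trans.
by rewrite ge_min lexx.
Qed.

(* If only constraints of one direction were tight at v, one could move v both
   ways along it. *)
Lemma vertex_tight B (S : set 'rV[R]_3) (y z : R) (s : seq R) :
    good r a B -> is_face (ray v) S -> 0 < u v -> (y != 0 \/ z != 0) ->
    all (fun g => 0 < g) s ->
    (forall e d, 0 < e -> all (fun g => e <= g) s ->
       u d = 0 -> ev (Pf B) d = e * y -> ev (Qf B) d = e * z -> S (v + d) /\ S (v - d)) ->
  False.
Proof.
move=> gB v_face u0 yz /gap[e e0 es] H.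
have [d [du dP dQ]] := coord_vec r_gt1 0 (e * y) (e * z) gB.
have [Sp Sm] := H e d e0 es du dP dQ.
have [t dE] := vertex_rigid v_face Sp Sm.
move: du dP dQ; rewrite dE !evZl => /eqP; rewrite mulf_eq0 (gt_eqF u0) orbF => /eqP->.
rewrite !mul0r => /esym/eqP + /esym/eqP.
by rewrite !mulf_eq0 (gt_eqF e0) /=; case: yz => /negbTE->.
Qed.

Lemma vertex_tee B j k : good r a B -> (j + k < bs B)%N -> (j + k < bt B)%N ->
  is_face (ray v) (sigma r a (tee B j k)) -> normal_vertex r a v.
Proof.
move=> gB js jt v_face.
have sigmaE (w : 'rV[R]_3) := tee_sigmaE r_gt1 le_ar co_ra gB js jt w.
have Sv : sigma r a (tee B j k) v.
  have [c [_ vE]] := v_face; have : ray v v by exists 1; rewrite ?ler01 ?scale1r.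
  by rewrite vE => -[].
have [u_ge /andP[P1 P2] /andP[Q1 Q2] PQ] := (sigmaE v).1 Sv.
have u0 : 0 < u v.
  rewrite lt_neqAle u_ge andbT eq_sym; apply/eqP => uv0; rewrite uv0 !mulr0 in P1 P2 Q1 Q2.
  case/eqP: (vertex_neq0 v_vertex); apply: (coord_inj r_gt1 gB); rewrite ?ev0l //; lra.
set m := minn (bs B) (bt B) in PQ.
have mE : (j + k < m)%N by rewrite leq_min js.
have natu (x y : nat) : x%:R * u v <= y%:R * u v -> (x <= y)%N.
  by rewrite ler_pM2r // ler_nat.
have natult (x y : nat) : x%:R * u v < y%:R * u v -> (x < y)%N.
  by rewrite ltr_pM2r // ltr_nat.
have Pint : ev (Pf B) v = j%:R * u v \/ ev (Pf B) v = j.+1%:R * u v.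
  move: P1 P2; rewrite !le_eqVlt => /orP[/eqP->|P1]; first by left.
  move=> /orP[/eqP->|P2]; first by right.
  (* With P/u strictly between j and j + 1 and the diagonal tight, Q/u is strictly between k and k +
     1 because m is an integer, so [v] can move along the diagonal. If the diagonal is slack, P
     alone can vary. *)
  exfalso; move: PQ; rewrite le_eqVlt => /orP[/eqP PQ|PQ].
    have Q1' : k%:R * u v < ev (Qf B) v.
      have : (j + k).+1%:R * u v <= m%:R * u v by rewrite ler_pM2r // ler_nat.
      by move: P2; rewrite -!natr1 natrD; lra.
    have Q2' : ev (Qf B) v < k.+1%:R * u v.
      rewrite lt_neqAle Q2 andbT; apply/eqP => QE.
      have h1 : (j + k.+1 < m)%N by apply: natult; rewrite natrD; lra.
      by have h2 : (m < j.+1 + k.+1)%N by [apply: natult; rewrite natrD; lra]; lia.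
    apply: (vertex_tight (y := 1) (z := -1) (s := [:: ev (Pf B) v - j%:R * u v;
      j.+1%:R * u v - ev (Pf B) v; ev (Qf B) v - k%:R * u v; k.+1%:R * u v - ev (Qf B) v])
      gB v_face u0).
    - by left; rewrite oner_neq0.
    - by rewrite /= !subr_gt0 P1 P2 Q1' Q2'.
    move=> e d e0 /and5P[g1 g2 g3 g4 _] du dP dQ.
    by rewrite !sigmaE !ev_lin du dP dQ !addr0 !subr0 -/m; split; split=> //; lra.
  apply: (vertex_tight (y := 1) (z := 0) (s := [:: ev (Pf B) v - j%:R * u v;
      j.+1%:R * u v - ev (Pf B) v; m%:R * u v - (ev (Pf B) v + ev (Qf B) v)])
      gB v_face u0).
  - by left; rewrite oner_neq0.
  - by rewrite /= !subr_gt0 P1 P2 PQ.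
  move=> e d e0 /and4P[g1 g2 g3 _] du dP dQ.
  by rewrite !sigmaE !ev_lin du dP dQ !addr0 !subr0 -/m; split; split=> //; lra.
have Qint : ev (Qf B) v = k%:R * u v \/ ev (Qf B) v = k.+1%:R * u v.
  move: Q1 Q2; rewrite !le_eqVlt => /orP[/eqP->|Q1]; first by left.
  move=> /orP[/eqP->|Q2]; first by right.
  exfalso; move: PQ; rewrite le_eqVlt => /orP[/eqP PQ|PQ].
    have [jj jjE] : exists jj : nat, ev (Pf B) v = jj%:R * u v.
      by case: Pint => ->; [exists j | exists j.+1].
    have h1 : (jj + k < m)%N by apply: natult; rewrite natrD; lra.
    by have h2 : (m < jj + k.+1)%N by [apply: natult; rewrite natrD; lra]; lia.
  apply: (vertex_tight (y := 0) (z := 1) (s := [:: ev (Qf B) v - k%:R * u v;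
      k.+1%:R * u v - ev (Qf B) v; m%:R * u v - (ev (Pf B) v + ev (Qf B) v)])
      gB v_face u0).
  - by right; rewrite oner_neq0.
  - by rewrite /= !subr_gt0 Q1 Q2 PQ.
  move=> e d e0 /and4P[g1 g2 g3 _] du dP dQ.
  by rewrite !sigmaE !ev_lin du dP dQ !addr0 !subr0 -/m; split; split=> //; lra.
have [j' j'E] : exists j' : nat, ev (Pf B) v = j'%:R * u v.
  by case: Pint => ->; [exists j | exists j.+1].
have [k' k'E] : exists k' : nat, ev (Qf B) v = k'%:R * u v.
  by case: Qint => ->; [exists k | exists k.+1].
have jkm : (j' + k' <= m)%N by apply: natu; rewrite natrD mulrDl -j'E -k'E.
apply: (normal_vertex_corner r_gt1 le_ar co_ra gB (j := j') (k := k')); try by lia.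
- by split.
- exact: (not_at_e2 r_gt1 v_vertex gB).
- exact: (not_at_e3 r_gt1 v_vertex gB).
Qed.

Lemma vertex_flat B kappa : good r a B -> bal B = 1%N -> bbe B = 1%N -> (kappa < r)%N ->
  is_face (ray v) (sigma r a (flat r B kappa)) -> normal_vertex r a v.
Proof.
move=> gB al1 be1 kr v_face; have rE := first_basis_sum gB al1 be1.
have sigmaE (w : 'rV[R]_3) := flat_sigmaE r_gt1 le_ar co_ra gB al1 be1 w kr.
have Sv : sigma r a (flat r B kappa) v.
  have [c [_ vE]] := v_face; have : ray v v by exists 1; rewrite ?ler01 ?scale1r.
  by rewrite vE => -[].
have [u_ge D1 D2 T] := (sigmaE v).1 Sv.
have u0 : 0 < u v.
  rewrite lt_neqAle u_ge andbT eq_sym; apply/eqP => uv0; rewrite uv0 !mulr0 in D1 D2.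
  (* On the plane u = 0 the cone reduces to the ray of e_1, which is excluded. *)
  have PQ : ev (Pf B) v = ev (Qf B) v by lra.
  have Q0 : ev (Qf B) v <= 0 by move: T; rewrite PQ; case: ifP.
  have [ue Pe Qe] : [/\ u (e_ R 0) = 0, ev (Pf B) (e_ R 0) = -1 & ev (Qf B) (e_ R 0) = -1].
    by rewrite !ev_cov3 !mxE /= al1 be1; split; ring.
  have vE : v = - ev (Qf B) v *: e_ R 0.
    by apply: (coord_inj r_gt1 gB); rewrite evZl ?ue ?Pe ?Qe ?uv0 ?PQ; ring.
  have Qn0 : ev (Qf B) v != 0.
    by apply: contraNneq (vertex_neq0 v_vertex) => Qv0; rewrite vE Qv0 oppr0 scale0r.
  have [_ /(_ 0)] := v_vertex; apply; apply: (ray_scale _ vE).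
  by rewrite oppr_gt0 lt_neqAle Qn0.
(* Off the side, [v] could move both ways in the direction of e_1, which changes P and Q equally and
   affects no other constraint. *)
have T0 : if (bs B <= kappa)%N then ev (Qf B) v = 0 else ev (Pf B) v = 0.
  have [//|nT0] := pselect (if (bs B <= kappa)%N then ev (Qf B) v = 0 else ev (Pf B) v = 0).
  exfalso; pose T1 := if (bs B <= kappa)%N then ev (Qf B) v else ev (Pf B) v.
  have T1_lt : 0 < - T1.
    rewrite oppr_gt0 /T1 lt_neqAle; move: T nT0; case: ifP => _ -> /eqP -> //.
  apply: (vertex_tight (y := 1) (z := 1) (s := [:: - T1]) gB v_face u0).
  - by left; rewrite oner_neq0.
  - by rewrite /= T1_lt.
  move=> e d e0 /andP[+ _] du dP dQ; rewrite !sigmaE !ev_lin du dP dQ !addr0 !subr0 /T1.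
  by case: ifP T nT0 => _ T nT0 eT; split; split=> //; lra.
have natult (x y : nat) : x%:R * u v < y%:R * u v -> (x < y)%N.
  by rewrite ltr_pM2r // ltr_nat.
(* Strictly inside the strip, [v] could slide along the side on which the strip stands. *)
have [c [cE ckr]] : exists c : nat,
    ev (Pf B) v - ev (Qf B) v + (bs B)%:R * u v = c%:R * u v /\ (c = kappa \/ c = kappa.+1).
  move: D1; rewrite le_eqVlt => /orP[/eqP D1|D1]; first by exists kappa; split; [|left].
  move: D2; rewrite le_eqVlt => /orP[/eqP D2|D2]; first by exists kappa.+1; split; [|right].
  exfalso.
  apply: (vertex_tight (y := if (bs B <= kappa)%N then 1 else 0)
    (z := if (bs B <= kappa)%N then 0 else 1)
    (s := [:: ev (Pf B) v - ev (Qf B) v + (bs B)%:R * u v - kappa%:R * u v;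
      kappa.+1%:R * u v - (ev (Pf B) v - ev (Qf B) v + (bs B)%:R * u v)]) gB v_face u0).
  - by case: ifP; [left|right]; rewrite oner_neq0.
  - by rewrite /= !subr_gt0 D1 D2.
  move=> e d e0 /and3P[g1 g2 _] du + +; rewrite !sigmaE !ev_lin du !addr0 !subr0.
  by case: ifP T0 => _ T0 -> ->; rewrite T0; split; split=> //; lra.
have [linej linek] := normal_vertex_line r_gt1 le_ar co_ra v gB.
case: leqP T0 => sk T0.
  have Bv : at_point B v (c - bs B) 0.
    by split; rewrite ?T0 ?mul0r // natrB; [lra|lia].
  have [lt_t|ge_t] := ltnP (c - bs B) (bt B); first exact: linej lt_t Bv.
  have cB : (c - bs B = bt B)%N by lia.
  by rewrite cB in Bv; case: (not_at_e2 r_gt1 v_vertex gB Bv).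
have Bv : at_point B v 0 (bs B - c).
  by split; rewrite ?T0 ?mul0r // natrB; [lra|lia].
have [lt_s|ge_s] := ltnP (bs B - c) (bs B); first exact: linek lt_s Bv.
have cB : (bs B - c = bs B)%N by lia.
by rewrite cB in Bv; case: (not_at_e3 r_gt1 v_vertex gB Bv).
Qed.

Lemma vertex_normal : normal_vertex r a v.
Proof.
have [[Gamma [GG v_face _]] _] := v_vertex.
have := Ggraph_classification r_gt1 le_ar co_ra GG.
case=> [[B [j [k [gB js jt GE]]]]|[B [kappa [gB al1 be1 kr GE]]]]; rewrite GE in v_face.
  exact: vertex_tee gB js jt v_face.
exact: vertex_flat gB al1 be1 kr v_face.
Qed.

End VertexClassification.

(** * Counting edges, and the cones at a point of a leg *)

Section LocalFans.
Variables (R : realType) (r a : nat) (r_gt1 : (1 < r)%N) (le_ar : (a <= r)%N).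
Hypothesis co_ra : coprime r a.
Implicit Types (v w : 'rV[R]_3) (B : basis).
Local Notation u := (ev (uf : 'cV[R]_3)).

Lemma card_seq (T : choiceType) (s : seq T) : uniq s -> ([set` s] #= `I_(size s))%card.
Proof.
move=> s_uniq; apply/card_set_bijP; exists (index^~ s); split.
- by move=> x /= xs; rewrite index_mem.
- by move=> x y /set_mem xs /set_mem ys /= eq_i; rewrite -(nth_index x xs) eq_i nth_index.
- move=> i /= i_lt; case: s s_uniq i_lt => // x s s_uniq i_lt.
  by exists (nth x (x :: s) i); [exact: mem_nth | exact: index_uniq].
Qed.

Lemma card_seq_uniq (T : choiceType) (s : seq T) : ([set` s] #= `I_(size s))%card -> uniq s.
Proof.
move=> s_card; have sE : [set` undup s] = [set` s].
  by apply/seteqP; split=> x /=; rewrite mem_undup.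
have := card_seq (undup_uniq s); rewrite sE => /card_esym s_card'.
have /card_eq_II sz := card_eq_trans s_card' s_card.
by rewrite -[uniq s]negbK -ltn_size_undup sz ltnn.
Qed.

Lemma set_of_seq (T : choiceType) (x1 x2 x3 x4 x5 : T) :
  [/\ [set` [:: x1; x2; x3]] = [set x1; x2; x3],
      [set` [:: x1; x2; x3; x4]] = [set x1; x2; x3; x4]
    & [set` [:: x1; x2; x3; x4; x5]] = [set x1; x2; x3; x4; x5]].
Proof.
split; apply/seteqP; split=> y /=; rewrite !inE.
- by case/or3P => /eqP->; [left; left|left; right|right].
- by move=> [[|]|] ->; rewrite eqxx ?orbT.
- by case/or4P => /eqP->; [left; left; left|left; left; right|left; right|right].
- by move=> [[[|]|]|] ->; rewrite eqxx ?orbT.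
- by case/or4P => [|||/orP[]] /eqP->;
    [left; left; left; left|left; left; left; right|left; left; right|left; right|right].
- by move=> [[[[|]|]|]|] ->; rewrite eqxx ?orbT.
Qed.

Lemma card_set3 (T : choiceType) (x y z : T) : x <> y -> x <> z -> y <> z ->
  ([set x; y; z] #= `I_3)%card.
Proof.
move=> /eqP xy /eqP xz /eqP yz; have [<- _ _] := set_of_seq x y z x x.
by apply: card_seq; rewrite /= !inE !negb_or xy xz yz.
Qed.

Lemma card_set4 (T : choiceType) (x y z t : T) : x <> y -> x <> z -> x <> t ->
  y <> z -> y <> t -> z <> t -> ([set x; y; z; t] #= `I_4)%card.
Proof.
move=> /eqP xy /eqP xz /eqP xt /eqP yz /eqP yt /eqP zt.
have [_ <- _] := set_of_seq x y z t x.
by apply: card_seq; rewrite /= !inE !negb_or xy xz xt yz yt zt.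
Qed.

Lemma card_set5 (T : choiceType) (x y z t s : T) : x <> y -> x <> z -> x <> t -> x <> s ->
  y <> z -> y <> t -> y <> s -> z <> t -> z <> s -> t <> s ->
  ([set x; y; z; t; s] #= `I_5)%card.
Proof.
move=> /eqP xy /eqP xz /eqP xt /eqP xs /eqP yz /eqP yt /eqP ys /eqP zt /eqP zs /eqP ts.
have [_ _ <-] := set_of_seq x y z t s.
by apply: card_seq; rewrite /= !inE !negb_or xy xz xt xs yz yt ys zt zs ts.
Qed.

Lemma card_set4_neq (T : choiceType) (x y z t : T) :
  ([set x; y; z; t] #= `I_4)%card -> x <> y /\ z <> t.
Proof.
have [_ <- _] := set_of_seq x y z t x => /(@card_seq_uniq _ [:: x; y; z; t]).
by rewrite /= !inE !negb_or andbT => /and3P[/and3P[/eqP ? _ _] _ /eqP ?].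
Qed.

Lemma card_set5_neq (T : choiceType) (x y z t s : T) :
  ([set x; y; z; t; s] #= `I_5)%card -> x <> y /\ z <> t.
Proof.
have [_ _ <-] := set_of_seq x y z t s => /(@card_seq_uniq _ [:: x; y; z; t; s]).
rewrite /= !inE !negb_or andbT => /and4P[/and4P[/eqP ? _ _ _] _ /andP[/eqP ? _] _].
by split.
Qed.

Lemma valency_unique v m n : valency r a v m -> valency r a v n -> m = n.
Proof. by move=> /card_esym vm vn; apply/card_eq_II; apply: card_eq_trans vm vn. Qed.

Lemma edge_dim v E : edges r a v E -> has_dim E 2.
Proof. by case=> -[Gamma []]. Qed.

(** An edge is two-dimensional, so it cannot lie in the line of v; edges that meet only there are
    distinct. *)
Lemma edge_neq v f g E E' : frame v f g -> edges r a v E ->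
    (forall w, E w -> E' w -> ev f w = 0 /\ ev g w = 0) ->
  E <> E'.
Proof.
move=> fr /edge_dim E2 EE' eqE; apply: (dim2_not_line (v := v) E2) => w Ew.
have [|fw gw] := EE' w Ew; first by rewrite -eqE.
exact: (frame_line fr fw gw).
Qed.

Lemma frame_decomp v f g c : frame v f g -> ev c v = 0 ->
  exists x y : R, forall w, ev c w = x * ev f w + y * ev g w.
Proof.
move=> fr cv; have [p [fp gp]] := frame_dualf fr; have [q [fq gq]] := frame_dualg fr.
exists (ev c p), (ev c q) => w.
have [||x wE] := frame_line fr (w := w - ev f w *: p - ev g w *: q).
- by rewrite !ev_lin fp fq; ring.
- by rewrite !ev_lin gp gq; ring.
have {1}-> : w = x *: v + ev g w *: q + ev f w *: p by rewrite -wE !subrK.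
by rewrite !ev_lin cv; ring.
Qed.

Lemma ev_eq0 (c : 'cV[R]_3) : (forall w, ev c w = 0) -> c = 0.
Proof.
move=> c0; apply/colP => i; have := c0 (delta_mx 0 i).
by rewrite /ev -rowE !mxE.
Qed.

Lemma EC_of_wedges v (cs : seq (set mon * 'cV[R]_3 * 'cV[R]_3)) c :
    (forall x, List.In x cs -> Ggraph r a x.1.1 /\ wedge (sigma r a x.1.1) v x.1.2 x.2) ->
    (forall w, exists2 x, List.In x cs & 0 <= ev x.1.2 w /\ 0 <= ev x.2 w) ->
  [set x + chi r 1 | x in EC r a v] c <-> forall x, List.In x cs -> label r a x.1.1 c.
Proof.
move=> cs_wedge cover; rewrite EC_label; split=> [H x x_in|H Gamma GG Gv].
  by have [GG W] := cs_wedge x x_in; apply: H GG (wedge_v W).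
have [x x_in ->] := Ggraph_of_wedges r_gt1 le_ar co_ra cs_wedge cover GG Gv.
exact: H.
Qed.

Lemma Pf_stepP B : (bs B <= bt B)%N -> Pf (stepP B) = pform B (bs B) + Qf B :> 'cV[R]_3.
Proof.
by move=> st; apply: cV3_eq; rewrite !mxE /= ?natrD ?natrB //; ring.
Qed.

Lemma Qf_stepQ B : (bt B <= bs B)%N ->
  Qf (stepQ B) = pform B 0 + qform B (bt B) :> 'cV[R]_3.
Proof.
by move=> ts; apply: cV3_eq; rewrite !mxE /= ?natrD ?natrB //; ring.
Qed.

Lemma segQ_stepP B j : (bs B <= bt B)%N -> segQ (R := R) (stepP B) 0 j = segQ B 0 (j + bs B).
Proof.
move=> st; apply/seteqP; split=> w [Qw P1 P2].
  move: P1 P2; rewrite ev_stepP // [ev (Qf B) w](Qw : ev (Qf B) w = _) => P1 P2.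
  by split=> //; rewrite -?addSn natrD; lra.
move: P1 P2; rewrite -addSn !natrD => P1 P2.
by split=> //; rewrite ev_stepP // Qw; lra.
Qed.

(* v becomes a corner of a square after i steps of Euclid's algorithm, and g is the
   P-form through v of the resulting basis. *)
Lemma inner_cones B v j : good r a B -> (0 < j < bt B)%N -> at_point B v j 0 ->
  exists (Gamma1 Gamma2 : set mon) (i : nat), let g := pform B j + i%:R *: Qf B in
  [/\ Ggraph r a Gamma1 /\ wedge (sigma r a Gamma1) v (Qf B) (- g),
      Ggraph r a Gamma2 /\ wedge (sigma r a Gamma2) v (Qf B) g,
      slice (R := R) (sigma r a Gamma1) (Qf B) = segQ B 0 j.-1 /\
      slice (R := R) (sigma r a Gamma2) (Qf B) = segQ B 0 j,
      slice (sigma r a Gamma1) (- g) = slice (sigma r a Gamma2) g /\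
      marked r a (slice (sigma r a Gamma2) g) (tau r a ((bt B)%:Z - j%:Z))
    & label r a Gamma1 (tau r a ((bt B)%:Z - (bs B)%:Z - j%:Z)) /\
      label r a Gamma2 (tau r a ((bt B)%:Z - (bs B)%:Z - j%:Z))].
Proof.
have [n] := ubnP (bt B); elim: n B j => // n IHn B [//|j] /ltnSE le_n gB /= jt Bv.
have [s_gt0 t_gt0] := (bs_gt0 gB, bt_gt0 gB).
(* The squares of B reach up to (s, 0) on this leg when s < t. The point [v] lies beyond (s, 0),
   before it, or exactly at it. *)
have [sj|js|js] := ltngtP (bs B) j.+1.
- have st : (bs B < bt B)%N by lia.
  have gB' := good_stepP gB st.
  have Bv' : at_point (stepP B) v (j.+1 - bs B) 0.
    have [u0 Pv Qv] := Bv; split=> //; rewrite ev_stepP ?(ltnW st) // Pv Qv.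
    by rewrite natrB ?(ltnW sj) //; lra.
  have [||G1 [G2 [i]]] := IHn (stepP B) (j.+1 - bs B)%N _ gB' _ Bv'; rewrite /=; try lia.
  (* The P-form of the new basis contains one more copy of [Qf B], whence i + 1. *)
  have -> : pform (stepP B) (j.+1 - bs B) + i%:R *: Qf (stepP B) =
      pform B j.+1 + i.+1%:R *: Qf B :> 'cV[R]_3.
    rewrite /pform Pf_stepP ?(ltnW st) // /pform natrB ?(ltnW sj) // -[i.+1%:R]natr1.
    by apply/colP => l; rewrite !mxE /=; ring.
  rewrite !segQ_stepP ?(ltnW st) // => -[W1 W2 [E1 E2] [Emid mark] [lab1 lab2]].
  exists G1, G2, i.+1; split=> //.
  + by rewrite E1 E2; split; congr segQ; lia.
  + split=> //; move: mark; rewrite -!subzn ?(ltnW st) ?(ltnW sj) //.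
    by congr (marked _ _ _ (tau _ _ _)); ring.
  + by move: lab1 lab2; rewrite -!subzn ?(ltnW st) ?(ltnW sj) // => l1 l2; split;
      [move: l1 | move: l2]; congr (label _ _ _ (tau _ _ _)); ring.
- have js0 : (j + 0 < bs B)%N by lia.
  have jt0 : (j + 0 < bt B)%N by lia.
  have js1 : (j.+1 + 0 < bs B)%N by lia.
  have jt1 : (j.+1 + 0 < bt B)%N by lia.
  have js2 : (j + 1 < bs B)%N by lia.
  have jt2 : (j + 1 < bt B)%N by lia.
  exists (tee B j 0), (tee B j.+1 0), 0%N; rewrite /= scale0r addr0; split.
  + split; first exact: tee_Ggraph.
    by apply: wedge_sym; rewrite -qform0; exact: tee_wedge10.
  + split; first exact: tee_Ggraph.
    by apply: wedge_sym; rewrite -qform0; exact: tee_wedge00.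
  + by rewrite -qform0; split; exact: slice_q0.
  + rewrite slice_p1 // slice_p0 //; split=> //.
    by apply: markP => //; [exact: ltnW | move=> w []].
  + split; apply/tee_labelP => //.
      by exists (- j%:Z - 1); [constructor 4 | congr tau; lia].
    by exists (- j.+1%:Z); [constructor 2; split=> //; left | congr tau; lia].
- have st : (bs B < bt B)%N by lia.
  have gB' := good_stepP gB st.
  have js0 : (j + 0 < bs B)%N by lia.
  have jt0 : (j + 0 < bt B)%N by lia.
  have tt0 : (0 + 0 < bt (stepP B))%N by rewrite /= subn_gt0.
  have mE : minn (bs B) (bt B) = (j + 0).+1 by lia.
  have gE : pform B j.+1 + 1 *: Qf B = pform (stepP B) 0 :> 'cV[R]_3.
    by rewrite pform0 Pf_stepP ?(ltnW st) // js scale1r.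
  have Bv' : at_point (stepP B) v 0 0.
    have [u0 Pv Qv] := Bv; split=> //; rewrite ev_stepP ?(ltnW st) // Pv Qv js.
    by lra.
  (* The hypotenuse of the last square of B on this leg is the first unit segment on the side P = 0
     of the next triangle. *)
  have slice1 : slice (sigma r a (tee B j 0)) (- pform (stepP B) 0) = segP (R := R) (stepP B) 0 0.
    rewrite (slice_diag r_gt1 le_ar co_ra gB js0 jt0 mE) => [|w]; last first.
      by rewrite evNr ev_pform ev_stepP ?(ltnW st) // mE addn0 js; ring.
    have sR : (bs B)%:R = j%:R + 1 :> R by rewrite js natr1.
    have mR : (minn (bs B) (bt B))%:R = j%:R + 1 :> R by rewrite mE addn0 natr1.
    have PE w : ev (Pf (stepP B)) w = ev (Pf B) w + ev (Qf B) w - (j%:R + 1) * u w.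
      by rewrite ev_stepP ?(ltnW st) // sR.
    have QE w : ev (Qf (stepP B)) w = ev (Qf B) w by [].
    apply/seteqP; split=> w [A1 A2 A3]; move: A1 A2 A3; rewrite ?PE ?QE ?mR -?natr1 => A1 A2 A3.
      by split; rewrite ?PE ?QE; lra.
    by split; rewrite ?mR -?natr1; lra.
  exists (tee B j 0), (tee (stepP B) 0 0), 1%N; rewrite /= gE; split.
  + split; first exact: tee_Ggraph.
    apply: wedge_sym; rewrite -qform0 -gE scale1r -[in X in _ + X]qform0.
    exact: tee_wedge10_diag.
  + split; first exact: tee_Ggraph.
    apply: wedge_sym; rewrite (_ : Qf B = qform (stepP B) 0); last by rewrite qform0.
    exact: tee_wedge00.
  + split; first by rewrite -qform0 slice_q0.
    rewrite (_ : Qf B = qform (stepP B) 0); last by rewrite qform0.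
    by rewrite slice_q0 // segQ_stepP ?(ltnW st) // js.
  + rewrite slice1 slice_p0 //; split=> //.
    have -> : (bt B)%:Z - j.+1%:Z = (bt (stepP B))%:Z - 0%N%:Z.
      by rewrite /= -subzn ?(ltnW st) //; lia.
    by apply: markP => //; move=> w [].
  + split; apply/tee_labelP => //.
      by exists (- j%:Z - 1); [constructor 4; split=> //; lia | congr tau; lia].
    exists 0; first by constructor 1; split=> //; right.
    by congr tau; rewrite /= -subzn ?(ltnW st) //; lia.
Qed.

End LocalFans.

(** * Edges and characters at a vertex *)

Section Cases.
Variables (R : realType) (r a : nat) (r_gt2 : (2 < r)%N) (le_ar : (a <= r)%N).
Hypothesis co_ra : coprime r a.
Implicit Types (v w : 'rV[R]_3) (B : basis) (S : set 'Z_r).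
Local Notation u := (ev (uf : 'cV[R]_3)).
Local Notation EC1 v := [set x + chi r 1 | x in EC r a v].

Let r_gt1 : (1 < r)%N := ltnW r_gt2.

Lemma label_tee_tau B j k n : good r a B -> (j + k < bs B)%N -> (j + k < bt B)%N ->
    tee_label B j k n -> label r a (tee B j k) (tau r a ((bt B)%:Z - (bs B)%:Z + n)).
Proof. by move=> gB js jt Hn; apply/tee_labelP => //; exists n. Qed.

(** Three cones surround the apex: the first square and the two strips on either side of the line to
    e_1. *)
Lemma apex_case v B : good r a B -> bal B = 1%N -> bbe B = 1%N -> at_point B v 0 0 ->
  forall S, is_SC r a v S <-> S = EC1 v.
Proof.
move=> gB al1 be1 Bv; have rE := first_basis_sum gB al1 be1.
have [s_gt0 t_gt0] := (bs_gt0 gB, bt_gt0 gB).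
have [kappa ks] : exists kappa, kappa.+1 = bs B by exists (bs B).-1; lia.
have kr : (kappa < r)%N by lia.
have sr : (0 + bs B < r)%N by lia.
pose c1 : set mon * 'cV[R]_3 * 'cV[R]_3 := (tee B 0 0, pform B 0, qform B 0).
pose c2 : set mon * 'cV[R]_3 * 'cV[R]_3 :=
  (flat r B (0 + bs B), - Qf B, xi B (0 + bs B)).
pose c3 : set mon * 'cV[R]_3 * 'cV[R]_3 := (flat r B kappa, - Pf B, - xi B (bs B)).
pose cs := [:: c1; c2; c3].
have csW x : List.In x cs -> Ggraph r a x.1.1 /\ wedge (sigma r a x.1.1) v x.1.2 x.2.
  case=> [<-|[<-|[<-|//]]] /=; split; try exact: flat_Ggraph.
  - exact: tee_Ggraph.
  - exact: tee_wedge00.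
  - exact: flat_wedge_right.
  - exact: flat_wedge_apex.
have cover w : exists2 x, List.In x cs & 0 <= ev x.1.2 w /\ 0 <= ev x.2 w.
  have [Q0|Q0] := leP 0 (ev (Qf B) w).
    have [P0|P0] := leP 0 (ev (Pf B) w).
      by exists c1; [left|rewrite /= pform0 qform0].
    by exists c3; [right; right; left|rewrite /= !(ev_xi, evforms); lra].
  have [PQ|PQ] := leP (ev (Qf B) w) (ev (Pf B) w).
    by exists c2; [right; left|rewrite /= !(ev_xi, evforms); lra].
  by exists c3; [right; right; left|rewrite /= !(ev_xi, evforms); lra].
have edgesE E : edges r a v E <-> [\/ E = segP B 0 0, E = segQ B 0 0 | E = segE B 0].
  rewrite (edges_of_wedges r_gt1 le_ar co_ra csW cover); split=> [[x]|].
    case=> [<-|[<-|[<-|//]]] /=.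
    - by rewrite slice_p0 // slice_q0 // => -[]->; [constructor 1|constructor 2].
    - by rewrite flat_slice_q // flat_slice_right // => -[]->; [constructor 2|constructor 3].
    - by rewrite flat_slice_p // flat_slice_apex // => -[]->; [constructor 1|constructor 3].
  case=> ->.
  - by exists c1; [left|left; rewrite slice_p0].
  - by exists c1; [left|right; rewrite slice_q0].
  - by exists c2; [right; left|right; rewrite flat_slice_right].
have fr := frame_at r_gt1 gB Bv; rewrite pform0 qform0 in fr.
have val3 : valency r a v 3; first rewrite /valency.
  have -> : edges r a v = [set segP B 0 0; segQ B 0 0; segE B 0].
    apply/seteqP; split=> E; first by case/edgesE=> ->; [left; left|left; right|right].
    by move=> [[|]|] ->; apply/edgesE; [constructor 1|constructor 2|constructor 3].
  have ne E E' := @edge_neq R r a v _ _ E E' fr.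
  apply: card_set3; apply: ne; rewrite ?edgesE.
  - by constructor 1.
  - by move=> w [Pw _ _] [Qw _ _]; rewrite Pw Qw; split; ring.
  - by constructor 1.
  - by move=> w [Pw _ _] [_ _ PQ]; split; lra.
  - by constructor 2.
  - by move=> w [Qw _ _] [_ _ PQ]; split; lra.
have xx : wt r a (mono 1 0 0) + wt r a (mono 1 0 0) = tau r a ((bt B)%:Z - (bs B)%:Z).
  rewrite -wtD; apply: (wt_tau r_gt1 le_ar); rewrite /cls !mnmDE !monoE.
  have := bal_inv gB; have := bbe_inv gB; rewrite al1 be1 => /dvdzP[q1 E1] /dvdzP[q2 E2].
  by apply/dvdzP; exists (q1 + q2); lia.
have EC1E : EC1 v = [set tau r a ((bt B)%:Z - (bs B)%:Z)].
  apply/seteqP; split=> c; rewrite (EC_of_wedges r_gt1 le_ar co_ra c csW cover).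
    move=> H; have := H _ (or_intror (or_introl erefl)).
    have := H _ (or_intror (or_intror (or_introl erefl))) => /=.
    move=> /(flat_labelP r_gt1 le_ar gB al1 be1 kr)[n Hn ->].
    move=> /(flat_labelP r_gt1 le_ar gB al1 be1 sr)[n' Hn'] /tau_inj E.
    (* The candidate exponents are t - s + 1, t - s on one side and t - s, t - s - 1 on the other.
       They differ by at most 2 < r, so only t - s is common. *)
    have {}E : (bt B)%:Z - kappa%:Z + n = (bt B)%:Z - (0 + bs B)%N%:Z + n'.
      by apply: E => //; lia.
    by congr tau; lia.
  move=> -> x; case=> [<-|[<-|[<-|//]]] /=.
  - rewrite -[_ - _]addr0; apply: label_tee_tau => //.
    by constructor 1; split=> //; right.
  - by apply/(flat_labelP r_gt1 le_ar gB al1 be1 sr); exists 0;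
      [left; split=> //; lia|congr tau; lia].
  - apply/(flat_labelP r_gt1 le_ar gB al1 be1 kr); exists (-1);
      [right; split=> //; lia|congr tau; lia].
rewrite EC1E -xx => S; split=> [|->]; last exact: SC_valency3.
case=> // [i j val4|Gamma kx ky jx jz ix jy kz F1 F2 val4|E1 E2 E3 E4 E5 cl cm cf val5].
- by have := valency_unique val3 val4.
- by have := valency_unique val3 val4.
- by have := valency_unique val3 val5.
Qed.

(* The edges are not two lines: a covector vanishing on the edge toward e_1 is a
   multiple of pform B j - Qf B, which vanishes on no other edge. *)
Lemma side_case v B j : good r a B -> bal B = 1%N -> bbe B = 1%N ->
    (0 < j < bt B)%N -> at_point B v j 0 ->
  forall S, is_SC r a v S <-> S = EC1 v.
Proof.
case: j => // j gB al1 be1 /= jt Bv; have rE := first_basis_sum gB al1 be1.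
have [s_gt0 t_gt0] := (bs_gt0 gB, bt_gt0 gB).
have k1r : (j.+1 + bs B < r)%N by lia.
have k0r : (j + bs B < r)%N by lia.
have [|G1 [G2 [i]]] := inner_cones r_gt1 le_ar co_ra gB (j := j.+1) _ Bv; first by [].
rewrite /=; set g := pform B j.+1 + _; set mid := slice (sigma r a G2) g.
move=> [W1 W2 [E1 E2] [Emid mark] [lab1 lab2]].
pose c1 : set mon * 'cV[R]_3 * 'cV[R]_3 := (flat r B (j.+1 + bs B), - Qf B, xi B (j.+1 + bs B)).
pose c2 : set mon * 'cV[R]_3 * 'cV[R]_3 := (flat r B (j + bs B), - Qf B, - xi B (j.+1 + bs B)).
pose c3 : set mon * 'cV[R]_3 * 'cV[R]_3 := (G1, Qf B, - g).
pose c4 : set mon * 'cV[R]_3 * 'cV[R]_3 := (G2, Qf B, g).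
pose cs := [:: c1; c2; c3; c4].
have csW x : List.In x cs -> Ggraph r a x.1.1 /\ wedge (sigma r a x.1.1) v x.1.2 x.2.
  case=> [<-|[<-|[<-|[<-|//]]]] //=; split; try exact: flat_Ggraph.
  - exact: flat_wedge_right.
  - exact: flat_wedge_left.
have cover w : exists2 x, List.In x cs & 0 <= ev x.1.2 w /\ 0 <= ev x.2 w.
  have [Q0|Q0] := leP 0 (ev (Qf B) w).
    have [g0|g0] := leP 0 (ev g w).
      by exists c4; [right; right; right; left|].
    by exists c3; [right; right; left|rewrite /= evNr; lra].
  have [x0|x0] := leP 0 (ev (xi B (j.+1 + bs B)) w).
    by exists c1; [left|rewrite /= evNr; lra].
  by exists c2; [right; left|rewrite /= !evNr; lra].
have edgesE E : edges r a v E <->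
    [\/ E = segE B j.+1, E = segQ B 0 j.+1, E = segQ B 0 j | E = mid].
  rewrite (edges_of_wedges r_gt1 le_ar co_ra csW cover); split=> [[x]|].
    case=> [<-|[<-|[<-|[<-|//]]]] /=.
    - by rewrite flat_slice_q // flat_slice_right // => -[]->; [constructor 2|constructor 1].
    - by rewrite flat_slice_q // flat_slice_left // => -[]->; [constructor 3|constructor 1].
    - by rewrite E1 Emid => -[]->; [constructor 3|constructor 4].
    - by rewrite E2 => -[]->; [constructor 2|constructor 4].
  case=> ->.
  - by exists c1; [left|right; rewrite flat_slice_right].
  - by exists c1; [left|left; rewrite flat_slice_q].
  - by exists c2; [right; left|left; rewrite flat_slice_q].
  - by exists c4; [right; right; right; left|right].
have fr := frame_at r_gt1 gB Bv; rewrite qform0 in fr.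
have mid_line w : mid w -> 0 <= ev (Qf B) w /\ ev (pform B j.+1) w + i%:R * ev (Qf B) w = 0.
  by move=> [Sw /=]; rewrite /g evDr evZr => ?; have [] := wedge_ge W2.2 Sw.
have ne E E' := @edge_neq R r a v _ _ E E' fr.
have segE_edge : edges r a v (segE B j.+1) by apply/edgesE; constructor 1.
have val4 : valency r a v 4; first rewrite /valency.
  have -> : edges r a v = [set segE B j.+1; segQ B 0 j.+1; segQ B 0 j; mid].
    apply/seteqP; split=> E.
      by case/edgesE=> ->; [left; left; left|left; left; right|left; right|right].
    by move=> [[[|]|]|] ->; apply/edgesE; [constructor 1|constructor 2|constructor 3|constructor 4].
  apply: card_set4; apply: ne; rewrite ?edgesE.
  - by constructor 1.
  - by move=> w [_ _ PQ] [Qw _ _]; rewrite evforms; split; lra.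
  - by constructor 1.
  - by move=> w [_ _ PQ] [Qw _ _]; rewrite evforms; split; lra.
  - by constructor 1.
  - move=> w [_ Qw PQ] /mid_line[Qw' gw]; have Q0 : ev (Qf B) w = 0 by lra.
    by rewrite Q0 in gw *; split; lra.
  - by constructor 2.
  - by move=> w [Qw P1 _] [_ _ P2]; rewrite evforms; split; lra.
  - by constructor 2.
  - by move=> w [Qw _ _] /mid_line[_]; rewrite Qw mul0r mulr0 => ?; split; lra.
  - by constructor 3.
  - by move=> w [Qw _ _] /mid_line[_]; rewrite Qw mul0r mulr0 => ?; split; lra.
have not_lines : ~ two_lines r a v.
  have Eplane (c : 'cV[R]_3) E : c != 0 -> segE B j.+1 `<=` plane c -> E `<=` plane c ->
      edges r a v E -> E <> segE B j.+1 -> False.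
    move=> c0 c_seg cE E_edge EnE.
    have cv : ev c v = 0 by apply/mulmx_ev0; apply: c_seg; case: segE_edge.
    have [x [y cxy]] := frame_decomp fr cv.
    have seg0 : segE B j.+1 (e_ R 0).
      by rewrite /segE /= !ev_cov3 !mxE /= al1 be1; split; lra.
    have c1' : ev c (e_ R 0) = 0 by apply/mulmx_ev0; exact: c_seg.
    have xy : x = - y.
      move: c1'; rewrite cxy evforms !ev_cov3 !mxE /= al1 be1; lra.
    have y0 : y != 0.
      apply: contraNneq c0 => y0; apply/eqP/ev_eq0 => w; rewrite cxy xy y0; ring.
    have pq w : E w -> ev (pform B j.+1) w = ev (Qf B) w.
      move=> /cE/mulmx_ev0; rewrite cxy xy => cw; apply: (mulfI y0); lra.
    case/edgesE: (E_edge) => E_eq; rewrite E_eq in pq E_edge EnE => //.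
    - apply: (ne _ _ E_edge _ erefl) => w Ew _; have := pq w Ew.
      by have [Qw _ _] := Ew; rewrite Qw; split; lra.
    - apply: (ne _ _ E_edge _ erefl) => w Ew _; have := pq w Ew.
      by have [Qw _ _] := Ew; rewrite Qw; split; lra.
    - apply: (ne _ _ E_edge _ erefl) => w Ew _; have := pq w Ew.
      have [Qw gw] := mid_line _ Ew => pqw; rewrite pqw in gw *.
      have : (1 + i%:R) * ev (Qf B) w = 0 by lra.
      move/eqP; rewrite mulf_eq0 gt_eqF ?ltr_pwDl //= => /eqP->.
      by [].
  move=> [F1 [F2 [F3 [F4 [d1 [d2 [FE [d10 d20] Fd1 Fd2]]]]]]].
  have F4' := val4; rewrite /valency FE in F4'; have [F12 F34] := card_set4_neq F4'.
  have Fe E : [set F1; F2; F3; F4] E -> edges r a v E by rewrite FE.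
  have : [set F1; F2; F3; F4] (segE B j.+1) by rewrite -FE.
  case=> [[[|]|]|] /= eqF.
  - apply: (Eplane d1 F2) => //; [| |by apply: Fe; left; left; right|by rewrite eqF => /esym].
      by rewrite eqF => w Fw; apply: Fd1; left.
    by move=> w Fw; apply: Fd1; right.
  - apply: (Eplane d1 F1) => //; [| |by apply: Fe; left; left; left|by rewrite eqF].
      by rewrite eqF => w Fw; apply: Fd1; right.
    by move=> w Fw; apply: Fd1; left.
  - apply: (Eplane d2 F4) => //; [| |by apply: Fe; right|by rewrite eqF => /esym].
      by rewrite eqF => w Fw; apply: Fd2; left.
    by move=> w Fw; apply: Fd2; right.
  - apply: (Eplane d2 F3) => //; [| |by apply: Fe; left; right|by rewrite eqF].
      by rewrite eqF => w Fw; apply: Fd2; right.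
    by move=> w Fw; apply: Fd2; left.
have segEE : segE B j.+1 = cone2 (e_ R 0) v := segE_cone2 r_gt1 gB al1 be1 Bv.
have ratio : has_ratio r a (cone2 (e_ R 0) v) (mono 0 (bt B - j.+1) 0) (mono 0 0 (j.+1 + bs B)).
  rewrite -segEE; apply: (ratioE r_gt1 le_ar co_ra gB al1 be1 (ltnW jt)) => w [_ _].
  by [].
have SE : wt r a (mono 1 0 0) + wt r a (mono 0 (bt B - j.+1) 0) =
    tau r a ((bt B)%:Z - (bs B)%:Z - j.+1%:Z).
  rewrite -wtD; apply: wt_tau => //; rewrite /cls !mnmDE !monoE -subzn ?(ltnW jt) //.
  have := bal_inv gB; rewrite al1 => /dvdzP[q1 E1'].
  by apply/dvdzP; exists q1; lia.
have EC1E : EC1 v = [set tau r a ((bt B)%:Z - (bs B)%:Z - j.+1%:Z)].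
  apply/seteqP; split=> c; rewrite (EC_of_wedges r_gt1 le_ar co_ra c csW cover).
    (* The two strips at [v] have a single label in common; the two inner cones contain it by
       [inner_cones]. *)
    move=> H; have := H _ (or_introl erefl).
    have := H _ (or_intror (or_introl erefl)) => /=.
    move=> /(flat_labelP r_gt1 le_ar gB al1 be1 k0r)[n Hn ->].
    move=> /(flat_labelP r_gt1 le_ar gB al1 be1 k1r)[n' Hn'] /tau_inj E.
    have {}E : (bt B)%:Z - (j + bs B)%N%:Z + n = (bt B)%:Z - (j.+1 + bs B)%N%:Z + n'.
      by apply: E => //; lia.
    by congr tau; lia.
  move=> -> x; case=> [<-|[<-|[<-|[<-|//]]]] //=.
  - by apply/(flat_labelP r_gt1 le_ar gB al1 be1 k1r); exists 0;
      [left; split=> //; lia|congr tau; lia].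
  - by apply/(flat_labelP r_gt1 le_ar gB al1 be1 k0r); exists (-1);
      [right; split=> //; lia|congr tau; lia].
rewrite EC1E -SE => S; split=> [|->].
  case=> [val3|k l _ _ _ rat|Gamma kx ky jx jz ix jy kz F1 F2 _ /not_lines //|
    F1 F2 F3 F4 F5 cl cm cf val5].
  - by have := valency_unique val3 val4.
  - have dim2 : has_dim (cone2 (e_ R 0) v) 2 by rewrite -segEE; exact: edge_dim segE_edge.
    have [[-> _] //|[e _]] := ratio_unique r_gt1 le_ar co_ra dim2 ratio rat.
    by have := congr1 (fun X : mon => zdeg X) e; rewrite !monoE.
  - by have := valency_unique val4 val5.
by apply: SC_valency4_not_lines ratio => //; rewrite -segEE.
Qed.

Lemma pow_mono n : [/\ (U_(0%R) *+ n)%MM = mono n 0 0 :> mon, (U_(1%R) *+ n)%MM = mono 0 n 0 :> mon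
  & (U_(2%R) *+ n)%MM = mono 0 0 n :> mon].
Proof. by split; apply: mon_eq; rewrite mulmnE mnmE monoE ?mul0n ?mul1n. Qed.

Lemma least_unique (D : nat -> Prop) m n : (forall i, D i <-> (i < m)%N) ->
  ~ D n -> (forall i, (i < n)%N -> D i) -> n = m.
Proof.
move=> DE nDn Dn; apply/eqP; rewrite eqn_leq; apply/andP; split.
  by rewrite leqNgt; apply/negP => /Dn/DE; rewrite ltnn.
by rewrite leqNgt; apply/negP => /DE.
Qed.

Section TwoValleys.
Variables (B : basis) (gB : good r a B) (j k : nat).
Hypotheses (jk_s : (j + k < bs B)%N) (jk_t : (j + k < bt B)%N).

Lemma tee_mono_y m n : tee B j k (mono m n 0) <->
  ((m < bal B + bbe B) && ((n <= k) || (m < bal B)) && (n < bt B - j))%N.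
Proof.
by case: gB => al0 be0 _ _ _ _ _; rewrite teeP !monoE; split=> [[[? ? ? ? ?] ?]|?];
  [lia | split; [split|]; lia].
Qed.

Lemma tee_mono_z m n : tee B j k (mono m 0 n) <->
  ((m < bal B + bbe B) && ((n <= j) || (m < bbe B)) && (n < bs B - k))%N.
Proof.
by case: gB => al0 be0 _ _ _ _ _; rewrite teeP !monoE; split=> [[[? ? ? ? ?] ?]|?];
  [lia | split; [split|]; lia].
Qed.

Lemma tee_y_valley m n : y_valley (tee B j k) m n -> (m.+1 = bal B /\ n = k)%N.
Proof.
case: gB => al0 be0 _ _ _ _ _ [] /tee_mono_y G1 /tee_mono_y G2 /tee_mono_y G3 nG.
by have /negP nG' : ~ _ := fun b => nG ((tee_mono_y m.+1 n.+1).2 b); lia.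
Qed.

Lemma tee_z_valley m n : z_valley (tee B j k) m n -> (m.+1 = bbe B /\ n = j)%N.
Proof.
case: gB => al0 be0 _ _ _ _ _ [] /tee_mono_z G1 /tee_mono_z G2 /tee_mono_z G3 nG.
by have /negP nG' : ~ _ := fun b => nG ((tee_mono_z m.+1 n.+1).2 b); lia.
Qed.

(** The two bounds say that the arm of z rises above j and the arm of y above k, so that both inner
    corners of the staircase are present. *)
Lemma tee_two_valleys : (j + k.+1 < bs B)%N -> (j + k.+1 < bt B)%N ->
  two_valleys (tee B j k) (bal B).-1 k (bbe B).-1 j.
Proof.
case: (gB) => al0 be0 _ _ _ _ _ js jt; split=> m n; split.
- by move=> /tee_y_valley[<- ->].
- by move=> [-> ->]; split; [| | |move=> /tee_mono_y ?]; try apply/tee_mono_y; lia.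
- by move=> /tee_z_valley[<- ->].
- by move=> [-> ->]; split; [| | |move=> /tee_mono_z ?]; try apply/tee_mono_z; lia.
Qed.

Lemma tee_least_x n : least_exponent (tee B j k) 0 n <-> n = (bal B + bbe B)%N.
Proof.
case: gB => al0 be0 _ _ _ _ _.
have xE i : tee B j k (U_(0%R) *+ i)%MM <-> (i < bal B + bbe B)%N.
  by have [-> _ _] := pow_mono i; rewrite tee_mono_y; split; lia.
split=> [[nDn Dn]|->]; first exact: least_unique xE nDn Dn.
by split; [move/xE; rewrite ltnn | move=> i /xE].
Qed.

Lemma tee_least_y n : least_exponent (tee B j k) 1 n <-> n = (bt B - j)%N.
Proof.
case: gB => al0 be0 _ _ _ _ _.
have yE i : tee B j k (U_(1%R) *+ i)%MM <-> (i < bt B - j)%N.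
  by have [_ -> _] := pow_mono i; rewrite tee_mono_y; split; lia.
split=> [[nDn Dn]|->]; first exact: least_unique yE nDn Dn.
by split; [move/yE; rewrite ltnn | move=> i /yE].
Qed.

Lemma tee_least_z n : least_exponent (tee B j k) 2 n <-> n = (bs B - k)%N.
Proof.
case: gB => al0 be0 _ _ _ _ _.
have zE i : tee B j k (U_(2%R) *+ i)%MM <-> (i < bs B - k)%N.
  by have [_ _ ->] := pow_mono i; rewrite tee_mono_z; split; lia.
split=> [[nDn Dn]|->]; first exact: least_unique zE nDn Dn.
by split; [move/zE; rewrite ltnn | move=> i /zE].
Qed.

End TwoValleys.

Lemma wt_peak_y B k : good r a B ->
  wt r a (mono (bal B + bbe B) k 0) = tau r a ((bt B)%:Z - (bs B)%:Z + k%:Z).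
Proof.
move=> gB; apply: wt_tau => //; rewrite /cls !monoE.
have /dvdzP[q1 E1] := bal_inv gB; have /dvdzP[q2 E2] := bbe_inv gB.
by apply/dvdzP; exists (q1 + q2); lia.
Qed.

Lemma wt_peak_z B j : good r a B ->
  wt r a (mono (bal B + bbe B) 0 j) = tau r a ((bt B)%:Z - (bs B)%:Z - j%:Z).
Proof.
move=> gB; apply: wt_tau => //; rewrite /cls !monoE.
have /dvdzP[q1 E1] := bal_inv gB; have /dvdzP[q2 E2] := bbe_inv gB.
by apply/dvdzP; exists (q1 + q2); lia.
Qed.

Lemma inner_case v B j k : good r a B -> (0 < j)%N -> (0 < k)%N ->
    (j + k < bs B)%N -> (j + k < bt B)%N -> at_point B v j k ->
  forall S, is_SC r a v S <-> S = EC1 v.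
Proof.
case: j => // j; case: k => // k gB _ _ js jt Bv.
have [js1 jt1] : (j.+1 + k < bs B)%N /\ (j.+1 + k < bt B)%N by lia.
have [js2 jt2] : (j + k.+1 < bs B)%N /\ (j + k.+1 < bt B)%N by lia.
have [js3 jt3] : (j + k < bs B)%N /\ (j + k < bt B)%N by lia.
have [js4 jt4] : (j + k.+2 < bs B)%N /\ (j + k.+2 < bt B)%N by lia.
pose c1 : set mon * 'cV[R]_3 * 'cV[R]_3 := (tee B j.+1 k.+1, pform B j.+1, qform B k.+1).
pose c2 : set mon * 'cV[R]_3 * 'cV[R]_3 := (tee B j k.+1, - pform B j.+1, qform B k.+1).
pose c3 : set mon * 'cV[R]_3 * 'cV[R]_3 := (tee B j.+1 k, pform B j.+1, - qform B k.+1).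
pose c4 : set mon * 'cV[R]_3 * 'cV[R]_3 := (tee B j k, - pform B j.+1, - qform B k.+1).
pose cs := [:: c1; c2; c3; c4].
have csW x : List.In x cs -> Ggraph r a x.1.1 /\ wedge (sigma r a x.1.1) v x.1.2 x.2.
  case=> [<-|[<-|[<-|[<-|//]]]] /=; split; try exact: tee_Ggraph.
  - exact: tee_wedge00.
  - exact: tee_wedge10.
  - exact: tee_wedge01.
  - exact: tee_wedge11.
have cover w : exists2 x, List.In x cs & 0 <= ev x.1.2 w /\ 0 <= ev x.2 w.
  have [p0|p0] := leP 0 (ev (pform B j.+1) w); have [q0|q0] := leP 0 (ev (qform B k.+1) w).
  - by exists c1; [left|].
  - by exists c3; [right; right; left|rewrite /= !evNr; lra].
  - by exists c2; [right; left|rewrite /= !evNr; lra].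
  - by exists c4; [right; right; right; left|rewrite /= !evNr; lra].
have edgesE E : edges r a v E <->
    [\/ E = segP B j.+1 k.+1, E = segP B j.+1 k, E = segQ B k.+1 j.+1 | E = segQ B k.+1 j].
  rewrite (edges_of_wedges r_gt1 le_ar co_ra csW cover); split=> [[x]|].
    case=> [<-|[<-|[<-|[<-|//]]]] /=.
    - by rewrite slice_p0 // slice_q0 // => -[]->; [constructor 1|constructor 3].
    - by rewrite slice_p1 // slice_q0 // => -[]->; [constructor 1|constructor 4].
    - by rewrite slice_p0 // slice_q1 // => -[]->; [constructor 2|constructor 3].
    - by rewrite slice_p1 // slice_q1 // => -[]->; [constructor 2|constructor 4].
  case=> ->.
  - by exists c1; [left|left; rewrite slice_p0].
  - by exists c3; [right; right; left|left; rewrite slice_p0].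
  - by exists c1; [left|right; rewrite slice_q0].
  - by exists c2; [right; left|right; rewrite slice_q0].
have fr := frame_at r_gt1 gB Bv.
have ne E E' := @edge_neq R r a v _ _ E E' fr.
have edgesS : edges r a v = [set segP B j.+1 k.+1; segP B j.+1 k; segQ B k.+1 j.+1; segQ B k.+1 j].
  apply/seteqP; split=> E.
    by case/edgesE=> ->; [left; left; left|left; left; right|left; right|right].
  by move=> [[[|]|]|] ->; apply/edgesE; [constructor 1|constructor 2|constructor 3|constructor 4].
have val4 : valency r a v 4.
  rewrite /valency edgesS; apply: card_set4; apply: ne; rewrite ?edgesE.
  - by constructor 1.
  - by move=> w [Pw Q1 _] [_ _ Q2]; rewrite !evforms; split; lra.
  - by constructor 1.
  - by move=> w [Pw _ _] [Qw _ _]; rewrite !evforms; split; lra.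
  - by constructor 1.
  - by move=> w [Pw _ _] [Qw _ _]; rewrite !evforms; split; lra.
  - by constructor 2.
  - by move=> w [Pw _ _] [Qw _ _]; rewrite !evforms; split; lra.
  - by constructor 2.
  - by move=> w [Pw _ _] [Qw _ _]; rewrite !evforms; split; lra.
  - by constructor 3.
  - by move=> w [Qw P1 _] [_ _ P2]; rewrite !evforms; split; lra.
have lines : two_lines r a v.
  exists (segP B j.+1 k.+1), (segP B j.+1 k), (segQ B k.+1 j.+1), (segQ B k.+1 j).
  exists (pform B j.+1), (qform B k.+1); split=> //.
  - have [[p [fp _]] [q [_ gq]]] := (frame_dualf fr, frame_dualg fr).
    split; [apply: contra_eq_neq fp | apply: contra_eq_neq gq] => ->;
      by rewrite /ev mulmx0 mxE eq_sym oner_neq0.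
  - by move=> w [[Pw _ _]|[Pw _ _]]; apply/mulmx_ev0; rewrite evforms Pw subrr.
  - by move=> w [[Qw _ _]|[Qw _ _]]; apply/mulmx_ev0; rewrite evforms Qw subrr.
have EC1E : EC1 v = [set wt r a (mono (bal B + bbe B) k.+1 0);
                         wt r a (mono (bal B + bbe B) 0 j.+1)].
  rewrite wt_peak_y // wt_peak_z //.
  have st_r := basis_sum_le gB.
  apply/seteqP; split=> c; rewrite (EC_of_wedges r_gt1 le_ar co_ra c csW cover).
    (* The squares (j + 1, k + 1) and (j, k), opposite at [v], already have only the two required
       labels in common; all exponents stay in a window shorter than r because s + t <= r. *)
    move=> H; have := H _ (or_introl erefl).
    have := H _ (or_intror (or_intror (or_intror (or_introl erefl)))) => /=.
    move=> /(tee_labelP r_gt1 le_ar gB js3 jt3)[n Hn ->].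
    move=> /(tee_labelP r_gt1 le_ar gB js jt)[n' Hn'] /tau_inj E.
    have {}E : (bt B)%:Z - (bs B)%:Z + n = (bt B)%:Z - (bs B)%:Z + n'.
      by apply: E => //; case: Hn => -[-> _]; case: Hn' => -[-> _]; lia.
    have : n = k.+1%:Z \/ n = - j.+1%:Z.
      by case: Hn => -[? _]; case: Hn' => -[? _]; lia.
    by case=> ->; [left | right].
  case=> -> x; case=> [<-|[<-|[<-|[<-|//]]]] /=; apply: label_tee_tau => //.
  - by constructor 1; split=> //; left.
  - by constructor 1; split=> //; left.
  - by constructor 3; split; lia.
  - by constructor 3; split; lia.
  - by constructor 2; split=> //; left.
  - by constructor 4; split; lia.
  - by constructor 2; split=> //; left.
  - by constructor 4; split; lia.
rewrite EC1E => S; split=> [|->].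
  case=> [val3|i l _ /(_ lines) //|Gamma kx ky jx jz ix jy kz F1 F2 _ _ GG [yv zv] ixE jyE kzE
      [F1face _] F1v ratio1 [F2face _] F2v ratio2|F1 F2 F3 F4 F5 cl cm cf val5].
  - by have := valency_unique val3 val4.
  - have Gv : sigma r a Gamma v by move: F1face F1v => [c [_ ->]] [].
    have [x x_in GE] := Ggraph_of_wedges r_gt1 le_ar co_ra csW cover GG Gv.
    have [j' [k' [js' jt' {}GE]]] : exists j' k',
        [/\ (j' + k' < bs B)%N, (j' + k' < bt B)%N & Gamma = tee B j' k'].
      by case: x_in GE => [<-|[<-|[<-|[<-|//]]]] /= ->; [exists j.+1, k.+1|exists j, k.+1
        |exists j.+1, k|exists j, k].
    rewrite GE in yv zv ixE jyE kzE.
    have [kxE kyE] := tee_y_valley gB js' jt' ((yv kx ky).2 (conj erefl erefl)).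
    have [jxE jzE] := tee_z_valley gB js' jt' ((zv jx jz).2 (conj erefl erefl)).
    move/(tee_least_x gB js' jt') : ixE => ->.
    move/(tee_least_y gB js' jt') : jyE => jyE; move/(tee_least_z gB js' jt') : kzE => kzE.
    have [u0 Pv Qv] := Bv.
    have nat_inj (x1 x2 : nat) : x1%:R * u v = x2%:R * u v -> x1 = x2.
      by move/(mulIf (lt0r_neq0 u0))/eqP; rewrite eqr_nat => /eqP.
    (* A priori [Gamma] is any of the four graphs around [v]. Evaluating the ratio of F1 at v gives
       P = (jz + 1) u there, which fixes jz, and F2 fixes ky in the same way. *)
    have jzj : jz.+1 = j.+1.
      apply: nat_inj; rewrite -Pv; have [_ _ /(_ v F1v)] := ratio1.
      rewrite !dotmE !monoE jyE jxE jzE !ev_cov3 -subnS natrB; last by lia.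
      by rewrite -natr1; lra.
    have kyk : ky.+1 = k.+1.
      apply: nat_inj; rewrite -Qv; have [_ _ /(_ v F2v)] := ratio2.
      rewrite !dotmE !monoE kzE kxE kyE !ev_cov3 -subnS natrB; last by lia.
      by rewrite -natr1; lra.
    by rewrite jzj kyk.
  - by have := valency_unique val4 val5.
(* The square (j, k) supplies the required graph: [v] is its corner opposite to the origin. *)
have W4 := (csW c4 (or_intror (or_intror (or_intror (or_introl erefl))))).2.
have [F1f F1d F1v] := slice_face W4; have [F2f F2d F2v] := slice_face (wedge_sym W4).
move: F1f F1d F1v F2f F2d F2v; rewrite /= slice_p1 // slice_q1 // => F1f F1d F1v F2f F2d F2v.
apply: (@SC_valency4_lines _ _ _ _ (tee B j k) (bal B).-1 k (bbe B).-1 j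
  (bal B + bbe B) (bt B - j) (bs B - k) (segP B j.+1 k) (segQ B k.+1 j)) => //.
- exact: tee_Ggraph.
- exact: tee_two_valleys.
- exact/tee_least_x.
- exact/tee_least_y.
- exact/tee_least_z.
- rewrite (prednK (bbe_gt0 gB)) -subnS; apply: (ratioP r_gt1 le_ar co_ra gB); first by lia.
  by move=> w [].
- rewrite (prednK (bal_gt0 gB)) -subnS; apply: (ratioQ r_gt1 le_ar co_ra gB); first by lia.
  by move=> w [].
Qed.

(** Five cones surround [v]: the full square below it, the two squares cut by the diagonal, and
    beyond the diagonal two cones obtained by viewing [v] as a point on a leg of the next
    triangle. *)
Lemma diag_case_aux v B j k : good r a B -> (bt B < bs B)%N -> (j.+1 + k.+1 = bt B)%N ->
    at_point B v j.+1 k.+1 ->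
  forall S, is_SC r a v S <-> S = EC1 v.
Proof.
move=> gB ts jkt Bv; have gB' := good_stepQ gB ts; have [u0 Pv Qv] := Bv.
have Bv' : at_point (stepQ B) v j.+1 0.
  by split=> //; rewrite ev_stepQ ?(ltnW ts) // Pv Qv -jkt natrD; ring.
have [|G1 [G2 [i]]] := inner_cones r_gt1 le_ar co_ra gB' (j := j.+1) _ Bv'.
  by rewrite /=; lia.
rewrite /=; set g := _ + i%:R *: _; set mid := slice (sigma r a G2) g.
move=> -[W1 W2 [E1 E2] [Emid mark] [lab1 lab2]].
have mE : minn (bs B) (bt B) = (j + k.+1).+1 by lia.
have mE' : minn (bs B) (bt B) = (j.+1 + k).+1 by lia.
have [js1 jt1] : (j.+1 + k < bs B)%N /\ (j.+1 + k < bt B)%N by lia.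
have [js2 jt2] : (j + k.+1 < bs B)%N /\ (j + k.+1 < bt B)%N by lia.
have [js3 jt3] : (j + k < bs B)%N /\ (j + k < bt B)%N by lia.
have QfE : Qf (stepQ B) = pform B j.+1 + qform B k.+1 :> 'cV[R]_3.
  rewrite Qf_stepQ ?(ltnW ts) // pform0 /pform /qform -jkt natrD.
  by apply/colP => l; rewrite !mxE; ring.
pose c1 : set mon * 'cV[R]_3 * 'cV[R]_3 := (tee B j k, - pform B j.+1, - qform B k.+1).
pose c2 : set mon * 'cV[R]_3 * 'cV[R]_3 := (tee B j.+1 k, pform B j.+1, - Qf (stepQ B)).
pose c3 : set mon * 'cV[R]_3 * 'cV[R]_3 := (tee B j k.+1, - Qf (stepQ B), qform B k.+1).
pose c4 : set mon * 'cV[R]_3 * 'cV[R]_3 := (G1, Qf (stepQ B), - g).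
pose c5 : set mon * 'cV[R]_3 * 'cV[R]_3 := (G2, Qf (stepQ B), g).
pose cs := [:: c1; c2; c3; c4; c5].
have csW x : List.In x cs -> Ggraph r a x.1.1 /\ wedge (sigma r a x.1.1) v x.1.2 x.2.
  case=> [<-|[<-|[<-|[<-|[<-|//]]]]] //=; split; try exact: tee_Ggraph.
  - exact: tee_wedge11.
  - by rewrite QfE; exact: tee_wedge01_diag.
  - by rewrite QfE; exact: tee_wedge10_diag.
have QfEv w : ev (Qf (stepQ B)) w = ev (pform B j.+1) w + ev (qform B k.+1) w.
  by rewrite QfE evDr.
have cover w : exists2 x, List.In x cs & 0 <= ev x.1.2 w /\ 0 <= ev x.2 w.
  have [Q0|Q0] := leP 0 (ev (Qf (stepQ B)) w).
    have [g0|g0] := leP 0 (ev g w).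
      by exists c5; [right; right; right; right; left|].
    by exists c4; [right; right; right; left|rewrite /= evNr; lra].
  have [p0|p0] := leP 0 (ev (pform B j.+1) w).
    by exists c2; [right; left|rewrite /= evNr; lra].
  have [q0|q0] := leP 0 (ev (qform B k.+1) w).
    by exists c3; [right; right; left|rewrite /= evNr; lra].
  by exists c1; [left|rewrite /= !evNr; lra].
have diag2 : slice (R := R) (sigma r a (tee B j.+1 k)) (- Qf (stepQ B)) = segQ (stepQ B) 0 j.+1.
  rewrite (slice_diag r_gt1 le_ar co_ra gB js1 jt1 mE') => [|w]; last first.
    by rewrite evNr ev_stepQ ?(ltnW ts) // (minn_idPr (ltnW ts)); ring.
  rewrite /segD /segQ (minn_idPr (ltnW ts)); apply/seteqP; split=> w [A1 A2 A3].
    by split=> //; rewrite ev_stepQ ?(ltnW ts) //; lra.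
  by split=> //; move: A1; rewrite ev_stepQ ?(ltnW ts) //; lra.
have diag3 : slice (R := R) (sigma r a (tee B j k.+1)) (- Qf (stepQ B)) = segQ (stepQ B) 0 j.
  rewrite (slice_diag r_gt1 le_ar co_ra gB js2 jt2 mE) => [|w]; last first.
    by rewrite evNr ev_stepQ ?(ltnW ts) // (minn_idPr (ltnW ts)); ring.
  rewrite /segD /segQ (minn_idPr (ltnW ts)); apply/seteqP; split=> w [A1 A2 A3].
    by split=> //; rewrite ev_stepQ ?(ltnW ts) //; lra.
  by split=> //; move: A1; rewrite ev_stepQ ?(ltnW ts) //; lra.
pose A1 := segP (R := R) B j.+1 k; pose A2 := segQ (R := R) B k.+1 j.
pose A3 := segQ (R := R) (stepQ B) 0 j; pose A4 := segQ (R := R) (stepQ B) 0 j.+1.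
have edgesE E : edges r a v E <->
    [\/ E = A1, E = mid, E = A3 | E = A4] \/ E = A2.
  rewrite (edges_of_wedges r_gt1 le_ar co_ra csW cover); split=> [[x]|].
    case=> [<-|[<-|[<-|[<-|[<-|//]]]]] /=.
    - by rewrite slice_p1 // slice_q1 // => -[]->; [left; constructor 1|right].
    - by rewrite slice_p0 // diag2 => -[]->; left; [constructor 1|constructor 4].
    - by rewrite slice_q0 // diag3 => -[]->; [left; constructor 3|right].
    - by rewrite E1 Emid => -[]->; left; [constructor 3|constructor 2].
    - by rewrite E2 => -[]->; left; [constructor 4|constructor 2].
  case=> [[]|] ->.
  - by exists c2; [right; left|left; rewrite slice_p0].
  - by exists c5; [right; right; right; right; left|right].
  - by exists c3; [right; right; left|left; rewrite diag3].
  - by exists c2; [right; left|right; rewrite diag2].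
  - by exists c3; [right; right; left|right; rewrite slice_q0].
have fr := frame_at r_gt1 gB Bv.
have ne E E' := @edge_neq R r a v _ _ E E' fr.
have mid_line w : mid w -> 0 <= ev (Qf (stepQ B)) w /\
    ev (pform B j.+1) w + i%:R * ev (Qf (stepQ B)) w = 0.
  by move=> [Sw /=]; rewrite /g evDr evZr => ?; have [] := wedge_ge W2.2 Sw.
have A1E w : A1 w -> ev (pform B j.+1) w = 0 /\ ev (qform B k.+1) w <= 0.
  by move=> [P1 _ Q1]; rewrite !evforms; split; lra.
have A2E w : A2 w -> ev (qform B k.+1) w = 0 /\ ev (pform B j.+1) w <= 0.
  by move=> [Q1 _ P1]; rewrite !evforms; split; lra.
have A3E w : A3 w -> ev (Qf (stepQ B)) w = 0 /\ ev (pform B j.+1) w <= 0.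
  by move=> [Q1 _ P1]; rewrite Q1 !evforms mul0r; split=> //; move: P1; rewrite /=; lra.
have A4E w : A4 w -> ev (Qf (stepQ B)) w = 0 /\ 0 <= ev (pform B j.+1) w.
  by move=> [Q1 P1 _]; rewrite Q1 !evforms mul0r; split=> //; move: P1; rewrite /=; lra.
have edgesS : edges r a v = [set A1; mid; A3; A4; A2].
  apply/seteqP; split=> E.
    by case/edgesE=> [[]|] ->; [left; left; left; left|left; left; left; right
      |left; left; right|left; right|right].
  by move=> [[[[|]|]|]|] ->; apply/edgesE; [left; constructor 1|left; constructor 2
    |left; constructor 3|left; constructor 4|right].
have e1 : edges r a v A1 by apply/edgesE; left; constructor 1.
have e2 : edges r a v mid by apply/edgesE; left; constructor 2.
have e3 : edges r a v A3 by apply/edgesE; left; constructor 3.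
have e4 : edges r a v A4 by apply/edgesE; left; constructor 4.
have e5 : edges r a v A2 by apply/edgesE; right.
have val5 : valency r a v 5.
  rewrite /valency edgesS; apply: card_set5; apply: ne => // w.
  - by move=> /A1E[p0 q0] /mid_line[]; rewrite QfEv; split; lra.
  - by move=> /A1E[p0 q0] /A3E[]; rewrite QfEv; split; lra.
  - by move=> /A1E[p0 q0] /A4E[]; rewrite QfEv; split; lra.
  - by move=> /A1E[p0 q0] /A2E[]; split; lra.
  - move=> /mid_line[+ + ] /A3E[Q0 _]; rewrite Q0 mulr0 addr0 => _ p0.
    by move: Q0; rewrite QfEv p0 => q0; split; lra.
  - move=> /mid_line[+ + ] /A4E[Q0 _]; rewrite Q0 mulr0 addr0 => _ p0.
    by move: Q0; rewrite QfEv p0 => q0; split; lra.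
  - move=> /mid_line[+ + ] /A2E[q0 p0]; rewrite QfEv q0 addr0 => p0'.
    have -> : ev (pform B j.+1) w = 0 by lra.
    by [].
  - by move=> /A3E[Q0 p0] /A4E[_ p0']; move: Q0; rewrite QfEv => Q0; split; lra.
  - by move=> /A3E[Q0 p0] /A2E[q0 _]; move: Q0; rewrite QfEv => Q0; split; lra.
  - by move=> /A4E[Q0 p0] /A2E[q0 _]; move: Q0; rewrite QfEv => Q0; split; lra.
have st_r := basis_sum_le gB.
(* [A1] and [mid] carry the same character even when [mid] does not continue [A1] in a straight
   line; [A3] and [A4] form the diagonal, and [A2] is the fifth edge. With j + 1 + k + 1 = t, the
   product of m1 and m2 has exponent t - s + k + 1. *)
pose m1 := tau r a ((bt B)%:Z - j.+1%:Z); pose m2 := tau r a ((bt B)%:Z - (bs B)%:Z).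
pose m3 := tau r a (k.+1%:Z - (bs B)%:Z).
have mk1 : marked r a A1 m1.
  by apply: (markP r_gt1 le_ar co_ra gB) => [|w []]; first by lia.
have mk2 : marked r a mid m1 by [].
have m2E : m2 = tau r a (0%N%:Z - (bs (stepQ B))%:Z).
  by rewrite /m2 /= -subzn ?(ltnW ts) //; congr tau; ring.
have mk3 : marked r a A3 m2 by rewrite m2E; apply: (markQ r_gt1 le_ar co_ra gB') => // w [].
have mk4 : marked r a A4 m2 by rewrite m2E; apply: (markQ r_gt1 le_ar co_ra gB') => // w [].
have mk5 : marked r a A2 m3.
  by apply: (markQ r_gt1 le_ar co_ra gB) => [|w []]; first by lia.
have tau_neq (x y : int) : `|x - y| < r%:Z -> x <> y -> tau r a x != tau r a y.
  by move=> lt ne_xy; apply/eqP => /tau_inj E; apply: ne_xy; apply: E.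
have EC1E : EC1 v = [set m1 + m2].
  have -> : m1 + m2 = tau r a ((bt B)%:Z - (bs B)%:Z + k.+1%:Z).
    by rewrite -tauD; congr tau; lia.
  apply/seteqP; split=> c; rewrite (EC_of_wedges r_gt1 le_ar co_ra c csW cover).
    (* The two cut squares have only the exponent k + 1 in common, since the labels with condition j
       + k + 2 < t are absent from both. *)
    move=> H; have := H _ (or_intror (or_introl erefl)).
    have := H _ (or_intror (or_intror (or_introl erefl))) => /=.
    move=> /(tee_labelP r_gt1 le_ar gB js2 jt2)[n Hn ->].
    move=> /(tee_labelP r_gt1 le_ar gB js1 jt1)[n' Hn'] /tau_inj E.
    have {}E : (bt B)%:Z - (bs B)%:Z + n = (bt B)%:Z - (bs B)%:Z + n'.
      by apply: E => //; case: Hn => -[-> ?]; case: Hn' => -[-> ?]; lia.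
    have -> : n = k.+1%:Z by case: Hn => -[? ?]; case: Hn' => -[? ?]; lia.
    by [].
  move=> -> x; case=> [<-|[<-|[<-|[<-|[<-|//]]]]] /=.
  - by apply: label_tee_tau => //; constructor 3; split; lia.
  - by apply: label_tee_tau => //; constructor 3; split; lia.
  - by apply: label_tee_tau => //; constructor 1; split=> //; left.
  - by move: lab1; rewrite -subzn ?(ltnW ts) //; congr (label _ _ _ (tau _ _ _)); lia.
  - by move: lab2; rewrite -subzn ?(ltnW ts) //; congr (label _ _ _ (tau _ _ _)); lia.
rewrite EC1E => S; split=> [|->]; last first.
  apply: (@SC_valency5 _ _ _ _ A1 mid A3 A4 A2 m1 m2 m3) => //; apply: tau_neq; lia.
case=> [val3|k' l val4|Gamma kx ky jx jz ix jy kz F1 F2 val4|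
    F1 F2 F3 F4 F5 cl cm cf _ FE n1 n2 n3 n4 _ clm _ _].
- by have := valency_unique val3 val5.
- by have := valency_unique val4 val5.
- by have := valency_unique val4 val5.
have val5' := val5; rewrite /valency FE in val5'; have [F12 F34] := card_set5_neq val5'.
have uniq_mark E c c' : edges r a v E -> marked r a E c -> marked r a E c' -> c = c'.
  by move=> /edge_dim E_dim; exact: (marked_unique r_gt1 le_ar co_ra E_dim).
(* A character on two distinct edges is m1 or m2: an edge with another mark can only be [A2]. So the
   choice of pairs does not affect the product. *)
have pair E E' c : edges r a v E -> edges r a v E' -> E <> E' ->
    marked r a E c -> marked r a E' c -> c = m1 \/ c = m2.
  move=> Ee E'e EE' mE1 mE2.
  have H F : edges r a v F -> marked r a F c -> [\/ c = m1, c = m2 | c = m3 /\ F = A2].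
    move=> Fe mF; case/edgesE: (Fe) => [[]|] F_eq; rewrite F_eq in mF Fe.
    - by constructor 1; exact: uniq_mark Fe mF mk1.
    - by constructor 1; exact: uniq_mark Fe mF mk2.
    - by constructor 2; exact: uniq_mark Fe mF mk3.
    - by constructor 2; exact: uniq_mark Fe mF mk4.
    - by constructor 3; split=> //; exact: uniq_mark Fe mF mk5.
  have [|//|[_ EA]] := H E Ee mE1; [by left | by right |].
  by have [|//|[_ E'A]] := H E' E'e mE2; [left | right | case: EE'; rewrite EA E'A].
have Fe E : [set F1; F2; F3; F4; F5] E -> edges r a v E by rewrite FE.
have f1 : edges r a v F1 by apply: Fe; left; left; left; left.
have f2 : edges r a v F2 by apply: Fe; left; left; left; right.
have f3 : edges r a v F3 by apply: Fe; left; left; right.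
have f4 : edges r a v F4 by apply: Fe; left; right.
have [clE|clE] := pair _ _ _ f1 f2 F12 n1 n2; have [cmE|cmE] := pair _ _ _ f3 f4 F34 n3 n4.
- by move: clm; rewrite clE cmE eqxx.
- by rewrite clE cmE.
- by rewrite clE cmE (addrC m2).
- by move: clm; rewrite clE cmE eqxx.
Qed.

Lemma diag_case v B j : good r a B -> (bt B < bs B)%N -> (0 < j < bt B)%N ->
    at_point B v j (bt B - j) ->
  forall S, is_SC r a v S <-> S = EC1 v.
Proof.
case: j => // j gB ts /= jt Bv.
have [k kE] : exists k, (bt B - j.+1 = k.+1)%N by exists (bt B - j.+1).-1; lia.
by rewrite kE in Bv; apply: (diag_case_aux gB ts _ Bv); lia.
Qed.

End Cases.

(** * Exchange of y and z *)

Section Exchange.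
Variable R : realType.
Implicit Types (v w : 'rV[R]_3) (E F S : set 'rV[R]_3).

Definition swapv w : 'rV[R]_3 := col_perm (tperm 1 2) w.
Definition swapS S : set 'rV[R]_3 := [set w | S (swapv w)].

Lemma swapvK : involutive swapv.
Proof. by move=> w; apply/rowP => i; rewrite !mxE tpermK. Qed.

Lemma swapSK : involutive swapS.
Proof. by move=> S; apply/seteqP; split=> w; rewrite /swapS /= swapvK. Qed.

Lemma swapvE w : [/\ swapv w 0 0 = w 0 0, swapv w 0 1 = w 0 2 & swapv w 0 2 = w 0 1].
Proof. by rewrite !mxE tpermL tpermR tpermD. Qed.

Lemma swapvM w : swapv w = w *m tperm_mx 1 2.
Proof. by rewrite /swapv col_permE tpermV. Qed.

Lemma tperm_mxK n (c : 'M[R]_(3, n)) : tperm_mx 1 2 *m (tperm_mx 1 2 *m c) = c.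
Proof. by rewrite mulmxA -perm_mxM tperm2 perm_mx1 mul1mx. Qed.

Lemma dotm_swap w X : dotm (swapv w) (swapm X) = dotm w X.
Proof. by have [w0 w1 w2] := swapvE w; rewrite !dotmE !monoE w0 w1 w2 addrAC. Qed.

Lemma is_face_swap F S : is_face F S -> is_face (swapS F) (swapS S).
Proof.
move=> [c [Sc ->]]; exists (tperm_mx 1 2 *m c); split=> [w Sw|].
  by rewrite mulmxA -swapvM; exact: Sc.
by apply/seteqP; split=> w; rewrite /swapS /= swapvM mulmxA.
Qed.

Lemma has_dim_swap F k : has_dim F k -> has_dim (swapS F) k.
Proof.
move=> [B [Bfree FB Fsub]]; exists (B *m tperm_mx 1 2); split=> [|i|w Fw].
- by rewrite /row_free mxrankMfree // row_free_unit unitmx_perm.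
- by rewrite row_mul -swapvM /swapS /= swapvK.
- by rewrite -[w]swapvK swapvM submxMr //; exact: Fsub.
Qed.

Lemma swapS_cone2 v v' : swapS (cone2 v v') = cone2 (swapv v) (swapv v').
Proof.
apply/seteqP; split=> w [s [t [s0 t0 wE]]]; exists s, t; split=> //.
  by rewrite -[w]swapvK wE !swapvM mulmxDl -!scalemxAl.
by rewrite wE !swapvM mulmxDl -!scalemxAl -!swapvM !swapvK.
Qed.

Lemma swapv_e0 : swapv (e_ R 0) = e_ R 0.
Proof.
have [w0 w1 w2] := swapvE (e_ R 0).
by apply: rV3_eq; rewrite ?w0 ?w1 ?w2 ?mxE.
Qed.

Lemma swap_image (D : set (set 'rV[R]_3)) (D' : set (set 'rV[R]_3)) :
  (forall E, D' (swapS E) <-> D E) -> D' = swapS @` D.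
Proof.
move=> DD'; apply/seteqP; split=> E.
  by move=> D'E; exists (swapS E); rewrite ?swapSK // -DD' swapSK.
by move=> [E' DE' <-]; apply/DD'.
Qed.

Variables (r a : nat) (r_gt1 : (1 < r)%N) (le_ar : (a <= r)%N).

Lemma min_gen_swap Gamma X : min_gen (swapG Gamma) (swapm X) <-> min_gen Gamma X.
Proof.
rewrite /min_gen /swapG /= swapmK; split=> -[nGX X_min]; split=> // Y nGY YX.
  apply: (can_inj swapmK); apply: X_min; first by rewrite swapmK.
  by rewrite dvdm_swapm.
by rewrite -[Y]swapmK (X_min (swapm Y)) // -dvdm_swapm swapmK.
Qed.

Lemma sigma_swap Gamma : sigma r (r - a) (swapG Gamma) = swapS (sigma r a Gamma).
Proof.
apply/seteqP; split=> w Sw X Y X_min GY wtY.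
  rewrite -(dotm_swap _ X) -(dotm_swap _ Y) swapvK; apply: Sw.
  - exact/min_gen_swap.
  - by rewrite /swapG /= swapmK.
  - by rewrite !wt_swapm.
rewrite -(dotm_swap _ X) -(dotm_swap _ Y); apply: Sw => //.
  by apply/min_gen_swap; rewrite swapmK.
by rewrite -!(wt_swapm _ r_gt1 le_ar) !swapmK.
Qed.

Lemma socle_swap Gamma X : socle Gamma X -> socle (swapG Gamma) (swapm X).
Proof.
rewrite /socle /swapG /= swapmK => -[GX X_max]; split=> // Y GY XY.
by rewrite -[Y]swapmK (X_max (swapm Y)) // -dvdm_swapm swapmK.
Qed.

Lemma fan_cone_swap k F : fan_cone r a k F -> fan_cone r (r - a) k (swapS F).
Proof.
move=> [Gamma [GG F_face F_dim]]; exists (swapG Gamma); split.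
- exact: Ggraph_swap.
- by rewrite sigma_swap; exact: is_face_swap.
- exact: has_dim_swap.
Qed.

Lemma edges_swap_sub v E : edges r a v E -> edges r (r - a) (swapv v) (swapS E).
Proof. by move=> [Ef Ev]; split; [exact: fan_cone_swap | rewrite /swapS /= swapvK]. Qed.

Lemma has_ratio_swap E m1 m2 : has_ratio r a E m1 m2 ->
  has_ratio r (r - a) (swapS E) (swapm m1) (swapm m2).
Proof.
have inv_swap (q q' : 'rV[int]_3) : q' 0 0 = q 0 0 -> q' 0 1 = q 0 2 -> q' 0 2 = q 0 1 ->
    Defs.invariant r (r - a) q' <-> Defs.invariant r a q.
  move=> q0 q1 q2; rewrite !invariantE ?leq_subr // q0 q1 q2 -subzn //.
  by split=> /dvdzP[p pE]; apply/dvdzP;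
    [exists (p + q 0 1 - q 0 2) | exists (p + q 0 2 - q 0 1)];
    rewrite !(mulrDl, mulrBl) -pE; ring.
have quoE X Y : quotient (swapm X) (swapm Y) = col_perm (tperm 1 2) (quotient X Y).
  by apply/rowP; apply: ord3P; rewrite !mxE ?tpermL ?tpermR ?tpermD // !monoE.
have permE (q : 'rV[int]_3) : [/\ col_perm (tperm 1 2) q 0 0 = q 0 0,
    col_perm (tperm 1 2) q 0 1 = q 0 2 & col_perm (tperm 1 2) q 0 2 = q 0 1].
  by rewrite !mxE tpermL tpermR tpermD.
have permK (q : 'rV[int]_3) : col_perm (tperm 1 2) (col_perm (tperm 1 2) q) = q.
  by apply/rowP => i; rewrite !mxE tpermK.
move=> [co [q_inv q0 q_prim] Ew]; split=> [X X1 X2||w Ew'].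
- rewrite -[X]swapmK (co (swapm X)); first by apply: mon_eq; rewrite monoE !mnm0E.
    by rewrite -dvdm_swapm swapmK.
  by rewrite -dvdm_swapm swapmK.
- rewrite quoE; have [p0 p1 p2] := permE (quotient m1 m2); split.
  + exact/(inv_swap (quotient m1 m2)).
  + by apply: contraNneq q0 => qp0; rewrite -[quotient m1 m2]permK qp0; apply/eqP/rowP => i;
      rewrite !mxE.
  + move=> u k u_inv uE; have [u0 u1 u2] := permE u.
    apply: (q_prim (col_perm (tperm 1 2) u)); first by apply/(inv_swap _ u); rewrite ?u0 ?u1 ?u2.
    rewrite -[LHS]permK uE; apply/rowP => i; rewrite mxE !mulmxnE mxE.
    by [].
- by rewrite -[w]swapvK !dotm_swap; exact: Ew.
Qed.

Lemma has_ratio_wt E m1 m2 : has_ratio r a E m1 m2 -> wt r a m1 = wt r a m2.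
Proof.
move=> [_ [/(invariantE r_gt1 le_ar) q_inv _ _] _].
apply/(wt_eqP _ _ r_gt1 le_ar); move: q_inv; have [-> -> ->] := quotientE m1 m2.
by congr (_ %| _)%Z; rewrite /cls; ring.
Qed.

Lemma has_ratio_sym E m1 m2 : has_ratio r a E m1 m2 -> has_ratio r a E m2 m1.
Proof.
move=> [co [q_inv q0 q_prim] Ew].
have qN : quotient m2 m1 = - quotient m1 m2 by apply/rowP => i; rewrite !mxE; ring.
have invN (q : 'rV[int]_3) : Defs.invariant r a (- q) <-> Defs.invariant r a q.
  rewrite !invariantE //.
  have -> : (- q) 0 0 + a%:Z * ((- q) 0 1 - (- q) 0 2) =
      - (q 0 0 + a%:Z * (q 0 1 - q 0 2)) by rewrite !mxE; ring.
  by rewrite rpredN.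
split=> [X X1 X2||w /Ew //]; first exact: co.
rewrite qN; split; [exact/invN | by rewrite oppr_eq0 |].
move=> u k u_inv uE; apply: (q_prim (- u)); first exact/invN.
by rewrite -[LHS]opprK uE mulNrn.
Qed.

Lemma marked_swap E c : marked r a E c -> marked r (r - a) (swapS E) c.
Proof.
move=> [m1 [m2 [rat w1 w2]]]; exists (swapm m1), (swapm m2).
by rewrite !wt_swapm //; split=> //; exact: has_ratio_swap.
Qed.

End Exchange.

Arguments swapS {R} S.

(** * Invariance of both sides under the exchange *)

Section ExchangeSC.
Variable R : realType.

Lemma edges_swap r a (v : 'rV[R]_3) E : (1 < r)%N -> (a <= r)%N ->
  edges r (r - a) (swapv v) (swapS E) <-> edges r a v E.
Proof.
move=> r_gt1 le_ar; split; last exact: edges_swap_sub.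
move=> /(edges_swap_sub r_gt1 (leq_subr a r)).
by rewrite subKn // swapvK swapSK.
Qed.

Lemma EC_swap_sub r a (v : 'rV[R]_3) : (1 < r)%N -> (a <= r)%N ->
  EC r (r - a) (swapv v) `<=` EC r a v.
Proof.
move=> r_gt1 le_ar c ECc Gamma [GG Gv].
have [|X SX <-] := ECc (swapG Gamma).
  by split; [exact: Ggraph_swap | rewrite sigma_swap // /swapS /= swapvK].
exists (swapm X); first by rewrite -[Gamma]swapGK; exact: socle_swap.
by rewrite -(wt_swapm _ r_gt1 le_ar) swapmK.
Qed.

Lemma EC_swap r a (v : 'rV[R]_3) : (1 < r)%N -> (a <= r)%N ->
  EC r (r - a) (swapv v) = EC r a v.
Proof.
move=> r_gt1 le_ar; apply/seteqP; split; first exact: EC_swap_sub.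
have := @EC_swap_sub r (r - a) (swapv v) r_gt1 (leq_subr a r).
by rewrite subKn // swapvK.
Qed.

Lemma is_SC_swap_sub r a (v : 'rV[R]_3) S : (1 < r)%N -> (a <= r)%N ->
  is_SC r a v S -> is_SC r (r - a) (swapv v) S.
Proof.
move=> r_gt1 le_ar.
have edgesE E := edges_swap v E r_gt1 le_ar.
have edges_im := swap_image edgesE.
have val n : valency r (r - a) (swapv v) n <-> valency r a v n.
  have im : (swapS @` edges r a v #= edges r a v)%card.
    by apply: inj_card_eq => E E' _ _; apply: (can_inj (@swapSK R)).
  rewrite /valency edges_im; split=> H; last exact: card_eq_trans im H.
  exact: card_eq_trans (card_esym im) H.
have lines r' a' (v' : 'rV[R]_3) : (1 < r')%N -> (a' <= r')%N ->
    two_lines r' a' v' -> two_lines r' (r' - a') (swapv v').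
  move=> r'_gt1 le_ar' [E1 [E2 [E3 [E4 [u1 [u2 [EE [u10 u20] pl1 pl2]]]]]]].
  exists (swapS E1), (swapS E2), (swapS E3), (swapS E4).
  exists (tperm_mx 1 2 *m u1), (tperm_mx 1 2 *m u2); split.
  - rewrite (swap_image (fun E => edges_swap v' E r'_gt1 le_ar')) EE.
    by rewrite !image_setU !image_set1.
  - by split; [apply: contraNneq u10 | apply: contraNneq u20] => u0;
      rewrite -[X in X == 0]tperm_mxK u0 mulmx0.
  - move=> w Ew; rewrite /plane /= mulmxA -swapvM; apply: pl1.
    by case: Ew => ?; [left | right].
  - move=> w Ew; rewrite /plane /= mulmxA -swapvM; apply: pl2.
    by case: Ew => ?; [left | right].
have linesE : two_lines r (r - a) (swapv v) <-> two_lines r a v.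
  split; last exact: lines.
  by move=> /(lines _ _ _ r_gt1 (leq_subr a r)); rewrite subKn // swapvK.
have wtS X : wt r a X = wt r (r - a) (swapm X) by rewrite wt_swapm.
case=> [v3|i j v4 nl eE rat|Gamma kx ky jx jz ix jy kz F1 F2 v4 l2 GG [yv zv] ixE jyE kzE
    [F1f F1d] F1v rat1 [F2f F2d] F2v rat2|E1 E2 E3 E4 E5 cl cm cf v5 EE k1 k2 k3 k4 k5 n1 n2 n3].
- by rewrite wtS swapm_mono; apply: SC_valency3; apply/val.
- have coneE : swapS (cone2 (e_ R 0) v) = cone2 (e_ R 0) (swapv v).
    by rewrite swapS_cone2 swapv_e0.
  (* This case names the weight of y^j, which the exchange turns into a power of z; the ratio gives
     z^i the same weight, and z^i becomes the required power of y. *)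
  rewrite (has_ratio_wt r_gt1 le_ar rat) !wtS !swapm_mono.
  apply: (@SC_valency4_not_lines _ _ _ _ j i); [exact/val | by move/linesE | |].
    by rewrite -coneE; apply/edgesE.
  rewrite -coneE; apply: has_ratio_sym => //; first exact: leq_subr.
  by have := has_ratio_swap r_gt1 le_ar rat; rewrite !swapm_mono.
- have GE i j k : swapG Gamma (mono i j k) = Gamma (mono i k j).
    by rewrite /swapG /= swapm_mono.
  have least (l l' : 'I_3) n : (forall i, swapm (U_(l') *+ i)%MM = (U_(l) *+ i)%MM) ->
      least_exponent Gamma l n -> least_exponent (swapG Gamma) l' n.
    move=> lE [nG Gn]; split; first by rewrite /swapG /= lE.
    by move=> i /Gn; rewrite /swapG /= lE.
  rewrite !wtS !swapm_mono [X in is_SC _ _ _ X]setUC.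
  (* The valleys, the least exponents and the two facets trade places, and so do the two
     characters. *)
  apply: (@SC_valency4_lines _ _ _ _ (swapG Gamma) jx jz kx ky ix kz jy (swapS F2) (swapS F1)).
  + exact/val.
  + exact/linesE.
  + exact: Ggraph_swap.
  + by split=> m n; rewrite -?yv -?zv /y_valley /z_valley !GE.
  + apply: least ixE => i; have [-> _ _] := pow_mono i; exact: swapm_mono.
  + by apply: least kzE => i; have [_ -> ->] := pow_mono i; exact: swapm_mono.
  + by apply: least jyE => i; have [_ -> ->] := pow_mono i; exact: swapm_mono.
  + by split; [rewrite sigma_swap //; exact: is_face_swap | exact: has_dim_swap].
  + by rewrite /swapS /= swapvK.
  + by have := has_ratio_swap r_gt1 le_ar rat2; rewrite !swapm_mono.
  + by split; [rewrite sigma_swap //; exact: is_face_swap | exact: has_dim_swap].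
  + by rewrite /swapS /= swapvK.
  + by have := has_ratio_swap r_gt1 le_ar rat1; rewrite !swapm_mono.
- apply: (@SC_valency5 _ _ _ _ (swapS E1) (swapS E2) (swapS E3) (swapS E4) (swapS E5) cl cm cf)
    => //; try exact: marked_swap; first exact/val.
  by rewrite edges_im EE !image_setU !image_set1.
Qed.

Lemma is_SC_swap r a (v : 'rV[R]_3) S : (1 < r)%N -> (a <= r)%N ->
  is_SC r (r - a) (swapv v) S <-> is_SC r a v S.
Proof.
move=> r_gt1 le_ar; split; last exact: is_SC_swap_sub.
by move=> /(is_SC_swap_sub r_gt1 (leq_subr a r)); rewrite subKn // swapvK.
Qed.

(** The exchange sends (m, i) to (m, -i), so the two basis vectors trade their roles. *)
Definition swapB (B : basis) := Basis (bbe B) (bal B) (bt B) (bs B).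

Lemma good_swap r a B : (a <= r)%N -> good r a B -> good r (r - a) (swapB B).
Proof.
move=> le_ar; case: B => al be s t [/= al0 be0 s0 t0 /dvdzP[qa qaE] /dvdzP[qb qbE] det].
split=> //=; last by rewrite addnC.
  by apply/dvdzP; exists (qb + t%:Z); rewrite -subzn //; lia.
by apply/dvdzP; exists (qa - s%:Z); rewrite -subzn //; lia.
Qed.

Lemma at_point_swap B (v : 'rV[R]_3) j k : at_point B v j k -> at_point (swapB B) (swapv v) k j.
Proof.
have [w0 w1 w2] := swapvE v.
have uE : ev uf (swapv v) = ev uf v by rewrite !ev_cov3 w0 w1 w2; ring.
have PE : ev (Pf (swapB B)) (swapv v) = ev (Qf B) v by rewrite !ev_cov3 w0 w1 w2 /=; ring.
have QE : ev (Qf (swapB B)) (swapv v) = ev (Pf B) v by rewrite !ev_cov3 w0 w1 w2 /=; ring.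
by move=> [u0 Pv Qv]; split; rewrite ?PE ?QE uE.
Qed.

End ExchangeSC.

Theorem theorem1p1 (R : realType) (r a : nat)
    (r_gt0 : (0 < r)%N) (a_gt0 : (0 < a)%N)
    (coprime_ra : coprime r a) (a_lt : (a < r - a)%N)
    (v : 'rV[R]_3) (v_vertex : vertex r a v) (S : set 'Z_r) :
  is_SC r a v S <-> S = [set c + chi r 1 | c in EC r a v].
Proof.
have r_gt2 : (2 < r)%N by lia.
have r_gt1 : (1 < r)%N by lia.
have le_ar : (a <= r)%N by lia.
have co' := coprime_subr le_ar coprime_ra.
case: (vertex_normal r_gt1 le_ar coprime_ra v_vertex).
- by move=> B gB al1 be1 Bv; exact: (apex_case r_gt2 le_ar coprime_ra gB al1 be1 Bv).
- by move=> B j gB al1 be1 jt Bv; exact: (side_case r_gt2 le_ar coprime_ra gB al1 be1 jt Bv).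
(* A point on the side P = 0 becomes a point on the side Q = 0 for the group with r - a in place of
   a. *)
- move=> B k gB al1 be1 ks Bv; rewrite -is_SC_swap // -EC_swap //.
  exact: (side_case r_gt2 (leq_subr a r) co' (good_swap le_ar gB) be1 al1 ks (at_point_swap Bv)).
- by move=> B j k gB j0 k0 js jt Bv; exact: (inner_case r_gt2 le_ar coprime_ra gB j0 k0 js jt Bv).
- by move=> B j gB ts jt Bv; exact: (diag_case r_gt2 le_ar coprime_ra gB ts jt Bv).
- move=> B k gB st ks Bv; rewrite -is_SC_swap // -EC_swap //.
  exact: (diag_case r_gt2 (leq_subr a r) co' (good_swap le_ar gB) st ks (at_point_swap Bv)).
Qed.
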